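(* Let $n$ be a positive integer. The category $\mathscr{G}\mathscr{Z}$ of Gelfand--Zeitlin modules over $\mathfrak{gl}_n(\mathbb{C})$ is extension full in the category $U(\mathfrak{gl}_n(\mathbb{C}))\text{-}\mathrm{Mod}$ of all $\mathfrak{gl}_n(\mathbb{C})$-modules.
   Context: Gelfand--Zeitlin modules. For $k\ge 1$ let $\mathfrak{g}_k=\mathfrak{gl}_k(\mathbb{C})$, let $U_k=U(\mathfrak{g}_k)$ be its universal enveloping algebra and $Z_k$ the center of $U_k$. Consider the chain $\mathfrak{g}_1\subset\mathfrak{g}_2\subset\dots\subset\mathfrak{g}_n$ of left upper corner embeddings and the induced chain $U_1\subset U_2\subset\dots\subset U_n=:U$. The Gelfand--Zeitlin subalgebra $\Gamma$ is the (commutative) subalgebra of $U$ generated by $Z_1,Z_2,\dots,Z_n$. The category $\mathscr{G}\mathscr{Z}$ is the full subcategory of the category of finitely generated $U$-modules consisting of those $M$ on which $\Gamma$ acts locally finitely, i.e. $\dim(\Gamma v)<\infty$ for all $v\in M$. Extensions. For an Abelian category $\mathcal{A}$, objects $M,N$ and $d\ge 0$, $\mathrm{Ext}^d_{\mathcal{A}}(M,N)$ denotes the Yoneda extension group: $\mathrm{Ext}^0_{\mathcal{A}}=\mathrm{Hom}_{\mathcal{A}}$, and for $d\geq 1$ it is the set of equivalence classes of exact sequences $0\to N\to X_1\to\dots\to X_d\to M\to 0$ in $\mathcal{A}$ modulo the equivalence relation generated by morphisms of such sequences which are identities on $N$ and $M$; it is an Abelian group under Baer sum. Extension fullness. Let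 $\mathcal{B}$ be a full Abelian subcategory of an Abelian category $\mathcal{A}$, with Abelian structure inherited from $\mathcal{A}$ (so that the inclusion is exact). The inclusion induces homomorphisms $\iota^d_{M,N}:\mathrm{Ext}^d_{\mathcal{B}}(M,N)\to\mathrm{Ext}^d_{\mathcal{A}}(M,N)$ for $M,N\in\mathcal{B}$, $d\ge 0$. $\mathcal{B}$ is extension full in $\mathcal{A}$ if $\iota^d_{M,N}$ is bijective for all $d\ge 0$ and all $M,N\in\mathcal{B}$. *)

(* Defs.v *)
From HB Require Import structures.
From mathcomp Require Import all_boot all_order all_algebra generic_quotient.
From mathcomp Require Import boolp classical_sets reals.
From mathcomp.real_closed Require Import complex.
From Stdlib Require Import Relation_Operators.

Set Implicit Arguments.
Unset Strict Implicit.
Unset Printing Implicit Defensive.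

Import GRing.Theory.
Local Open Scope ring_scope.
Local Open Scope quotient_scope.
Local Open Scope classical_set_scope.

(* The universal enveloping algebra of a Lie algebra (V, br) over a field K,  *)
(* by generators and relations: formal non-commutative polynomial expressions *)
(* in the elements of V, modulo the smallest congruence containing the axioms *)
(* of associative unital K-algebras, the linearity of V -> U(V), and          *)
(* [x, y] = x y - y x.                                                        *)

Inductive uea_term (K V : Type) : Type :=
| UGen of V
| UCst of K
| UAdd of uea_term K V & uea_term K V
| UMul of uea_term K V & uea_term K V.
Arguments UGen {K V}.
Arguments UCst {K V}.

HB.instance Definition _ (K V : Type) := gen_eqMixin (uea_term K V).
HB.instance Definition _ (K V : Type) := gen_choiceMixin (uea_term K V).

Inductive uea_eq (K : fieldType) (V : lmodType K) (br : V -> V -> V) :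
    uea_term K V -> uea_term K V -> Prop :=
| ueq_refl s : uea_eq br s s
| ueq_sym s t : uea_eq br s t -> uea_eq br t s
| ueq_trans s t u : uea_eq br s t -> uea_eq br t u -> uea_eq br s u
| ueq_add s s' t t' : uea_eq br s s' -> uea_eq br t t' ->
    uea_eq br (UAdd s t) (UAdd s' t')
| ueq_mul s s' t t' : uea_eq br s s' -> uea_eq br t t' ->
    uea_eq br (UMul s t) (UMul s' t')
| ueq_addA s t u : uea_eq br (UAdd s (UAdd t u)) (UAdd (UAdd s t) u)
| ueq_addC s t : uea_eq br (UAdd s t) (UAdd t s)
| ueq_add0 s : uea_eq br (UAdd (UCst 0) s) s
| ueq_addN s : uea_eq br (UAdd (UMul (UCst (-1)) s) s) (UCst 0)
| ueq_mulA s t u : uea_eq br (UMul s (UMul t u)) (UMul (UMul s t) u)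
| ueq_mul1 s : uea_eq br (UMul (UCst 1) s) s
| ueq_mulDl s t u :
    uea_eq br (UMul (UAdd s t) u) (UAdd (UMul s u) (UMul t u))
| ueq_mulDr s t u :
    uea_eq br (UMul s (UAdd t u)) (UAdd (UMul s t) (UMul s u))
| ueq_cstD a b : uea_eq br (UAdd (UCst a) (UCst b)) (UCst (a + b))
| ueq_cstM a b : uea_eq br (UMul (UCst a) (UCst b)) (UCst (a * b))
| ueq_cstC a s : uea_eq br (UMul (UCst a) s) (UMul s (UCst a))
| ueq_genP a x y :
    uea_eq br (UGen (a *: x + y)) (UAdd (UMul (UCst a) (UGen x)) (UGen y))
| ueq_lie x y : uea_eq br (UGen (br x y))
    (UAdd (UMul (UGen x) (UGen y))
          (UMul (UCst (-1)) (UMul (UGen y) (UGen x)))).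

Fixpoint uea_eval (K : fieldType) (V : lmodType K) (A : algType K)
    (f : V -> A) (t : uea_term K V) : A :=
  match t with
  | UGen x => f x
  | UCst a => a%:A
  | UAdd s u => uea_eval f s + uea_eval f u
  | UMul s u => uea_eval f s * uea_eval f u
  end.

Lemma uea_eval_eq (K : fieldType) (V : lmodType K) (br : V -> V -> V)
    (A : algType K) (f : V -> A) :
  linear f -> (forall x y, f (br x y) = f x * f y - f y * f x) ->
  forall s t, uea_eq br s t -> uea_eval f s = uea_eval f t.
Proof.
move=> flin flie s t; elim=> {s t} /=.
- by [].
- by move=> s t _ ->.
- by move=> s t u _ -> _ ->.
- by move=> s s' t t' _ -> _ ->.
- by move=> s s' t t' _ -> _ ->.
- by move=> s t u; rewrite addrA.
- by move=> s t; rewrite addrC.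
- by move=> s; rewrite scale0r add0r.
- by move=> s; rewrite scaleN1r mulN1r addNr scale0r.
- by move=> s t u; rewrite mulrA.
- by move=> s; rewrite scale1r mul1r.
- by move=> s t u; rewrite mulrDl.
- by move=> s t u; rewrite mulrDr.
- by move=> a b; rewrite scalerDl.
- by move=> a b; rewrite -scalerAl mul1r scalerA.
- by move=> a s; rewrite -scalerAl mul1r -scalerAr mulr1.
- by move=> a x y; rewrite flin -scalerAl mul1r.
- by move=> x y; rewrite flie scaleN1r mulN1r.
Qed.

Section Uea.
Variables (K : fieldType) (V : lmodType K) (br : V -> V -> V).

Definition uea_rel (s t : uea_term K V) : bool := `[< uea_eq br s t >].

Lemma uea_rel_refl : reflexive uea_rel.
Proof. by move=> s; apply/asboolP; apply: ueq_refl. Qed.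
Lemma uea_rel_sym : symmetric uea_rel.
Proof. by move=> s t; apply/asboolP/asboolP; apply: ueq_sym. Qed.
Lemma uea_rel_trans : transitive uea_rel.
Proof.
by move=> t s u /asboolP st /asboolP tu; apply/asboolP; apply: ueq_trans st tu.
Qed.

Canonical uea_equiv := EquivRel uea_rel uea_rel_refl uea_rel_sym uea_rel_trans.

Definition uea := {eq_quot uea_equiv}.
HB.instance Definition _ := Choice.on uea.

Definition uea_pi (t : uea_term K V) : uea := \pi_({eq_quot uea_equiv}) t.
Definition uea_repr (u : uea) : uea_term K V :=
  repr (u : {eq_quot uea_equiv}).

Lemma uea_reprK u : uea_pi (uea_repr u) = u.
Proof. exact: reprK. Qed.

Lemma uea_piP s t : uea_pi s = uea_pi t <-> uea_eq br s t.
Proof.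
split=> [/eqP|H]; first by rewrite eqmodE => /asboolP.
by apply/eqP; rewrite eqmodE; apply/asboolP.
Qed.

Lemma uea_repr_pi t : uea_eq br (uea_repr (uea_pi t)) t.
Proof. by apply/uea_piP; rewrite uea_reprK. Qed.

Lemma uea_ind (P : uea -> Prop) : (forall t, P (uea_pi t)) -> forall u, P u.
Proof. by move=> H u; rewrite -(uea_reprK u). Qed.

Definition uea_cst (a : K) : uea := uea_pi (UCst a).
Definition uea_add (u v : uea) : uea := uea_pi (UAdd (uea_repr u) (uea_repr v)).
Definition uea_mul (u v : uea) : uea := uea_pi (UMul (uea_repr u) (uea_repr v)).
Definition uea_opp (u : uea) : uea := uea_mul (uea_cst (-1)) u.
Definition uea_scale (a : K) (u : uea) : uea := uea_mul (uea_cst a) u.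

Lemma uea_piD s t : uea_add (uea_pi s) (uea_pi t) = uea_pi (UAdd s t).
Proof. by apply/uea_piP; apply: ueq_add; apply: uea_repr_pi. Qed.
Lemma uea_piM s t : uea_mul (uea_pi s) (uea_pi t) = uea_pi (UMul s t).
Proof. by apply/uea_piP; apply: ueq_mul; apply: uea_repr_pi. Qed.

Lemma uea_addA : associative uea_add.
Proof.
elim/uea_ind=> s; elim/uea_ind=> t; elim/uea_ind=> u.
by rewrite !uea_piD; apply/uea_piP; apply: ueq_addA.
Qed.
Lemma uea_addC : commutative uea_add.
Proof.
elim/uea_ind=> s; elim/uea_ind=> t.
by rewrite !uea_piD; apply/uea_piP; apply: ueq_addC.
Qed.
Lemma uea_add0 : left_id (uea_cst 0) uea_add.
Proof.
by elim/uea_ind=> s; rewrite uea_piD; apply/uea_piP; apply: ueq_add0.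
Qed.
Lemma uea_addN : left_inverse (uea_cst 0) uea_opp uea_add.
Proof.
elim/uea_ind=> s; rewrite /uea_opp uea_piM uea_piD.
by apply/uea_piP; apply: ueq_addN.
Qed.

HB.instance Definition _ :=
  GRing.isZmodule.Build uea uea_addA uea_addC uea_add0 uea_addN.

Lemma uea_mulA : associative uea_mul.
Proof.
elim/uea_ind=> s; elim/uea_ind=> t; elim/uea_ind=> u.
by rewrite !uea_piM; apply/uea_piP; apply: ueq_mulA.
Qed.
Lemma uea_mul1 : left_id (uea_cst 1) uea_mul.
Proof.
by elim/uea_ind=> s; rewrite uea_piM; apply/uea_piP; apply: ueq_mul1.
Qed.
Lemma uea_cstC a u : uea_mul (uea_cst a) u = uea_mul u (uea_cst a).
Proof.
by elim/uea_ind: u => s; rewrite !uea_piM; apply/uea_piP; apply: ueq_cstC.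
Qed.
Lemma uea_mul1r : right_id (uea_cst 1) uea_mul.
Proof. by move=> u; rewrite -uea_cstC uea_mul1. Qed.
Lemma uea_mulDl : left_distributive uea_mul uea_add.
Proof.
elim/uea_ind=> s; elim/uea_ind=> t; elim/uea_ind=> u.
by rewrite !(uea_piM, uea_piD); apply/uea_piP; apply: ueq_mulDl.
Qed.
Lemma uea_mulDr : right_distributive uea_mul uea_add.
Proof.
elim/uea_ind=> s; elim/uea_ind=> t; elim/uea_ind=> u.
by rewrite !(uea_piM, uea_piD); apply/uea_piP; apply: ueq_mulDr.
Qed.
Lemma uea_1_neq0 : uea_cst 1 != uea_cst 0.
Proof.
apply/eqP => /uea_piP /(@uea_eval_eq _ _ br K^o (fun=> 0)) /= H.
have /eqP : (1%:A : K^o) = 0%:A.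
  by apply: H => [a x y|x y]; rewrite ?scaler0 ?addr0 ?mulr0 ?subr0.
by rewrite scale1r scale0r oner_eq0.
Qed.

HB.instance Definition _ := GRing.Zmodule_isNzRing.Build uea
  uea_mulA uea_mul1 uea_mul1r uea_mulDl uea_mulDr uea_1_neq0.

Lemma uea_scaleA a b u : uea_scale a (uea_scale b u) = uea_scale (a * b) u.
Proof.
rewrite /uea_scale uea_mulA uea_piM; congr (uea_mul _ u).
by apply/uea_piP; apply: ueq_cstM.
Qed.
Lemma uea_scale1 : left_id 1 uea_scale.
Proof. exact: uea_mul1. Qed.
Lemma uea_scaleDr : right_distributive uea_scale +%R.
Proof. by move=> a u v; apply: uea_mulDr. Qed.
Lemma uea_scaleDl u : {morph uea_scale^~ u : a b / a + b}.
Proof.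
move=> a b; rewrite /uea_scale -[RHS]uea_mulDl; congr (uea_mul _ u).
by rewrite uea_piD; apply/esym/uea_piP; apply: ueq_cstD.
Qed.

HB.instance Definition _ := GRing.Zmodule_isLmodule.Build K uea
  uea_scaleA uea_scale1 uea_scaleDr uea_scaleDl.

Lemma uea_scaleAl (a : K) (u v : uea) : a *: (u * v) = (a *: u) * v.
Proof. exact: uea_mulA. Qed.
HB.instance Definition _ := GRing.Lmodule_isLalgebra.Build K uea uea_scaleAl.

Lemma uea_scaleAr (a : K) (u v : uea) : a *: (u * v) = u * (a *: v).
Proof.
change (uea_mul (uea_cst a) (uea_mul u v) = uea_mul u (uea_mul (uea_cst a) v)).
by rewrite !uea_mulA uea_cstC.
Qed.
HB.instance Definition _ := GRing.Lalgebra_isAlgebra.Build K uea uea_scaleAr.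

Definition uea_gen (x : V) : uea := uea_pi (UGen x).

Lemma uea_gen_linear : linear uea_gen.
Proof.
move=> a x y; apply: etrans (_ : uea_add (uea_scale a (uea_gen x)) _ = _) => //.
by rewrite /uea_scale uea_piM uea_piD; apply/uea_piP; apply: ueq_genP.
Qed.
HB.instance Definition _ :=
  GRing.isLinear.Build K V uea *:%R uea_gen uea_gen_linear.

Lemma uea_gen_lie x y :
  uea_gen (br x y) = uea_gen x * uea_gen y - uea_gen y * uea_gen x.
Proof.
apply: etrans (_ : uea_add (uea_mul (uea_gen x) (uea_gen y))
  (uea_opp (uea_mul (uea_gen y) (uea_gen x))) = _) => //.
by rewrite /uea_opp /uea_gen !uea_piM uea_piD; apply/uea_piP; apply: ueq_lie.
Qed.

(* The extension of f : V -> A to U(V); it is only meaningful when f is a     *)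
(* homomorphism of Lie algebras, see uea_liftP and uea_lift_uniq.             *)
Definition uea_lift (A : algType K) (f : V -> A) (u : uea) : A :=
  uea_eval f (uea_repr u).

Lemma uea_liftP (A : algType K) (f : V -> A) :
  linear f -> (forall x y, f (br x y) = f x * f y - f y * f x) ->
  [/\ linear (uea_lift f), monoid_morphism (uea_lift f)
    & forall x, uea_lift f (uea_gen x) = f x].
Proof.
move=> flin flie.
have E t : uea_lift f (uea_pi t) = uea_eval f t.
  by apply: (uea_eval_eq flin flie); apply: uea_repr_pi.
have ED u v : uea_lift f (u + v) = uea_lift f u + uea_lift f v by exact: E.
have EM u v : uea_lift f (u * v) = uea_lift f u * uea_lift f v by exact: E.
split=> [a u v||x]; last exact: E.
  rewrite ED; congr (_ + _); rewrite [LHS]EM E /=.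
  by rewrite -scalerAl mul1r.
by split=> [|u v]; [rewrite [LHS]E /= scale1r | exact: EM].
Qed.

Lemma uea_lift_uniq (A : algType K) (f : V -> A) (g : {lrmorphism uea -> A}) :
  (forall x, g (uea_gen x) = f x) -> g =1 uea_lift f.
Proof.
move=> gf u; rewrite /uea_lift -{1}(uea_reprK u).
elim: (uea_repr u) => [x|a|s IHs t IHt|s IHs t IHt] /=.
- exact: gf.
- have -> : uea_pi (UCst a) = a%:A :> uea
    by exact: esym (uea_mul1r (uea_cst a)).
  by rewrite linearZ rmorph1.
- by rewrite -IHs -IHt -rmorphD -uea_piD.
- by rewrite -IHs -IHt -rmorphM -uea_piM.
Qed.

End Uea.

Definition commutator (K : fieldType) (k : nat) (A B : 'M[K]_k) : 'M[K]_k :=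
  A *m B - B *m A.

Definition Ugl (K : fieldType) (k : nat) : algType K := uea (@commutator K k).

(* A placed in the upper left corner of an n x n matrix (for k <= n), padded  *)
(* with zeros.                                                                *)
Definition corner (K : fieldType) (k n : nat) (A : 'M[K]_k) : 'M[K]_n :=
  (pid_mx k : 'M_(n, k)) *m A *m (pid_mx k : 'M_(k, n)).

Lemma cornerE (K : fieldType) (k n : nat) (A : 'M[K]_k) (i j : 'I_n) :
  corner n A i j =
  match insub (val i), insub (val j) with
  | Some i', Some j' => A i' j'
  | _, _ => 0
  end.
Proof.
rewrite /corner mxE.
case: (insubP 'I_k (val j)) => [j' jk ej|jk]; last first.
  rewrite big1 => [|l _]; first by case: insub.
  rewrite !mxE [_ == _](_ : _ = false) ?mulr0 //.
  by apply/negP => /eqP e; move: jk; rewrite /= -e ltn_ord.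
rewrite (bigD1 j') //= [X in _ + X]big1 ?addr0 => [|l nl]; last first.
  rewrite [X in _ * X]mxE -ej [_ == _](_ : _ = false) ?mulr0 //.
  exact/negbTE.
rewrite [X in _ * X]mxE -ej eqxx ltn_ord mulr1 mxE.
case: (insubP 'I_k (val i)) => [i' ik ei|ik]; last first.
  by rewrite big1 => [//|l _]; rewrite mxE (negbTE ik) andbF mul0r.
rewrite (bigD1 i') //= big1 ?addr0 => [|l nl].
  by rewrite mxE -ei eqxx ltn_ord mul1r.
rewrite mxE -ei [_ == _](_ : _ = false) ?mul0r //.
by rewrite eq_sym; exact/negbTE.
Qed.

Lemma corner_linear (K : fieldType) (k n : nat) : linear (@corner K k n).
Proof.
by move=> a A B; rewrite /corner mulmxDr mulmxDl -scalemxAr -scalemxAl.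
Qed.

Lemma corner_commutator (K : fieldType) (k n : nat) (A B : 'M[K]_k) :
  (k <= n)%N ->
  corner n (commutator A B) = commutator (corner n A) (corner n B).
Proof.
move=> kn.
have M (X Y : 'M[K]_k) : corner n (X *m Y) = corner n X *m corner n Y.
  rewrite /corner !mulmxA -[_ *m pid_mx k *m pid_mx k]mulmxA mul_pid_mx.
  by rewrite minnn (minn_idPr kn) pid_mx_1 mulmx1.
by rewrite /commutator -!M /corner mulmxBr mulmxBl.
Qed.

Definition Ugl_incl (K : fieldType) (k n : nat) : Ugl K k -> Ugl K n :=
  uea_lift (fun A : 'M[K]_k => uea_gen (@commutator K n) (corner n A)).

Lemma Ugl_inclP (K : fieldType) (k n : nat) : (k <= n)%N ->
  [/\ linear (@Ugl_incl K k n), monoid_morphism (@Ugl_incl K k n)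
    & forall A, Ugl_incl n (uea_gen (@commutator K k) A)
                = uea_gen (@commutator K n) (corner n A)].
Proof.
move=> kn; apply: uea_liftP => [a A B|A B].
  by rewrite corner_linear linearP.
by rewrite corner_commutator // uea_gen_lie.
Qed.

Definition alg_center (A : nzRingType) : set A :=
  [set z | forall u, GRing.comm z u].
Arguments alg_center : clear implicits.

Definition GZ_alg (K : fieldType) (n : nat) : set (Ugl K n) :=
  smallest [set B : set (Ugl K n) | GRing.subalg_closed (mem B)]
    (\bigcup_(k in [set k | (1 <= k <= n)%N])
       Ugl_incl n @` alg_center (Ugl K k)).
Arguments GZ_alg : clear implicits.

Definition fin_gen (A : nzRingType) (M : lmodType A) : Prop :=
  exists s : seq M, forall v : M,
    exists c : 'I_(size s) -> A, v = \sum_i c i *: s`_i.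

(* K acts on an A-module through K -> A, a |-> a%:A.                          *)
Definition lin_span (K : fieldType) (A : algType K) (M : lmodType A)
    (s : seq M) : set M :=
  [set v | exists c : 'I_(size s) -> K, v = \sum_i (c i)%:A *: s`_i].

Definition GZ_module (K : fieldType) (n : nat) (M : lmodType (Ugl K n)) : Prop :=
  fin_gen M /\
  forall v : M, exists s : seq M,
    [set g *: v | g in GZ_alg K n] = lin_span s.

(* Yoneda extensions in the full subcategory of A-Mod with class of objects P *)
(* (with exactness inherited from A-Mod).                                     *)

Section Yoneda.
Variable A : nzRingType.

Definition from_prev (N : lmodType A) (X : nat -> lmodType A)
    (f : {linear N -> X 0%N}) (g : forall i, {linear X i -> X i.+1}) (i : nat) :
    X i -> Prop :=
  match i with
  | 0 => fun x => exists y, f y = x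
  | j.+1 => fun x => exists y, g j y = x
  end.

(* Exact sequences 0 -> N -> X_0 -> ... -> X_d -> M -> 0, i.e. representatives *)
(* of classes in Ext^{d+1}(M, N).  The values of yobj above d, and of ymap    *)
(* from d on, are irrelevant: nothing is required of them, here or in yhom.   *)
Record yseq (P : lmodType A -> Prop) (d : nat) (M N : lmodType A) := YSeq {
  yobj : nat -> lmodType A;
  yin : {linear N -> yobj 0%N};
  ymap : forall i, {linear yobj i -> yobj i.+1};
  yout : {linear yobj d -> M};
  yobjP : forall i, (i <= d)%N -> P (yobj i);
  yin_inj : injective yin;
  ymap_exact : forall i, (i < d)%N ->
    forall x, ymap i x = 0 <-> from_prev yin ymap x;
  yout_exact : forall x, yout x = 0 <-> from_prev yin ymap x;
  yout_surj : forall m, exists x, yout x = m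
}.

Definition yhom P d M N (x y : yseq P d M N) : Prop :=
  exists phi : forall i, {linear yobj x i -> yobj y i},
    [/\ forall u, phi 0%N (yin x u) = yin y u,
        forall i, (i < d)%N ->
          forall u, phi i.+1 (ymap x i u) = ymap y i (phi i u)
      & forall u, yout y (phi d u) = yout x u].

Definition yequiv P d M N : yseq P d M N -> yseq P d M N -> Prop :=
  clos_refl_sym_trans _ (@yhom P d M N).

Definition yclass P d M N : Type :=
  {C : yseq P d M N -> Prop | exists x, C = yequiv x}.

Definition Ext P d (M N : lmodType A) : Type :=
  match d with
  | 0 => {linear M -> N}
  | e.+1 => yclass P e M N
  end.

Definition any_module : lmodType A -> Prop := fun=> True.

Definition yseq_incl P d M N (x : yseq P d M N) : yseq any_module d M N :=
  @YSeq any_module d M N (yobj x) (yin x) (ymap x) (yout x)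
    (fun _ _ => I) (@yin_inj _ _ _ _ x) (@ymap_exact _ _ _ _ x)
    (@yout_exact _ _ _ _ x) (@yout_surj _ _ _ _ x).

Lemma yequiv_incl P d M N (x y : yseq P d M N) :
  yequiv x y -> yequiv (yseq_incl x) (yseq_incl y).
Proof.
elim=> [a b ab|a|a b _ IH|a b c _ IH1 _ IH2].
- by apply: rst_step; exact: ab.
- exact: rst_refl.
- exact: rst_sym.
- exact: rst_trans IH1 IH2.
Qed.

Lemma yclass_incl_subproof P d M N (C : yclass P d M N) :
  exists z, (fun y => exists2 x, sval C x & yequiv (yseq_incl x) y) = yequiv z.
Proof.
case: C => C /= [x0 ->]; exists (yseq_incl x0).
apply/funext => y; apply/propext; split=> [[x x0x xy]|x0y].
  exact: rst_trans (yequiv_incl x0x) xy.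
by exists x0 => //; apply: rst_refl.
Qed.

Definition yclass_incl P d M N (C : yclass P d M N) : yclass any_module d M N :=
  exist _ _ (yclass_incl_subproof C).

Definition Ext_incl P d M N : Ext P d M N -> Ext any_module d M N :=
  match d with
  | 0 => id
  | e.+1 => @yclass_incl P e M N
  end.

Definition extension_full (P : lmodType A -> Prop) : Prop :=
  forall (d : nat) (M N : lmodType A), P M -> P N ->
    bijective (@Ext_incl P d M N).

End Yoneda.

(* Main.v *)
(* Let Q be the set of the images in U = U(gl_n) of the Casimir elements       *)
(* tr(E^r), 1 <= r <= k, of all U(gl_k), k <= n. An element of a U-module is   *)
(* locally finite if each q in Q satisfies a nonzero polynomial on it.        *)
(* Restricting equivariant polynomial maps on matrices to the diagonal shows  *)
(* that the centralizer of gl_k in U(gl_k) (x) End(V) is a finite module over *)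
(* the Casimir elements. For V trivial, this makes Gelfand-Zeitlin modules    *)
(* the finitely generated modules all of whose elements are locally finite;   *)
(* for V = gl_n, it makes the locally finite elements of any U-module a       *)
(* submodule.                                                                 *)
(*   The functor of locally finite elements then has no higher derived        *)
(* functors on locally finite modules. This is proved by adding the elements  *)
(* of Q one gl_k at a time: injective U(gl_{k+1})-modules restrict to         *)
(* injective U(gl_k)-modules because U(gl_{k+1}) is free over U(gl_k), and    *)
(* the new elements are central in U(gl_{k+1}), so that noetherianity makes   *)
(* injective modules divisible by polynomials in them modulo torsion.         *)
(*   Hence the locally finite part of an extension of locally finite modules, *)
(* pulled back from an injective coresolution, is still exact; it represents  *)
(* the same class and receives a map from every locally finite representative.*)
(* By noetherianity it may be shrunk to a finitely generated extension.       *)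

Require Import Defs.
From HB Require Import structures.
From mathcomp Require Import all_boot all_order all_algebra.
From mathcomp Require Import boolp classical_sets reals.
From mathcomp.real_closed Require Import complex.
From mathcomp Require Import ssrcomplements mpoly ring.
From Stdlib Require Import Relation_Operators.

Set Implicit Arguments.
Unset Strict Implicit.
Unset Printing Implicit Defensive.

Import Order.TTheory GRing.Theory Num.Theory.
Local Open Scope classical_set_scope.
Local Open Scope ring_scope.

(** * Submodules, quotients, injectivity and restriction of scalars *)

(** The theorem splits into a homological half, valid for any left noetherian algebra with a set [Q]
    of elements, and a half special to gl_n. Homological half, [extension_full_lf]. An injective
    coresolution of [N] attaches to an extension a map from [M] to a cosyzygy, unique modulo maps
    that lift to the injective module above it ([ycls_ex], [ycls_uniq]). Pulling the coresolution
    back along this map recovers the class. If [lf Q] elements form submodules and the functor of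
    [lf Q] elements is acyclic on [lf Q] modules, the locally finite part [class_seq] of the
    pullback is still exact. It maps to the full pullback, which gives surjectivity. It receives
    every locally finite representative of its class ([class_seq_hom]), which gives injectivity.
    [fin_gen_subseq] then cuts everything down to finitely generated modules. Half special to gl_n.
    With [Q] the Casimir elements of the chain, [GZ_moduleE] identifies the Gelfand-Zeitlin modules
    with the finitely generated [lf Q] modules. The three hypotheses are [Ugl_noetherian],
    [lf_GZ_stable] and [good_GZ_casimirs]. The last goes up the chain: [good_res] restricts to the
    smaller algebra, where injectives stay injective by PBW ([inj_mod_res_incl]), and
    [good_add_central] adjoins the new central Casimirs. The other inputs rest on
    [centralizing_finite]. The PBW map [tau] turns the adjoint action into an action by derivations,
    so centralizing families become equivariant polynomial maps on matrices. These are determined on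
    diagonal matrices ([invariant_eq0]), where polynomials are finite over power sums
    ([psum_finite]). [fusion_span] applies this to the action of the center on a tensor product: the
    trivial representation gives [center_span], and gl_n itself gives [lf_GZ_glE]. *)

Section Modules.
Variable A : nzRingType.
Implicit Types X Y Z : lmodType A.

Definition mk_linear X Y (f : X -> Y) (H : linear f) : {linear X -> Y} :=
  HB.pack f (GRing.isLinear.Build A X Y *:%R f H).

Lemma mk_linearE X Y (f : X -> Y) (H : linear f) x : mk_linear H x = f x.
Proof. by []. Qed.

Definition submod_set X (S : set X) : Prop :=
  S 0 /\ forall a x y, S x -> S y -> S (a *: x + y).

Section SubmodTheory.
Variables (X : lmodType A) (S : set X).
Hypothesis HS : submod_set S.

Lemma submod0 : S 0. Proof. by case: HS. Qed.
Lemma submodD x y : S x -> S y -> S (x + y).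
Proof. by move=> Sx Sy; rewrite -[x]scale1r; apply: (proj2 HS). Qed.
Lemma submodZ a x : S x -> S (a *: x).
Proof. by move=> Sx; rewrite -[_ *: _]addr0; apply: (proj2 HS) => //; apply: submod0. Qed.
Lemma submodN x : S x -> S (- x).
Proof. by move=> Sx; rewrite -scaleN1r; apply: submodZ. Qed.
Lemma submodB x y : S x -> S y -> S (x - y).
Proof. by move=> Sx Sy; apply: submodD => //; apply: submodN. Qed.
Lemma submod_sum (I : Type) (r : seq I) (F : I -> X) :
  (forall i, S (F i)) -> S (\sum_(i <- r) F i).
Proof.
by move=> SF; elim/big_ind: _ => [|x y|i _]; [apply: submod0|apply: submodD|].
Qed.
End SubmodTheory.

Record submodule X := Submodule { smem :> set X; smemP : submod_set smem }.

Section SubmoduleType.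
Variables (X : lmodType A) (S : submodule X).

Record submodT := SubmodT { smval : X; smvalP : smem S smval }.

Lemma smval_inj : injective smval.
Proof.
case=> x Sx [y Sy] /= e; case: _ / e in Sy *.
by congr SubmodT; apply: Prop_irrelevance.
Qed.

HB.instance Definition _ := gen_eqMixin submodT.
HB.instance Definition _ := gen_choiceMixin submodT.

Let HS := smemP S.
Definition smT0 := SubmodT (submod0 HS).
Definition smT_add x y := SubmodT (submodD HS (smvalP x) (smvalP y)).
Definition smT_opp x := SubmodT (submodN HS (smvalP x)).
Definition smT_scale a x := SubmodT (submodZ HS a (smvalP x)).

Let addA : associative smT_add.
Proof. by move=> x y z; apply: smval_inj; rewrite /= addrA. Qed.
Let addC : commutative smT_add.
Proof. by move=> x y; apply: smval_inj; rewrite /= addrC. Qed.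
Let add0 : left_id smT0 smT_add.
Proof. by move=> x; apply: smval_inj; rewrite /= add0r. Qed.
Let addN : left_inverse smT0 smT_opp smT_add.
Proof. by move=> x; apply: smval_inj; rewrite /= addNr. Qed.
HB.instance Definition _ := GRing.isZmodule.Build submodT addA addC add0 addN.

Let scaleA a b x : smT_scale a (smT_scale b x) = smT_scale (a * b) x.
Proof. by apply: smval_inj; rewrite /= scalerA. Qed.
Let scale1 : left_id 1 smT_scale.
Proof. by move=> x; apply: smval_inj; rewrite /= scale1r. Qed.
Let scaleDr : right_distributive smT_scale +%R.
Proof. by move=> a x y; apply: smval_inj; rewrite /= scalerDr. Qed.
Let scaleDl x : {morph smT_scale^~ x : a b / a + b}.
Proof. by move=> a b; apply: smval_inj; rewrite /= scalerDl. Qed.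
HB.instance Definition _ := GRing.Zmodule_isLmodule.Build A submodT
  scaleA scale1 scaleDr scaleDl.

Lemma smval_linear : linear smval. Proof. by []. Qed.
Definition smval_lin : {linear submodT -> X} := mk_linear smval_linear.

End SubmoduleType.

Section SubmoduleLift.
Variables (X Y : lmodType A) (S : submodule Y) (f : {linear X -> Y}).
Hypothesis fS : forall x, smem S (f x).
Definition sm_lift x : submodT S := SubmodT (fS x).
Lemma sm_lift_linear : linear sm_lift.
Proof. by move=> a x y; apply: smval_inj; rewrite /= linearP. Qed.
Definition sm_lift_lin : {linear X -> submodT S} := mk_linear sm_lift_linear.
End SubmoduleLift.

Section QuotientType.
Variables (X : lmodType A) (S : submodule X).
Let HS := smemP S.

(** Elements are the cosets themselves, as sets, so that two classes agree exactly when their cosets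
    are equal, by extensionality. *)
Record quotT := QuotT { qset : set X; qsetP : exists x : X, qset = [set y : X | smem S (y - x)] }.

Definition qpi (x : X) : quotT :=
  @QuotT [set y : X | smem S (y - x)] (ex_intro _ x erefl).

Lemma qpiP x y : qpi x = qpi y <-> smem S (x - y).
Proof.
split=> [[e]|Sxy].
  have : [set z : X | smem S (z - x)] x by rewrite /= subrr; apply: (submod0 HS).
  by rewrite e.
have e : [set z : X | smem S (z - x)] = [set z : X | smem S (z - y)].
  apply/seteqP; split=> z /= Sz.
    by rewrite -[z](subrK x) -addrA; apply: (submodD HS).
  rewrite -[z](subrK y) -addrA; apply: (submodD HS) => //.
  by rewrite -opprB; apply: (submodN HS).
rewrite /qpi; move: (ex_intro _ x _) (ex_intro _ y _) => /=.
rewrite e => p q; congr QuotT; exact: Prop_irrelevance.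
Qed.

Definition qrep (c : quotT) : X := projT1 (cid (qsetP c)).

Lemma qrepK c : qpi (qrep c) = c.
Proof.
rewrite /qrep; case: cid => x /= e; case: c e => s p /= e.
rewrite /qpi; move: (ex_intro _ x _) => /=; rewrite -e => q.
by congr QuotT; apply: Prop_irrelevance.
Qed.

Lemma qrep_pi x : smem S (qrep (qpi x) - x).
Proof. by apply/qpiP; rewrite qrepK. Qed.

HB.instance Definition _ := gen_eqMixin quotT.
HB.instance Definition _ := gen_choiceMixin quotT.

Definition qadd c e := qpi (qrep c + qrep e).
Definition qopp c := qpi (- qrep c).
Definition qscale a c := qpi (a *: qrep c).

Let piD x y : qadd (qpi x) (qpi y) = qpi (x + y).
Proof. by apply/qpiP; rewrite opprD addrACA; apply: (submodD HS); apply: qrep_pi. Qed.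
Let piN x : qopp (qpi x) = qpi (- x).
Proof. by apply/qpiP; rewrite -opprD; apply: (submodN HS); apply: qrep_pi. Qed.
Let piZ a x : qscale a (qpi x) = qpi (a *: x).
Proof. by apply/qpiP; rewrite -scalerBr; apply: (submodZ HS); apply: qrep_pi. Qed.
Let piW (P : quotT -> Prop) : (forall x, P (qpi x)) -> forall c, P c.
Proof. by move=> H c; rewrite -(qrepK c). Qed.

Let addA : associative qadd.
Proof. by elim/piW=> x; elim/piW=> y; elim/piW=> z; rewrite !piD addrA. Qed.
Let addC : commutative qadd.
Proof. by elim/piW=> x; elim/piW=> y; rewrite !piD addrC. Qed.
Let add0 : left_id (qpi 0) qadd.
Proof. by elim/piW=> x; rewrite !piD add0r. Qed.
Let addN : left_inverse (qpi 0) qopp qadd.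
Proof. by elim/piW=> x; rewrite piN piD addNr. Qed.
HB.instance Definition _ := GRing.isZmodule.Build quotT addA addC add0 addN.

Let piD' x y : qpi x + qpi y = qpi (x + y). Proof. exact: piD. Qed.
Let scaleA a b x : qscale a (qscale b x) = qscale (a * b) x.
Proof. by elim/piW: x => x; rewrite !piZ scalerA. Qed.
Let scale1 : left_id 1 qscale.
Proof. by elim/piW=> x; rewrite piZ scale1r. Qed.
Let scaleDr : right_distributive qscale +%R.
Proof. by move=> a; elim/piW=> x; elim/piW=> y; rewrite piD' !piZ piD' scalerDr. Qed.
Let scaleDl x : {morph qscale^~ x : a b / a + b}.
Proof. by move=> a b; elim/piW: x => x; rewrite !piZ piD' scalerDl. Qed.
HB.instance Definition _ := GRing.Zmodule_isLmodule.Build A quotT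
  scaleA scale1 scaleDr scaleDl.

Lemma qpi_linear : linear qpi.
Proof. by move=> a x y; rewrite -piD' -piZ. Qed.
Definition qpi_lin : {linear X -> quotT} := mk_linear qpi_linear.

Lemma qpi_eq0 x : qpi_lin x = 0 <-> smem S x.
Proof. by rewrite mk_linearE (qpiP x 0) subr0. Qed.

Lemma qpi_surj c : exists x, qpi_lin x = c.
Proof. by exists (qrep c); rewrite mk_linearE qrepK. Qed.

End QuotientType.

Lemma image_submod X Y (f : {linear X -> Y}) :
  submod_set [set y | exists x, f x = y].
Proof.
split=> [|a _ _ [x <-] [y <-]]; first by exists 0; rewrite linear0.
by exists (a *: x + y); rewrite linearP.
Qed.
Definition image_of X Y (f : {linear X -> Y}) := Submodule (image_submod f).

Lemma factor_surj X Y Z (f : {linear X -> Y}) (g : {linear X -> Z}) :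
  (forall y, exists x, f x = y) -> (forall x, f x = 0 -> g x = 0) ->
  exists s : {linear Y -> Z}, forall x, s (f x) = g x.
Proof.
move=> fs fg; pose r y := projT1 (cid (fs y)).
have rK y : f (r y) = y by rewrite /r; case: cid.
have E x y : f x = f y -> g x = g y.
  by move=> e; apply/subr0_eq; rewrite -linearB; apply: fg; rewrite linearB e subrr.
have L : linear (g \o r).
  by move=> a x y /=; rewrite -linearP; apply: E; rewrite linearP !rK.
by exists (mk_linear L) => x; rewrite mk_linearE; apply: E; rewrite rK.
Qed.

(** The map [f] need not be injective; only its kernel must lie in that of [g]. Passing to
    [X / ker f] shows that this is ordinary injectivity. In this form it applies directly to maps
    such as [ymap] and [yout]. *)
Definition inj_mod (I : lmodType A) : Prop :=
  forall (X Y : lmodType A) (f : {linear X -> Y}) (g : {linear X -> I}),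
    (forall x, f x = 0 -> g x = 0) ->
    exists s : {linear Y -> I}, forall x, s (f x) = g x.

End Modules.

Definition res_mod (B A : nzRingType) (phi : {rmorphism B -> A}) (X : lmodType A) :
  Type := X.

Section Restriction.
Variables (B A : nzRingType) (phi : {rmorphism B -> A}).

Section Inst.
Variable X : lmodType A.
HB.instance Definition _ := GRing.Zmodule.on (res_mod phi X).
Let sc (b : B) (x : res_mod phi X) : res_mod phi X := (phi b *: (x : X) : X).
Let scaleA a b x : sc a (sc b x) = sc (a * b) x.
Proof. by rewrite /sc scalerA rmorphM. Qed.
Let scale1 : left_id 1 sc.
Proof. by move=> x; rewrite /sc rmorph1 scale1r. Qed.
Let scaleDr : right_distributive sc +%R.
Proof. by move=> a x y; rewrite /sc scalerDr. Qed.
Let scaleDl x : {morph sc^~ x : a b / a + b}.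
Proof. by move=> a b; rewrite /sc rmorphD scalerDl. Qed.
HB.instance Definition _ := GRing.Zmodule_isLmodule.Build B (res_mod phi X)
  scaleA scale1 scaleDr scaleDl.
End Inst.

Lemma res_scaleE (X : lmodType A) (b : B) (x : res_mod phi X) :
  b *: x = (phi b *: (x : X) : X).
Proof. by []. Qed.

Lemma res_linear (X Y : lmodType A) (f : {linear X -> Y}) :
  linear (f : res_mod phi X -> res_mod phi Y).
Proof. by move=> b x y; rewrite res_scaleE -linearP. Qed.
Definition res_lin (X Y : lmodType A) (f : {linear X -> Y}) :
  {linear res_mod phi X -> res_mod phi Y} := mk_linear (@res_linear X Y f).

End Restriction.

(** Zorn's lemma yields a complement of the image of [f], and [g] is extended by zero on it. *)
Lemma inj_mod_field (K : fieldType) (N : lmodType K) : inj_mod N.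
Proof.
move=> X Y f g fg.
pose P (W : set Y) := (forall a x y, W x -> W y -> W (a *: x + y)) /\
  (forall x, W (f x) -> f x = 0).
have [W [[Wl Wf] Wmax]] : exists W, P W /\ forall B, W `<` B -> ~ P B.
  apply: Zorn_bigcup => F FP Ft; split=> [a x y [V FV Vx] [V' FV' V'y]|x [V FV Vx]].
    have [VV'|V'V] := Ft _ _ FV FV'.
      by exists V' => //; apply: (proj1 (FP _ FV')) => //; apply: VV'.
    by exists V => //; apply: (proj1 (FP _ FV)) => //; apply: V'V.
  exact: (proj2 (FP _ FV)).
pose W0 w := W w \/ w = 0.
have W0l a x y : W0 x -> W0 y -> W0 (a *: x + y).
  move=> [Wx|->] [Wy|->]; rewrite ?scaler0 ?addr0 ?add0r; rewrite /W0 ?Wl; auto.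
  left; have W00 : W 0 by rewrite -[0](addNr x) -scaleN1r; apply: Wl.
  by rewrite -[_ *: _]addr0; apply: Wl.
have W0f x : W0 (f x) -> f x = 0 by case=> [/Wf|].
have dec y : exists xw : X * Y, W0 xw.2 /\ y = f xw.1 + xw.2.
  apply: contrapT => Hy.
  pose B := [set z | exists a w, W0 w /\ z = a *: y + w].
  apply: (Wmax B).
    split=> [z Wz|BW].
      by exists 0, z; rewrite scale0r add0r; split=> //; left.
    have By : B y by exists 1, 0; rewrite scale1r addr0; split=> //; right.
    apply: Hy; exists (0, y); rewrite linear0 add0r.
    by split=> //; left; apply: BW.
  split=> [a _ _ [b [w [Ww ->]]] [b' [w' [Ww' ->]]]|x [a [w [Ww e]]]].
    exists (a * b + b'), (a *: w + w'); split; first exact: W0l.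
    by rewrite scalerDr scalerA scalerDl addrACA.
  have [a0|a0] := eqVneq a 0.
    by rewrite a0 scale0r add0r in e; apply: W0f; rewrite e.
  case: Hy; exists (a^-1 *: x, - a^-1 *: w); split=> /=.
    by rewrite -[_ *: _]addr0; apply: W0l => //; right.
  by rewrite linearZ /= e scalerDr scalerA mulVf // scale1r scaleNr addrK.
pose r y := projT1 (cid (dec y)).
have rP y : W0 (r y).2 /\ y = f (r y).1 + (r y).2 by rewrite /r; case: cid.
have E y x w : W0 w -> y = f x + w -> g (r y).1 = g x.
  move=> Ww e; have [W' e'] := rP y.
  apply/subr0_eq; rewrite -linearB; apply: fg; apply: W0f.
  rewrite linearB.
  have -> : f (r y).1 - f x = - 1 *: (r y).2 + w.
    have e1 : f (r y).1 = y - (r y).2 by rewrite [X in X - _]e' addrK.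
    have e2 : f x = y - w by rewrite e addrK.
    by rewrite e1 e2 opprB addrC addrA subrK scaleN1r addrC.
  exact: W0l.
have L : linear (fun y => g (r y).1).
  move=> a y y'; have [W1 e1] := rP y; have [W2 e2] := rP y'.
  rewrite -linearP; apply: (E _ _ (a *: (r y).2 + (r y').2)); first exact: W0l.
  by rewrite linearP addrACA -scalerDr -e1 -e2.
exists (mk_linear L) => x; rewrite mk_linearE.
by apply: (E _ _ 0); [right|rewrite addr0].
Qed.

(** * Coinduced modules Hom_B(A, N) *)

Section Coinduction.
Variables (B A : nzRingType) (phi : {rmorphism B -> A}).

Section Inst.
Variable N : lmodType B.

Record coind := Coind { cfun : A -> N;
  cfunP : forall b x y, cfun (phi b * x + y) = b *: cfun x + cfun y }.

Lemma coind_ext h k : (forall a, cfun h a = cfun k a) -> h = k.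
Proof.
case: h k => h hP [k kP] /= /funext e; case: _ / e in kP *.
by congr Coind; apply: Prop_irrelevance.
Qed.

Lemma cfun_add h x y : cfun h (x + y) = cfun h x + cfun h y.
Proof. by have := cfunP h 1 x y; rewrite rmorph1 mul1r scale1r. Qed.
Lemma cfun0 h : cfun h 0 = 0.
Proof. by apply: (addrI (cfun h 0)); rewrite -cfun_add !addr0. Qed.
Lemma cfunZ h b x : cfun h (phi b * x) = b *: cfun h x.
Proof. by have := cfunP h b x 0; rewrite cfun0 !addr0. Qed.

HB.instance Definition _ := gen_eqMixin coind.
HB.instance Definition _ := gen_choiceMixin coind.

Let P0 b (x y : A) : (0 : N) = b *: 0 + 0. Proof. by rewrite scaler0 addr0. Qed.
Let PD h k b x y : cfun h (phi b * x + y) + cfun k (phi b * x + y)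
  = b *: (cfun h x + cfun k x) + (cfun h y + cfun k y).
Proof. by rewrite !cfunP scalerDr addrACA. Qed.
Let PN h b x y : - cfun h (phi b * x + y) = b *: (- cfun h x) + (- cfun h y).
Proof. by rewrite cfunP opprD scalerN. Qed.
Let PZ a h b x y : cfun h ((phi b * x + y) * a)
   = b *: cfun h (x * a) + cfun h (y * a).
Proof. by rewrite mulrDl -mulrA cfunP. Qed.

Definition cd0 := Coind P0.
Definition cdD h k := Coind (PD h k).
Definition cdN h := Coind (PN h).
Definition cdZ a h := Coind (PZ a h).

Let addA : associative cdD.
Proof. by move=> x y z; apply: coind_ext => a /=; rewrite addrA. Qed.
Let addC : commutative cdD.
Proof. by move=> x y; apply: coind_ext => a /=; rewrite addrC. Qed.
Let add0 : left_id cd0 cdD.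
Proof. by move=> x; apply: coind_ext => a /=; rewrite add0r. Qed.
Let addN : left_inverse cd0 cdN cdD.
Proof. by move=> x; apply: coind_ext => a /=; rewrite addNr. Qed.
HB.instance Definition _ := GRing.isZmodule.Build coind addA addC add0 addN.

Let scaleA a b x : cdZ a (cdZ b x) = cdZ (a * b) x.
Proof. by apply: coind_ext => c /=; rewrite mulrA. Qed.
Let scale1 : left_id 1 cdZ.
Proof. by move=> x; apply: coind_ext => c /=; rewrite mulr1. Qed.
Let scaleDr : right_distributive cdZ +%R.
Proof. by move=> a x y; apply: coind_ext. Qed.
Let scaleDl x : {morph cdZ^~ x : a b / a + b}.
Proof. by move=> a b; apply: coind_ext => c /=; rewrite mulrDr cfun_add. Qed.
HB.instance Definition _ := GRing.Zmodule_isLmodule.Build A coind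
  scaleA scale1 scaleDr scaleDl.

Lemma coind_scaleE a h x : cfun (a *: h) x = cfun h (x * a).
Proof. by []. Qed.
Lemma coind_addE h k x : cfun (h + k) x = cfun h x + cfun k x.
Proof. by []. Qed.

(** Frobenius reciprocity: a map into the coinduced module is determined by its values at 1, which
    form a [B]-linear map to [N]. An extension [s] of the latter gives back y |-> (a |-> s (a
    y)). *)
Lemma inj_mod_coind : inj_mod N -> inj_mod (coind : lmodType A).
Proof.
move=> HN X Y f g fg.
have gl : linear (fun x : res_mod phi X => cfun (g x) 1).
  by move=> b x y; rewrite linearP coind_addE coind_scaleE mul1r
    -[phi b]mulr1 cfunZ.
have [s sP] := HN _ _ (@res_lin _ _ phi _ _ f) (mk_linear gl)
  (fun x e => congr1 (fun h => cfun h 1) (fg x e)).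
have sl y b a a' :
    s ((phi b * a + a') *: y) = b *: s (a *: y) + s (a' *: y).
  by rewrite scalerDl -scalerA -[_ *: (a *: y)]/(b *: (a *: y : res_mod phi Y)) linearP.
have Ll : linear (fun y => Coind (sl y)).
  move=> a y y'; apply: coind_ext => a' /=.
  by rewrite scalerDr scalerA raddfD.
exists (mk_linear Ll) => x; apply: coind_ext => a /=.
have := sP (a *: x); rewrite /= linearZ /= => ->.
by rewrite linearZ coind_scaleE mul1r.
Qed.

End Inst.

Section Unit.
Variable X : lmodType A.
Let XP (x : X) b (a a' : A) :
  ((phi b * a + a') *: x : res_mod phi X) = b *: (a *: x : res_mod phi X) + a' *: x.
Proof. by rewrite res_scaleE scalerDl scalerA. Qed.
Let ul : linear (fun x : X => Coind (XP x)).
Proof.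
by move=> a x y; apply: coind_ext => a' /=; rewrite scalerDr scalerA.
Qed.
Definition coind_in : {linear X -> coind (res_mod phi X)} := mk_linear ul.
Lemma coind_in_inj : injective coind_in.
Proof.
by move=> x y e; have := congr1 (fun h => cfun h 1) e; rewrite /= !scale1r.
Qed.
End Unit.
End Coinduction.

Lemma inj_mod_retract (A : nzRingType) (I J : lmodType A) (i : {linear I -> J})
    (r : {linear J -> I}) :
  (forall x, r (i x) = x) -> inj_mod J -> inj_mod I.
Proof.
move=> ri HJ X Y f g fg.
have L : linear (i \o g) by move=> a x y; rewrite /= !linearP.
have [s sP] := HJ _ _ f (mk_linear L)
   (fun x e => etrans (congr1 i (fg x e)) (linear0 i)).
have L' : linear (r \o s) by move=> a x y; rewrite /= !linearP.
by exists (mk_linear L') => x; rewrite /= sP /= ri.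
Qed.

Section Span.
Variable A : nzRingType.
Implicit Type M : lmodType A.

Definition span M (s : seq M) : set M :=
  [set v | exists c : 'I_(size s) -> A, v = \sum_i c i *: s`_i].

Lemma span_submod M (s : seq M) : submod_set (span s).
Proof.
split=> [|a _ _ [c ->] [c' ->]].
  by exists (fun=> 0); rewrite big1 // => i _; rewrite scale0r.
exists (fun i => a * c i + c' i); rewrite scaler_sumr -big_split.
by apply: eq_bigr => i _; rewrite /= scalerA scalerDl.
Qed.

Lemma span_mem M (s : seq M) x : x \in s -> span s x.
Proof.
rewrite -index_mem => xs; exists (fun i => (i == Ordinal xs)%:R).
rewrite (bigD1 (Ordinal xs)) //= eqxx scale1r nth_index -?index_mem //.
by rewrite big1 ?addr0 // => i /negPf ->; rewrite scale0r.
Qed.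

Lemma span_min M (s : seq M) (S : set M) : submod_set S ->
  (forall x, x \in s -> S x) -> forall v, span s v -> S v.
Proof.
move=> HS sS _ [c ->]; apply: submod_sum => // i.
by apply: submodZ => //; apply: sS; apply: mem_nth.
Qed.

Lemma span_sub M (s t : seq M) : (forall x, x \in s -> span t x) ->
  forall v, span s v -> span t v.
Proof. exact: span_min (span_submod t). Qed.

Lemma span_map M M' (f : {linear M -> M'}) (s : seq M) v :
  span s v -> span (map f s) (f v).
Proof.
have HS : submod_set [set v | span (map f s) (f v)].
  split=> [|a x y /= Hx Hy]; first by rewrite /= linear0; apply: submod0 (span_submod _).
  by rewrite linearP; apply: (proj2 (span_submod _)).
by apply: (span_min HS) => x xs /=; apply: span_mem; apply: map_f.
Qed.

Definition noetherian : Prop := forall M, fin_gen M ->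
  forall S : set M, submod_set S -> exists s : seq M, S = span s.

End Span.

(** * Locally finite elements *)

Section LocallyFinite.
Variables (K : fieldType) (A : algType K).
Implicit Types (Q : set A) (X Y : lmodType A).

Lemma horner_alg_comm (q a : A) p : q * a = a * q ->
  horner_alg q p * a = a * horner_alg q p.
Proof.
move=> qa; elim/poly_ind: p => [|p c IH]; first by rewrite rmorph0 mulr0 mul0r.
rewrite rmorphD rmorphM /= horner_algX horner_algC mulrDl mulrDr; congr (_ + _).
  by rewrite -mulrA qa mulrA IH mulrA.
by rewrite -scalerAl -scalerAr mul1r mulr1.
Qed.

(** Imposed on each [q] separately, which makes stability under maps immediate. For finitely many
    commuting [q] it amounts to a finite-dimensional orbit, see [lf_stable_span]. *)
Definition lf Q X (x : X) : Prop :=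
  forall q, Q q -> exists2 p : {poly K}, p != 0 & horner_alg q p *: x = 0.

Lemma lf0 Q X : lf Q (0 : X).
Proof. by move=> q _; exists 1; rewrite ?oner_neq0 ?scaler0. Qed.

Lemma lfD Q X (x y : X) : lf Q x -> lf Q y -> lf Q (x + y).
Proof.
move=> Hx Hy q Qq; have [p p0 px] := Hx q Qq; have [r r0 ry] := Hy q Qq.
exists (p * r); first by rewrite mulf_neq0.
rewrite scalerDr {1}mulrC !rmorphM /= -!scalerA px ry.
by rewrite !scaler0 addr0.
Qed.

Lemma lfN Q X (x : X) : lf Q x -> lf Q (- x).
Proof. by move=> Hx q /Hx [p p0 px]; exists p; rewrite // scalerN px oppr0. Qed.

Lemma lfB Q X (x y : X) : lf Q x -> lf Q y -> lf Q (x - y).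
Proof. by move=> Hx Hy; apply: lfD => //; apply: lfN. Qed.

Lemma lf_linear Q X Y (f : {linear X -> Y}) x : lf Q x -> lf Q (f x).
Proof. by move=> Hx q /Hx [p p0 px]; exists p; rewrite // -linearZ px linear0. Qed.

Lemma lf_inj Q X Y (f : {linear X -> Y}) x : injective f -> lf Q (f x) -> lf Q x.
Proof.
move=> fi Hx q /Hx [p p0 px]; exists p => //; apply: fi.
by rewrite linearZ /= px linear0.
Qed.

Lemma lfS Q Q' X (x : X) : Q' `<=` Q -> lf Q x -> lf Q' x.
Proof. by move=> Q'Q Hx q /Q'Q /Hx. Qed.

Lemma lf_comm Q X (x : X) (a : A) : (forall q, Q q -> q * a = a * q) ->
  lf Q x -> lf Q (a *: x).
Proof.
move=> Qa Hx q Qq; have [p p0 px] := Hx _ Qq; exists p => //.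
by rewrite scalerA horner_alg_comm ?Qa // -scalerA px scaler0.
Qed.

(* [good Q d C] says that [R^i lf_Q (C) = 0] for [1 <= i <= d], where [lf_Q] is *)
(* the functor of [lf Q]-elements, whatever injective resolution is used.     *)
Fixpoint good Q d (C : lmodType A) : Prop :=
  if d is d'.+1 then
    forall (I C' : lmodType A) (i : {linear C -> I}) (p : {linear I -> C'}),
    inj_mod I -> injective i -> (forall y, exists x, p x = y) ->
    (forall x, p x = 0 <-> exists c, i c = x) ->
    (forall u, lf Q u -> exists2 v, lf Q v & p v = u) /\ good Q d' C'
  else True.

Lemma good_set0 d C : good set0 d C.
Proof.
elim: d C => //= d IH C I C' i p _ _ ps _; split=> // u _.
by have [x <-] := ps u; exists x.
Qed.

Definition lf_mod Q (C : lmodType A) : Prop := forall x : C, lf Q x.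

(** As [s] is central, the left ideals {a | s^k a x = 0} increase with k. Their union is finitely
    generated, so it is reached at a finite stage. *)
Lemma stable_ker (s : A) X (x : X) : noetherian A -> (forall a, s * a = a * s) ->
  exists k, forall a, s ^+ k.+1 *: (a *: x) = 0 -> s ^+ k *: (a *: x) = 0.
Proof.
move=> NA sC.
have sXC k a : s ^+ k * a = a * s ^+ k.
  by apply: esym; apply: (@commrX _ a s); apply: esym; apply: sC.
pose L : set (A^o) := [set a | exists k, s ^+ k *: (a *: x) = 0].
have Lup k l (a : A^o) : (k <= l)%N -> s ^+ k *: (a *: x) = 0 -> s ^+ l *: (a *: x) = 0.
  by move=> kl e; rewrite -(subnK kl) exprD -scalerA e scaler0.
have HL : submod_set L.
  split=> [|a u v [k ek] [l el]]; first by exists 0%N; rewrite scale0r scaler0.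
  exists (maxn k l); have -> : (a *: u + v) *: x = a *: (u *: x) + v *: x.
    by rewrite scalerDl scalerA.
  rewrite scalerDr.
  have := Lup k (maxn k l) u (leq_maxl k l) ek.
  have := Lup l (maxn k l) v (leq_maxr k l) el => -> e.
  by rewrite scalerA sXC -scalerA e scaler0 addr0.
have fgA : fin_gen A^o.
  by exists [:: 1] => v; exists (fun=> v); rewrite big_ord1 /= /GRing.scale /= mulr1.
have [t Lt] := NA _ fgA _ HL.
have [k Hk] : exists k, forall a, a \in t -> s ^+ k *: (a *: x) = 0.
  have : forall a, a \in t -> L a by move=> a at_; rewrite Lt; apply: span_mem.
  elim: t {Lt} => [|a t IH] Ht; first by exists 0%N.
  have [k ek] : L a by apply: Ht; rewrite mem_head.
  have [b bt|l el] := IH; first by apply: Ht; rewrite in_cons bt orbT.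
  exists (maxn k l) => b; rewrite in_cons => /orP[/eqP->|bt].
    exact: Lup (leq_maxl k l) ek.
  exact: Lup (leq_maxr k l) (el _ bt).
exists k => a e; have : L a by exists k.+1.
rewrite Lt => -[c ->]; rewrite scaler_suml scaler_sumr big1 // => i _.
have -> : (c i *: t`_i) *: x = c i *: (t`_i *: x) by rewrite scalerA.
by rewrite [LHS]scalerA sXC -scalerA Hk ?scaler0 ?mem_nth.
Qed.

Section AddCentral.
Variables (Q : set A) (q : A).
Hypotheses (NA : noetherian A) (qC : forall a, q * a = a * q).

Let p_comm p a : horner_alg q p * a = a * horner_alg q p.
Proof. exact: horner_alg_comm. Qed.

Let Q' := Q `|` [set q].

Let lf_tors X (x : X) (p : {poly K}) : p != 0 -> lf Q x -> lf Q' (horner_alg q p *: x) -> lf Q' x.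
Proof.
move=> p0 Hx H r [|->]; first exact: Hx.
have [p' p'0 e] := H q (or_intror erefl); exists (p' * p); first by rewrite mulf_neq0.
by rewrite rmorphM -scalerA.
Qed.

(* Trivial when [lf_mod Q' C] holds; unlike the latter, this property passes   *)
(* to the cosyzygies of an injective coresolution.                            *)
Definition divisible_mod_tors (C : lmodType A) : Prop :=
  forall p : {poly K}, p != 0 -> forall x : C, lf Q x ->
  exists w t, [/\ lf Q w, lf Q' t & x = horner_alg q p *: w + t].

(* By [stable_ker], [s ^+ k.+1 *: (a *: x) |-> s ^+ k *: (a *: x)] is a well  *)
(* defined map; extend it to [phi : I -> I] and take [w = phi x].             *)
Lemma inj_divisible I : inj_mod I -> divisible_mod_tors I.
Proof.
move=> HI p p0 x Qx; set s := horner_alg q p.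
have sXE k : s ^+ k = horner_alg q (p ^+ k) by rewrite rmorphXn.
have [k Hk] := @stable_ker s _ x NA (p_comm p).
have L l : linear (fun a : A^o => s ^+ l *: (a *: x)).
  move=> a b c; have -> : (a *: b + c) *: x = a *: (b *: x) + c *: x.
    by rewrite scalerDl scalerA.
  by rewrite scalerDr [in LHS]scalerA sXE p_comm -scalerA.
have [phi phiP] := HI _ _ (mk_linear (L k.+1)) (mk_linear (L k)) Hk.
have e : phi (s ^+ k.+1 *: x) = s ^+ k *: x.
  by have := phiP 1; rewrite /= scale1r.
exists (phi x), (x - s *: phi x); split; last by rewrite addrC subrK.
  exact: lf_linear.
have Qw : lf Q (x - s *: phi x).
  apply: lfB => //; apply: lf_comm; last exact: lf_linear.
  by move=> r _; rewrite p_comm.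
(* The power s^k kills [x - s *: phi x], because s^(k+1) phi(x) = phi(s^(k+1) x) = s^k x. *)
apply: (@lf_tors _ _ (p ^+ k)) => //; first by rewrite expf_neq0.
rewrite -sXE scalerBr scalerA -exprSr -e linearZ /= subrr; exact: lf0.
Qed.

(** Let [v] be an [lf Q] lift of an [lf Q'] element [u], and let r(q) kill [u]. Then r(q) v comes
    from some c in [C]. Writing c = r(q) w + t, the corrected lift v - i(w) satisfies r(q)(v - i(w))
    = i(t), so it is [lf Q']. The quotient [C'] inherits divisibility from [I], since [lf Q]
    elements lift along [p]. *)
Lemma good_add_central d C :
  divisible_mod_tors C -> good Q d C -> good Q' d C.
Proof.
elim: d C => //= d IH C HC HG I C' i p HI ii ps pi.
have [H1 H2] := HG I C' i p HI ii ps pi; split=> [u Hu|].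
  have [v Qv pv] := H1 u (lfS (@subsetUl _ _ _) Hu).
  have [r r0 ru] := Hu q (or_intror erefl).
  have : p (horner_alg q r *: v) = 0 by rewrite linearZ pv.
  move=> /pi [c ec].
  have Qc : lf Q c.
    apply: lf_inj ii _; rewrite ec; apply: lf_comm Qv => *; by rewrite p_comm.
  have [w [t [Qw Qt e]]] := HC r r0 c Qc.
  exists (v - i w); last first.
    by rewrite linearB pv (_ : p (i w) = 0) ?subr0 //; apply/pi; exists w.
  apply: (lf_tors r0); first by apply: lfB => //; apply: lf_linear.
  rewrite scalerBr -linearZ -ec e raddfD /= addrC addKr; exact: lf_linear.
apply: IH => // r r0 x Qx; have [y Qy <-] := H1 x Qx.
have [w [t [Qw Qt ->]]] := inj_divisible HI r0 Qy.
exists (p w), (p t); split; try exact: lf_linear.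
by rewrite linearD linearZ.
Qed.

Lemma lf_mod_divisible C : lf_mod Q' C -> divisible_mod_tors C.
Proof.
move=> HC p p0 x Qx; exists 0, x; split=> //; first exact: lf0.
by rewrite scaler0 add0r.
Qed.

Lemma good_lf_mod_add_central :
  (forall C, lf_mod Q C -> forall d, good Q d C) ->
  forall C, lf_mod Q' C -> forall d, good Q' d C.
Proof.
move=> H C HC d; apply: good_add_central; first exact: lf_mod_divisible.
by apply: H => x; apply: lfS (HC x); apply: subsetUl.
Qed.

End AddCentral.

Lemma good_lf_mod_add_centrals Q (s : seq A) : noetherian A ->
  (forall q, q \in s -> forall a, q * a = a * q) ->
  (forall C, lf_mod Q C -> forall d, good Q d C) ->
  forall C, lf_mod (Q `|` [set` s]) C -> forall d, good (Q `|` [set` s]) d C.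
Proof.
move=> NA; elim: s Q => [|q s IH] Q sC H.
  have -> : [set` [::]] = set0 :> set A by apply/seteqP; split.
  by rewrite setU0.
have -> : Q `|` [set` q :: s] = (Q `|` [set q]) `|` [set` s].
  rewrite -setUA; congr setU; apply/seteqP; split=> x /=.
    by rewrite in_cons => /orP[/eqP|]; [left|right].
  by rewrite in_cons => -[->|->]; rewrite ?eqxx ?orbT.
apply: IH => [r rs|]; first by apply: sC; rewrite in_cons rs orbT.
by apply: good_lf_mod_add_central => // a; apply: sC; rewrite mem_head.
Qed.

End LocallyFinite.

Section GoodRestriction.
Variables (K : fieldType) (B A : algType K) (phi : {lrmorphism B -> A}).

Lemma horner_alg_lrmorph q p : phi (horner_alg q p) = horner_alg (phi q) p.
Proof.
elim/poly_ind: p => [|p c IH]; first by rewrite !rmorph0.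
by rewrite !rmorphD !rmorphM /= !horner_algX !horner_algC IH linearZ rmorph1.
Qed.

Lemma lf_res (Q : set B) (X : lmodType A) (x : X) :
  lf Q (x : res_mod phi X) <-> lf (phi @` Q) x.
Proof.
split=> [Hx _ [q Qq <-]|Hx q Qq].
  have [p p0 px] := Hx _ Qq; exists p => //.
  by rewrite -horner_alg_lrmorph.
have [|p p0 px] := Hx (phi q); first by exists q.
by exists p => //; rewrite -horner_alg_lrmorph in px.
Qed.

(** If injectives restrict to injectives, the restriction of an embedding into an injective module
    can be used to test [good] over [B]. *)
Lemma good_res (Q : set B) : (forall I, inj_mod I -> inj_mod (res_mod phi I)) ->
  forall d (C : lmodType A), good Q d (res_mod phi C) -> good (phi @` Q) d C.
Proof.
move=> HI; elim=> //= d IH C HG I C' i p Ii ii ps pi.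
have [H1 H2] := HG _ _ (@res_lin _ _ phi _ _ i) (@res_lin _ _ phi _ _ p) (HI _ Ii) ii ps pi.
split=> [u Hu|]; last exact: IH.
by have [v Qv pv] := H1 u (proj2 (lf_res Q u) Hu); exists v => //; apply/lf_res.
Qed.

End GoodRestriction.

(** * Yoneda classes through injective coresolutions *)

Section Coresolution.
Variables (K : fieldType) (A : algType K).

(** Not a minimal hull: this is Hom_K(A, X), which is injective because [X] is injective over the
    field. *)
Definition inj_hull (X : lmodType A) : lmodType A :=
  coind (in_alg A) (res_mod (in_alg A) X).
Definition inj_emb (X : lmodType A) : {linear X -> inj_hull X} :=
  coind_in (in_alg A) X.

Lemma inj_hull_inj X : inj_mod (inj_hull X).
Proof. exact/inj_mod_coind/inj_mod_field. Qed.
Lemma inj_emb_inj X : injective (inj_emb X).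
Proof. exact: coind_in_inj. Qed.

(* [cosyz i] is the (i+1)-st cosyzygy, the cokernel of [N -> cores 0] for      *)
(* [i = 0] and of [cosyz (i - 1) -> cores i] otherwise.                       *)
Record coresolution (N : lmodType A) := Coresolution {
  cores : nat -> lmodType A;
  cosyz : nat -> lmodType A;
  cin : {linear N -> cores 0};
  cpr : forall i, {linear cores i -> cosyz i};
  cinS : forall i, {linear cosyz i -> cores i.+1};
  cores_inj : forall i, inj_mod (cores i);
  cin_inj : injective cin;
  cinS_inj : forall i, injective (cinS i);
  cpr_surj : forall i y, exists x, cpr i x = y;
  cpr0_eq0 : forall x, cpr 0 x = 0 <-> exists c, cin c = x;
  cprS_eq0 : forall i x, cpr i.+1 x = 0 <-> exists c, cinS i c = x;
  cores_good : forall Q : set A, (forall d, good Q d N) ->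
    forall i u, lf Q u -> exists2 v, lf Q v & cpr i v = u }.

Section Existence.
Variable N : lmodType A.

Let C := fix C i : lmodType A :=
  if i is j.+1 then quotT (image_of (inj_emb (C j))) else N.
Let J i := inj_hull (C i).
Let f i : {linear C i -> J i} := inj_emb (C i).
Let p i : {linear J i -> C i.+1} := qpi_lin (image_of (inj_emb (C i))).

Let p_surj i y : exists x, p i x = y. Proof. exact: qpi_surj. Qed.
Let p_eq0 i x : p i x = 0 <-> exists c, f i c = x. Proof. exact: qpi_eq0. Qed.

Let J_good Q : (forall d, good Q d N) ->
  forall i u, lf Q u -> exists2 v, lf Q v & p i v = u.
Proof.
move=> H i; have Hg d : good Q d (C i).
  elim: i d => [|i IH] d; first exact: H.
  have [] // := IH d.+1 _ _ (f i) (p i) (@inj_hull_inj _) (@inj_emb_inj _) (@p_surj i) (@p_eq0 i).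
have [+ _] := Hg 1%N _ _ (f i) (p i) (@inj_hull_inj _) (@inj_emb_inj _) (@p_surj i) (@p_eq0 i).
exact.
Qed.

Lemma coresolution_ex : exists R : coresolution N, True.
Proof.
exists (@Coresolution N J (fun i => C i.+1) (f 0%N) p (fun i => f i.+1)
  (fun i => @inj_hull_inj _) (@inj_emb_inj _) (fun i => @inj_emb_inj _)
  p_surj (@p_eq0 0%N) (fun i => @p_eq0 i.+1) J_good).
exact: I.
Qed.
End Existence.

Section Theory.
Variables (N : lmodType A) (R : coresolution N).
Lemma cpr_cin c : cpr R 0 (cin R c) = 0.
Proof. by apply/cpr0_eq0; exists c. Qed.
Lemma cpr_cinS i c : cpr R i.+1 (cinS R i c) = 0.
Proof. by apply/cprS_eq0; exists c. Qed.
End Theory.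

End Coresolution.

(** Completing a single map to a family indexed by nat avoids transports along equalities of
    indices. *)
Lemma lin_fam (A : nzRingType) (M : lmodType A) (T : nat -> lmodType A) d
    (c : {linear M -> T d}) :
  exists c' : forall i, {linear M -> T i}, c' d = c /\ forall i, i != d -> c' i = \0.
Proof.
exists (@dfwith nat (fun i => {linear M -> T i}) (fun i => \0) d c); split=> [|i id].
  by rewrite dfwith_in.
by rewrite dfwith_out // eq_sym.
Qed.

Section ExtClass.
Variables (K : fieldType) (A : algType K) (M N : lmodType A).
Variables (R : coresolution N) (d : nat).

Notation J := (cores R).
Notation C := (cosyz R).

(** A family, although the class sits in index [d]: conditions of the form [i = d -> ... c i ...]
    can then be stated without casts. *)
Definition cofam := forall i, {linear M -> C i}.

(* A chain map from [z] to the injective coresolution [R] of [N], inducing [c d]  *)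
(* on [M]; modulo maps factoring through [cpr R d], [c d] is the class of [z]. *)
Definition chain P (z : yseq P d M N) (c : cofam)
    (g : forall i, {linear yobj z i -> J i}) : Prop :=
  [/\ forall n, g 0%N (yin z n) = cin R n,
      forall i, (i < d)%N -> forall u, g i.+1 (ymap z i u) = cinS R i (cpr R i (g i u))
    & forall u, c d (yout z u) = cpr R d (g d u)].

Definition ycls P (z : yseq P d M N) (c : cofam) : Prop := exists g, @chain P z c g.

Lemma from_prev_cpr P (z : yseq P d M N) k (g : forall i, {linear yobj z i -> J i}) :
  (forall n, g 0%N (yin z n) = cin R n) ->
  (forall i, (i < k)%N -> forall u, g i.+1 (ymap z i u) = cinS R i (cpr R i (g i u))) ->
  forall i u, (i <= k)%N -> from_prev (yin z) (ymap z) (i:=i) u -> cpr R i (g i u) = 0.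
Proof.
move=> g0 gS [|i] u id [y <-]; first by rewrite g0 cpr_cin.
by rewrite gS // cpr_cinS.
Qed.

(** The comparison theorem: the chain map is built degree by degree, each step extending along
    [ymap] by injectivity of the next term of [R]. *)
Lemma ycls_ex P (z : yseq P d M N) : exists c, ycls z c.
Proof.
pose G k := exists g : forall i, {linear yobj z i -> J i},
  (forall n, g 0%N (yin z n) = cin R n) /\
  (forall i, (i < k)%N -> forall u, g i.+1 (ymap z i u) = cinS R i (cpr R i (g i u))).
have HG k : (k <= d)%N -> G k.
  elim: k => [_|k IH kd].
    have [|g0 Hg0] := @cores_inj K A N R 0 _ _ (yin z) (cin R).
      by move=> n e; rewrite (yin_inj (etrans e (esym (linear0 (yin z))))) linear0.
    exists (@dfwith nat (fun i => {linear yobj z i -> J i}) (fun i => \0) 0%N g0); rewrite dfwith_in; split=> //.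
  have [g [g0 gS]] := IH (ltnW kd).
  have [|h hP] := @cores_inj K A N R k.+1 _ _ (ymap z k)
      (cinS R k \o (cpr R k \o g k)).
    move=> u /(ymap_exact kd) Hu.
    have e : cpr R k (g k u) = 0 := from_prev_cpr g0 gS (leqnn k) Hu.
    by rewrite /= e linear0.
  exists (@dfwith nat (fun i => {linear yobj z i -> J i}) g k.+1 h); split=> [n|i].
    by rewrite dfwith_out.
  rewrite ltnS leq_eqVlt => /orP[/eqP->|ik] u.
    by rewrite dfwith_in dfwith_out ?neq_ltn ?ltnSn ?orbT // hP.
  rewrite !dfwith_out ?gS //; first by rewrite neq_ltn ltnS (ltnW ik) orbT.
  by rewrite eqSS neq_ltn ik orbT.
have [g [g0 gS]] := HG d (leqnn d).
have [|c0 c0P] := @factor_surj _ _ _ _ (yout z) (cpr R d \o g d) (@yout_surj _ _ _ _ _ z).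
  by move=> u /yout_exact Hu; exact: (from_prev_cpr g0 gS (leqnn d) Hu).
have [c [cd _]] := @lin_fam A M (fun i => C i) d c0.
exists c, g; split=> // u; rewrite cd; exact: c0P.
Qed.

(** Two chain maps are homotopic. In each degree the difference [e i] is corrected to a map [e']
    with the same image under [cpr] that vanishes on what comes from the previous term. Hence [e']
    extends along the next map of [z], and in degree [d] along [yout]. *)
Lemma ycls_uniq P (z : yseq P d M N) c c' : ycls z c -> ycls z c' ->
  exists s : {linear M -> J d}, forall m, c d m - c' d m = cpr R d (s m).
Proof.
move=> [g [g0 gS gd]] [h [h0 hS hd]].
pose e i : {linear yobj z i -> J i} := g i \- h i.
have E i : (i <= d)%N -> exists e' : {linear yobj z i -> J i},
   (forall u, cpr R i (e' u) = cpr R i (e i u)) /\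
   (forall u, from_prev (yin z) (ymap z) u -> e' u = 0).
  elim: i => [_|i IH id].
    exists (e 0%N); split=> // _ [n <-].
    by rewrite /= /e g0 h0 subrr.
  have [e' [e'1 e'2]] := IH (ltnW id).
  have [|s sP] := @cores_inj K A N R i _ _ (ymap z i) e'.
    by move=> u /(ymap_exact id) /e'2.
  exists (e i.+1 \- (cinS R i \o (cpr R i \o s))).
  split=> [u|_ [u <-]].
    by rewrite /= linearB /= cpr_cinS subr0.
  by rewrite /= sP e'1 /= gS // hS // (linearB (cpr R i)) (linearB (cinS R i)) subrr.
have [e' [e'1 e'2]] := E d (leqnn d).
have [|s sP] := @cores_inj K A N R d _ _ (yout z) e'.
  by move=> u /yout_exact /e'2.
exists s => m; have [u <-] := yout_surj z m.
by rewrite gd hd sP e'1 /= linearB.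
Qed.

Lemma ycls_hom P P' (x : yseq P d M N) (y : yseq P' d M N) c :
  yhom (yseq_incl x) (yseq_incl y) -> ycls y c -> ycls x c.
Proof.
move=> [phi [p0 pS pd]] [g [g0 gS gd]].
exists (fun i => g i \o phi i); split=> [n|i id u|u] /=.
- by rewrite -g0; congr (g _ _); apply: p0.
- by rewrite -gS //; congr (g _ _); apply: pS.
- by rewrite -gd; congr (c d _); apply: esym; apply: pd.
Qed.

Definition cls_eq (c c' : cofam) : Prop :=
  exists s : {linear M -> J d}, forall m, c d m - c' d m = cpr R d (s m).

Lemma cls_eq_sym c c' : cls_eq c c' -> cls_eq c' c.
Proof.
by move=> [s sP]; exists (\- s) => m; rewrite /= linearN -sP opprB.
Qed.

Lemma cls_eq_trans c c' c'' : cls_eq c c' -> cls_eq c' c'' -> cls_eq c c''.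
Proof.
by move=> [s sP] [t tP]; exists (s \+ t) => m; rewrite /= linearD -sP -tP subrKA.
Qed.

Lemma ycls_equiv (x y : yseq (@any_module A) d M N) c c' :
  yequiv x y -> ycls x c -> ycls y c' -> cls_eq c c'.
Proof.
move=> xy; elim: xy c c' => {x y} [x y xy|x|x y _ IH|x y z _ IH1 _ IH2] c c' xc yc.
- exact: ycls_uniq xc (ycls_hom xy yc).
- exact: ycls_uniq xc yc.
- exact/cls_eq_sym/IH.
- by have [e ye] := ycls_ex y; apply: cls_eq_trans (IH1 _ _ xc ye) (IH2 _ _ ye yc).
Qed.

End ExtClass.

Lemma yout_fam (A : nzRingType) (M N : lmodType A) d P (x : yseq P d M N) :
  exists h : forall i, {linear yobj x i -> M},
    [/\ h d = yout x, forall i, i != d -> h i = \0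
      & forall i (u : yobj x i), from_prev (yin x) (ymap x) u -> h i u = 0].
Proof.
pose h := @dfwith nat (fun i => {linear yobj x i -> M}) (fun i => \0) d (yout x).
have hd : h d = yout x by rewrite /h dfwith_in.
have hN i : i != d -> h i = \0 by move=> id; rewrite /h dfwith_out // eq_sym.
exists h; split=> // i u; have [/esym e|id] := eqVneq i d; last by rewrite hN.
by case: i / e u => u; rewrite hd => /yout_exact.
Qed.

(** Subtracting [s \o yout] from the chain map in degree [d] changes the class by [cpr R d \o s] and
    leaves the other conditions intact, as [yout] kills the image of the previous term. *)
Lemma ycls_shift (K : fieldType) (A : algType K) (M N : lmodType A)
    (R : coresolution N) d P (x : yseq P d M N) (c c' : cofam M R) :
  ycls x c -> cls_eq d c c' -> ycls x c'.
Proof.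
move=> [g [g0 gS gd]] [s0 s0P]; have [h [hd hN h_prev]] := yout_fam x.
have [s [sd sN]] := @lin_fam A M (cores R) d s0.
exists (fun i => g i \- (s i \o h i)); split=> [n|i id u|u] /=.
- by rewrite (h_prev 0%N _ (ex_intro _ n erefl)) linear0 subr0.
- rewrite (h_prev i.+1 _ (ex_intro _ u erefl)) linear0 subr0 gS //.
  by rewrite hN ?neq_ltn ?id //= linear0 subr0.
- by rewrite linearB -gd sd hd -s0P opprB addrC subrK.
Qed.

Section ClassSequence.
Variables (K : fieldType) (A : algType K) (M N : lmodType A).
Variables (R : coresolution N) (d : nat) (Q : set A) (c : cofam M R).
Hypothesis lfZ : forall (X : lmodType A) (a : A) (x : X), lf Q x -> lf Q (a *: x).
Hypotheses (MQ : lf_mod Q M) (NQ : lf_mod Q N).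
Hypothesis cores_lf : forall i u, lf Q u -> exists2 v, lf Q v & cpr R i v = u.

Let J := cores R.
(* The locally finite part of the extension with class [c]: it receives a map  *)
(* from every locally finite sequence with that class.                        *)
Let E_set i : set (J i * M)%type :=
  [set z | [/\ lf Q z.1, (i < d)%N -> z.2 = 0 & i = d -> cpr R i z.1 = c i z.2]].

Let E_submod i : submod_set (@E_set i).
Proof.
split=> [|a x y [x1 x2 x3] [y1 y2 y3]]; split=> //=.
- exact: lf0.
- by rewrite !linear0.
- by apply: lfD => //; exact: lfZ.
- by move=> id; rewrite x2 // y2 // scaler0 addr0.
- by move=> id; rewrite !linearP x3 // y3.
Qed.
Let ES i := Submodule (@E_submod i).
Let E i : lmodType A := submodT (ES i).

Let in_fun (n : N) : J 0%N * M := (cin R n, 0).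
Let in_fun_linear : linear in_fun.
Proof.
by move=> a x y; rewrite /in_fun linearP; congr (_, _); rewrite /= scaler0 addr0.
Qed.
Let in_fun_S n : smem (ES 0) (mk_linear in_fun_linear n).
Proof.
split=> //=; first exact/lf_linear/NQ.
by move=> _; rewrite cpr_cin linear0.
Qed.
Let E_in : {linear N -> E 0%N} := sm_lift_lin in_fun_S.

Let map_fun i (z : E i) : J i.+1 * M := (cinS R i (cpr R i (smval z).1), 0).
Let map_fun_linear i : linear (@map_fun i).
Proof.
move=> a x y; rewrite /map_fun /= !linearP; congr (_, _).
by rewrite /= scaler0 addr0.
Qed.
Let map_fun_S i z : smem (ES i.+1) (mk_linear (@map_fun_linear i) z).
Proof.
split=> //=.
  by do 2!apply: lf_linear; case: (smvalP z).
by move=> _; rewrite cpr_cinS linear0.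
Qed.
Let E_map i : {linear E i -> E i.+1} := sm_lift_lin (@map_fun_S i).

Let out_linear : linear (fun z : E d => (smval z).2).
Proof. by []. Qed.
Let E_out := mk_linear out_linear.

Let lf_E i (z : E i) : lf Q z.
Proof.
apply: (lf_inj (f := smval_lin (ES i))); first exact: smval_inj.
move=> q Qq; have [z1 _ _] := smvalP z.
have [p p0 e] := z1 q Qq; have [r r0 e'] := MQ (smval z).2 Qq.
exists (p * r); first by rewrite mulf_neq0.
apply/pair_equal_spec; split.
  by rewrite /= mulrC rmorphM -scalerA e scaler0.
by rewrite /= rmorphM -scalerA e' scaler0.
Qed.

Let E_exact i (x : E i) : (i <= d)%N -> (smval x).2 = 0 -> cpr R i (smval x).1 = 0 ->
  from_prev E_in E_map x.
Proof.
case: i x => [|i] x id x2 /= Hx.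
  have [n en] := proj1 (cpr0_eq0 _) Hx; exists n; apply: smval_inj => /=.
  by rewrite /in_fun en -x2; case: (smval x).
have [u eu] := proj1 (cprS_eq0 _) Hx.
have Qu : lf Q u.
  by apply: lf_inj (@cinS_inj _ _ _ R i) _; rewrite eu; case: (smvalP x).
have [v Qv vu] := cores_lf Qu.
have Sv : smem (ES i) (v, 0) by split=> //= e; rewrite e ltnn in id.
exists (SubmodT Sv); apply: smval_inj => /=.
by rewrite /map_fun /= vu eu -x2; case: (smval x).
Qed.

Let E_in_inj : injective E_in.
Proof. by move=> x y /(congr1 (fun z => (smval z).1)) /cin_inj. Qed.

Let E_prev i (x : E i) : from_prev E_in E_map x -> (smval x).2 = 0 /\ cpr R i (smval x).1 = 0.
Proof.
case: i x => [|i] x [y <-] /=; split=> //; first exact: cpr_cin.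
exact: cpr_cinS.
Qed.

Let E_map_exact i : (i < d)%N -> forall x : E i, E_map i x = 0 <-> from_prev E_in E_map x.
Proof.
move=> id x; split=> [e|/E_prev[_ e]].
  apply: E_exact; first exact: ltnW.
    by have [_ -> //] := smvalP x.
  by apply: (@cinS_inj _ _ _ R i); rewrite linear0; exact: (congr1 (fun z => (smval z).1) e).
by apply: smval_inj => /=; rewrite /map_fun e linear0.
Qed.

Let E_out_exact (x : E d) : E_out x = 0 <-> from_prev E_in E_map x.
Proof.
split=> [e|/E_prev[] //]; apply: E_exact => //.
by have [_ _ ->] := smvalP x; rewrite //= (_ : (smval x).2 = 0) ?linear0.
Qed.

Let E_out_surj m : exists x, E_out x = m.
Proof.
have [v Qv vm] := cores_lf (lf_linear (c d) (MQ m)).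
have Sv : smem (ES d) (v, m) by split=> //=; rewrite ltnn.
by exists (SubmodT Sv).
Qed.

(** For [Q] empty every element is locally finite, and this is the full pullback of the coresolution
    along [c d]. *)
Definition class_seq : yseq (lf_mod Q) d M N :=
  @YSeq A (lf_mod Q) d M N E E_in E_map E_out (fun i _ => @lf_E i) E_in_inj
    E_map_exact E_out_exact E_out_surj.

Lemma class_seq_cls : ycls class_seq c.
Proof.
have L i : linear (fun z : E i => (smval z).1) by [].
exists (fun i => mk_linear (@L i)); split=> //= u.
by have [_ _ ->] := smvalP u.
Qed.

(** The chain map [g] paired with [yout] is a map into the pullback; it lands in the locally finite
    part because linear maps preserve local finiteness. *)
Lemma class_seq_hom P (x : yseq P d M N) :
  (forall i, (i <= d)%N -> lf_mod Q (yobj x i)) -> ycls x c ->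
  yhom (yseq_incl x) (yseq_incl class_seq).
Proof.
move=> Hx [g [g0 gS gd]].
have [h [hd hN h_prev]] := yout_fam x.
(* Above index [d] the objects of [x] are arbitrary, so the chain map is replaced there by zero to
   keep its values locally finite. *)
pose g' i : {linear yobj x i -> J i} := if (i <= d)%N then g i else \0.
have L i : linear (fun u => (g' i u, h i u) : J i * M).
  by move=> a u v; rewrite !linearP.
have S i u : smem (ES i) (mk_linear (L i) u).
  rewrite mk_linearE /g'; split=> /=.
  - by case: leqP => id; [apply/lf_linear/Hx | apply: lf0].
  - by move=> id; rewrite hN // neq_ltn id.
  - by move=> /esym e; case: i / e u => u; rewrite leqnn hd gd.
exists (fun i => sm_lift_lin (@S i)); split=> [n|i id u|u].
- apply: smval_inj; by rewrite /= /g' leq0n g0 (h_prev 0%N _ (ex_intro _ n erefl)).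
- have e : (smval (sm_lift (@S i) u)).1 = g i u by rewrite /= /g' (ltnW id).
  apply: smval_inj; rewrite /= /map_fun e /g' id gS //.
  by rewrite (h_prev i.+1 _ (ex_intro _ u erefl)).
- by rewrite /= hd.
Qed.

End ClassSequence.


(** * Shrinking exact sequences to finitely generated ones *)

Lemma fin_gen_span (A : nzRingType) (X : lmodType A) (S : submodule X) (s : seq X) :
  smem S = span s -> fin_gen (submodT S).
Proof.
move=> eS; have [s' es] : exists s' : seq (submodT S), map (@smval _ _ S) s' = s.
  have : forall x, x \in s -> smem S x by move=> x; rewrite eS; apply: span_mem.
  elim: s {eS} => [|x s IH] Hs; first by exists [::].
  have [y ys|s' <-] := IH; first by apply: Hs; rewrite in_cons ys orbT.
  by exists (SubmodT (Hs x (mem_head _ _)) :: s').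
exists s' => v.
have HS : submod_set [set x | exists2 v, span s' v & smval v = x].
  split=> [|a _ _ [u Hu <-] [u' Hu' <-]].
    by exists 0 => //; apply: submod0 (span_submod _).
  by exists (a *: u + u') => //; apply: (proj2 (span_submod _)).
have := smvalP v; rewrite eS => /(span_min HS) [x|u Hu /smval_inj <- //].
by rewrite -es => /mapP[u us ->]; exists u => //; apply: span_mem.
Qed.

Lemma fin_gen_sub (A : nzRingType) (X : lmodType A) (S : set X) (s : seq X) :
  noetherian A -> submod_set S -> (forall x, S x -> span s x) ->
  exists t : seq X, S = span t.
Proof.
move=> NA HS Ss; pose T := Submodule (span_submod s).
have HS' : submod_set [set v : submodT T | S (smval v)].
  by split=> [|a x y Hx Hy]; [apply: (proj1 HS)|apply: (proj2 HS)].
have [t et] := NA _ (@fin_gen_span _ _ T s erefl) _ HS'.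
exists (map (@smval _ _ T) t); apply/seteqP; split=> [x Sx|x].
  have : span t (SubmodT (Ss x Sx : smem T x)) by rewrite -et.
  by move=> /(span_map (smval_lin T)).
apply: span_min => // y /mapP[v vt ->].
by have := span_mem vt; rewrite -et.
Qed.

(** The intersection of [span s] with the image of [f] is finitely generated; [l] lifts its
    generators. *)
Lemma lift_seq (A : nzRingType) (X Y : lmodType A) (f : {linear X -> Y}) (s : seq Y) :
  noetherian A ->
  exists l : seq X, (forall x, x \in l -> span s (f x)) /\
    forall y, span s y -> (exists x, f x = y) -> exists2 x, span l x & f x = y.
Proof.
move=> NA; pose S := [set y | span s y /\ exists x, f x = y].
have HS : submod_set S.
  split=> [|a u v [Hu [x ex]] [Hv [y ey]]].
    by split; [apply: submod0 (span_submod _)|exists 0; rewrite linear0].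
  split; first by apply: (proj2 (span_submod _)).
  by exists (a *: x + y); rewrite linearP ex ey.
have [|t et] := @fin_gen_sub _ _ S s NA HS; first by move=> x [].
have [l el] : exists l, map f l = t.
  have : forall x, x \in t -> S x by move=> x xt; rewrite et; apply: span_mem.
  elim: t {et} => [|x t IH] Ht; first by exists [::].
  have [y yt|l <-] := IH; first by apply: Ht; rewrite in_cons yt orbT.
  by have [_ [x' <-]] := Ht x (mem_head _ _); exists (x' :: l).
exists l; split=> [x xl|y sy fy].
  suff [] : S (f x) by [].
  by rewrite et -el; apply/span_mem/map_f.
have : S y by []; rewrite et -el.
have HS' : submod_set [set y | exists2 x, span l x & f x = y].
  split=> [|a _ _ [u Hu <-] [u' Hu' <-]].
    by exists 0; rewrite ?linear0 //; apply: submod0 (span_submod _).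
  by exists (a *: u + u'); rewrite ?linearP //; apply: (proj2 (span_submod _)).
move=> /(span_min HS'); apply=> _ /mapP[x xl ->].
by exists x => //; apply: span_mem.
Qed.

Section FinGenSubsequence.
Variables (A : nzRingType) (M N : lmodType A) (d : nat) (P : lmodType A -> Prop).
Hypotheses (NA : noetherian A) (fgM : fin_gen M) (fgN : fin_gen N).
Hypothesis P_sub : forall (X : lmodType A) (S : submodule X), P X -> P (submodT S).
Variables (w : yseq P d M N) (F : forall i, seq (yobj w i)).

(** The generators are chosen from degree [d] downwards. [T i] contains [F i], the images of the
    generators one degree below, and lifts of generators of the part of [span (T i.+1)] in the image
    of [ymap]. The lifts keep the subsequence exact, and the prescribed images die under the next
    map, so nothing propagates upwards more than one step. *)
Lemma fin_gen_subfam : exists T : forall i, seq (yobj w i),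
  [/\ forall i x, x \in F i -> span (T i) x,
      forall n, span (T 0%N) (yin w n),
      forall i, (i < d)%N -> forall x, span (T i) x -> span (T i.+1) (ymap w i x),
      forall i, (i < d)%N -> forall x, span (T i.+1) x -> (exists y, ymap w i y = x) ->
        exists2 y, span (T i) y & ymap w i y = x
    & forall m, exists2 x, span (T d) x & yout w x = m].
Proof.
have [gN HN] := fgN; have [gM HM] := fgM.
pose B i : seq (yobj w i) := F i ++
  match i return seq (yobj w i) with 0 => map (yin w) gN | j.+1 => map (ymap w j) (F j) end.
have [L HL] : exists L : forall i, seq (yobj w i.+1) -> seq (yobj w i),
  forall i s, (forall x, x \in L i s -> span s (ymap w i x)) /\
    forall y, span s y -> (exists x, ymap w i x = y) ->
      exists2 x, span (L i s) x & ymap w i x = y.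
  exists (fun i s => projT1 (cid (lift_seq (ymap w i) s NA))) => i s.
  by case: cid.
have [lM [_ HlM]] := lift_seq (yout w) gM NA.
pose D := @dfwith nat (fun i => seq (yobj w i)) (fun i => [::]) d lM.
(* The first argument of [T0] is the distance to [d], which makes the downward recursion
   structural. *)
pose T0 := fix T0 j i : seq (yobj w i) :=
  if j is j'.+1 then B i ++ L i (T0 j' i.+1) else B i ++ D i.
pose T i := T0 (d - i)%N i.
have TS i : (i < d)%N -> T i = B i ++ L i (T i.+1).
  by move=> id; rewrite /T -subnSK.
have Td : T d = B d ++ lM by rewrite /T subnn /= /D dfwith_in.
have BT i x : x \in B i -> span (T i) x.
  move=> xB; apply: span_mem; rewrite /T.
  by case: (d - i)%N => [|j] /=; rewrite mem_cat xB.
exists T; split.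
- by move=> i x xF; apply: BT; rewrite mem_cat xF.
- move=> n; have /(span_map (yin w)) := HN n : span gN n.
  by apply: span_sub => x xs; apply: BT; rewrite mem_cat xs orbT.
- move=> i id; apply: span_min => [|x].
    split=> [|a x y Hx Hy] /=; first by rewrite linear0; apply: submod0 (span_submod _).
    by rewrite linearP; apply: (proj2 (span_submod _)).
  rewrite TS // mem_cat => /orP[|xL /=]; last by apply: (proj1 (HL i _)).
  rewrite mem_cat => /orP[xF|xp] /=.
    by apply: BT; rewrite mem_cat map_f ?orbT.
  suff -> : ymap w i x = 0 by apply: submod0 (span_submod _).
  apply/(ymap_exact id); move: xp; case: (i) x => [|j] x /mapP[y _ ->];
  by exists y.
- move=> i id x Tx xe; have [y Ly yx] := proj2 (HL i (T i.+1)) x Tx xe.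
  exists y => //; move: Ly; apply: span_sub => z zL; apply: span_mem.
  by rewrite TS // mem_cat zL orbT.
move=> m; have [x lx xm] := HlM m (HM m) (yout_surj w m).
exists x => //; move: lx; apply: span_sub => z zL; apply: span_mem.
by rewrite Td mem_cat zL orbT.
Qed.

Definition fgP (X : lmodType A) : Prop := fin_gen X /\ P X.

(** The prescribed families [F] serve to enlarge the subsequence until it receives given morphisms
    from finitely generated sequences. *)
Lemma fin_gen_subseq : exists w' : yseq fgP d M N,
  yhom (yseq_incl w') (yseq_incl w) /\
  forall P' (x : yseq P' d M N),
    (exists phi : forall i, {linear yobj x i -> yobj w i},
    [/\ forall u, phi 0%N (yin x u) = yin w u,
        forall i, (i < d)%N ->
          forall u, phi i.+1 (ymap x i u) = ymap w i (phi i u),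
        forall u, yout w (phi d u) = yout x u
      & forall i, (i <= d)%N -> forall u, span (F i) (phi i u)]) ->
  yhom (yseq_incl x) (yseq_incl w').
Proof.
have [T [T1 T2 T3 T4 T5]] := fin_gen_subfam.
pose S i : submodule (yobj w i) := Submodule (span_submod (T i)).
pose X i : lmodType A := submodT (S i).
pose f : {linear N -> X 0%N} := sm_lift_lin (T2 : forall n, smem (S 0%N) (yin w n)).
pose g0 i : {linear X i -> yobj w i.+1} :=
  if (i < d)%N then (ymap w i \o smval_lin (S i) : {linear X i -> yobj w i.+1}) else \0.
have g0E i : (i < d)%N -> forall x, g0 i x = ymap w i (smval x).
  by rewrite /g0 => ->.
have g0S i x : smem (S i.+1) (g0 i x).
  rewrite /g0; case: ltnP => id; last exact: (submod0 (span_submod _)).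
  by apply: (T3 i id); apply: (smvalP x).
pose g i : {linear X i -> X i.+1} := sm_lift_lin (@g0S i).
pose h : {linear X d -> M} := yout w \o smval_lin (S d).
have prevE i (x : X i) : (i <= d)%N ->
    from_prev f g x <-> from_prev (yin w) (ymap w) (smval x).
  case: i x => [|i] x id; split=> -[y e].
  - by exists y; rewrite -e.
  - by exists y; apply: smval_inj.
  - by exists (smval y); rewrite -e /= g0E.
  - have [|y' Ty' e'] := T4 i id (smval x) (smvalP x); first by exists y.
    by exists (SubmodT (Ty' : smem (S i) y')); apply: smval_inj; rewrite /= g0E.
have XP i : (i <= d)%N -> fgP (X i).
  by move=> id; split; [exact: fin_gen_span|apply: P_sub; apply: yobjP].
have fi : injective f by move=> x y /(congr1 (@smval _ _ _)) /yin_inj.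
have ge i : (i < d)%N -> forall x : X i, g i x = 0 <-> from_prev f g x.
  move=> id x; rewrite prevE 1?ltnW // -(ymap_exact id) -g0E //; split=> [|e].
    by move=> /(congr1 (@smval _ _ _)).
  exact: smval_inj.
have he (x : X d) : h x = 0 <-> from_prev f g x by rewrite prevE // -yout_exact.
have hs m : exists x, h x = m.
  by have [x Tx <-] := T5 m; exists (SubmodT (Tx : smem (S d) x)).
exists (@YSeq A fgP d M N X f g h XP fi ge he hs); split.
  exists (fun i => smval_lin (S i)); split=> //= i id u; exact: g0E.
move=> P' x [phi [p0 pS pd pF]].
pose phi' i : {linear yobj x i -> yobj w i} := if (i <= d)%N then phi i else \0.
have phiE i : (i <= d)%N -> phi' i = phi i by rewrite /phi' => ->.
have phiS i u : smem (S i) (phi' i u).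
  rewrite /phi'; case: leqP => id; last exact: (submod0 (span_submod _)).
  by have := pF i id u; apply: span_sub; apply: T1.
exists (fun i => sm_lift_lin (@phiS i)); split=> [u|i id u|u] /=.
- by apply: smval_inj; rewrite /= phiE // p0.
- by apply: smval_inj; rewrite /= phiE // g0E //= phiE 1?ltnW // pS.
- by rewrite phiE // pd.
Qed.

End FinGenSubsequence.

(** * Extension fullness from acyclicity of the locally finite part *)

Section ExtensionFull.
Variables (K : fieldType) (A : algType K) (Q : set A).
Hypothesis NA : noetherian A.
Hypothesis lfZ : forall (X : lmodType A) (a : A) (x : X), lf Q x -> lf Q (a *: x).
Hypothesis good_lf : forall C : lmodType A, lf_mod Q C -> forall d, good Q d C.

Notation B := (fgP (lf_mod Q)).

Let lf_sub (X : lmodType A) (S : submodule X) : lf_mod Q X -> lf_mod Q (submodT S).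
Proof.
by move=> HX x; apply: (lf_inj (f := smval_lin S)); [apply: smval_inj|apply: HX].
Qed.

(** The zigzag is z -> w0 <- w <- w': the full pullback [w0], its locally finite part [w], and a
    finitely generated subsequence [w'] of [w]. *)
Lemma yseq_lf_surj d (M N : lmodType A) (z : yseq (@any_module A) d M N) :
  B M -> B N -> exists x : yseq B d M N, yequiv (yseq_incl x) z.
Proof.
move=> [fgM MQ] [fgN NQ]; have [R _] := coresolution_ex N.
have [c zc] := ycls_ex R z.
have set0Z (X : lmodType A) (a : A) (x : X) : lf set0 x -> lf set0 (a *: x) by move=> _ q.
have set0M (X : lmodType A) : lf_mod set0 X by move=> x q.
pose w := class_seq d c lfZ MQ NQ (cores_good (good_lf NQ)).
pose w0 := class_seq d c set0Z (@set0M M) (@set0M N) (cores_good (fun d => good_set0 d N)).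
have zw0 : yhom (yseq_incl z) (yseq_incl w0) by apply: class_seq_hom.
have ww0 : yhom (yseq_incl w) (yseq_incl w0).
  by apply: class_seq_hom => //; apply: class_seq_cls.
have [w' [w'w _]] := fin_gen_subseq NA fgM fgN lf_sub (fun i => [::] : seq (yobj w i)).
exists w'; apply: (rst_trans _ _ _ (yseq_incl w)); first exact: rst_step.
apply: (rst_trans _ _ _ (yseq_incl w0)); first exact: rst_step.
(* [yseq_incl z] and [z] differ only in their proofs of [any_module], on which [yhom] does not
   depend. *)
by apply/rst_sym/rst_step; case: z zw0 {zc}.
Qed.

(** Equivalent sequences have the same class, so both map to the same locally finite sequence [w].
    The images are finitely generated, hence lie in a finitely generated subsequence [w'], and x ->
    w' <- y stays inside the subcategory. *)
Lemma yseq_lf_inj d (M N : lmodType A) (x y : yseq B d M N) :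
  B M -> B N -> yequiv (yseq_incl x) (yseq_incl y) -> yequiv x y.
Proof.
move=> [fgM MQ] [fgN NQ] xy; have [R _] := coresolution_ex N.
have [c xc] := ycls_ex R x; have [c' yc'] := ycls_ex R y.
have cc' : cls_eq d c c' by apply: (ycls_equiv xy xc yc').
have yc := ycls_shift yc' (cls_eq_sym cc').
pose w := class_seq d c lfZ MQ NQ (cores_good (good_lf NQ)).
have obQ (u : yseq B d M N) i : (i <= d)%N -> lf_mod Q (yobj u i).
  by move=> id; case: (yobjP u id).
have [phi [p0 pS pd]] : yhom (yseq_incl x) (yseq_incl w).
  by apply: class_seq_hom => //; apply: obQ.
have [psi [q0 qS qd]] : yhom (yseq_incl y) (yseq_incl w).
  by apply: class_seq_hom => //; apply: obQ.
have gens (u : yseq B d M N) : exists g : forall i, seq (yobj u i),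
    forall i, (i <= d)%N -> forall v, span (g i) v.
  have H i : exists s : seq (yobj u i), (i <= d)%N -> forall v, span s v.
    case: (leqP i d) => id; last by exists [::].
    by have [[s sP] _] := yobjP u id; exists s.
  by exists (fun i => projT1 (cid (H i))) => i; case: cid.
have [gx gxP] := gens x; have [gy gyP] := gens y.
pose F i : seq (yobj w i) := map (phi i) (gx i) ++ map (psi i) (gy i).
have [w' [_ Hw']] := fin_gen_subseq NA fgM fgN lf_sub F.
apply: (rst_trans _ _ _ w'); [apply: rst_step|apply/rst_sym/rst_step].
  apply: Hw'; exists phi; split=> // i id u.
  have := span_map (phi i) (gxP i id u); apply: span_sub => v vs.
  by apply: span_mem; rewrite mem_cat vs.
apply: Hw'; exists psi; split=> // i id u.
have := span_map (psi i) (gyP i id u); apply: span_sub => v vs.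
by apply: span_mem; rewrite mem_cat vs orbT.
Qed.

Theorem extension_full_lf : extension_full B.
Proof.
move=> [|d] M N BM BN; first by exists id.
rewrite /Ext_incl.
have inj (C D : yclass B d M N) : yclass_incl C = yclass_incl D -> C = D.
  case: C D => C HC [D HD] /(congr1 sval) /= e.
  have [x eC] := HC; have [y eD] := HD.
  have CD : C = D.
    have : yequiv x y.
      apply: yseq_lf_inj => //.
      have : exists2 x', D x' & yequiv (yseq_incl x') (yseq_incl x).
        have := congr1 (fun f => f (yseq_incl x)) e => /= <-.
        by exists x; rewrite ?eC; apply: rst_refl.
      by move=> [y']; rewrite eD => yy' y'x; apply: rst_sym;
        apply: rst_trans y'x; apply: yequiv_incl.
    move=> xy; rewrite eC eD; apply/funext => z; apply/propext; split=> H.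
      by apply: rst_trans H; apply: rst_sym.
    exact: rst_trans H.
  by case: _ / CD HD {eD} => HD; congr exist; apply: Prop_irrelevance.
have sur (D : yclass (@any_module A) d M N) : exists C : yclass B d M N, yclass_incl C = D.
  case: D => D HD; have [z eD] := HD.
  have [x xz] := yseq_lf_surj z BM BN.
  exists (exist (fun C => exists x, C = yequiv x) (yequiv x) (ex_intro _ x erefl) : yclass B d M N).
  apply: eq_exist; rewrite /= eD; apply/funext => u; apply/propext; split.
    move=> [x' xx' x'u]; apply: rst_trans x'u.
    by apply: rst_trans (yequiv_incl xx'); apply: rst_sym.
  move=> zu; exists x; [exact: rst_refl|exact: rst_trans xz zu].
exists (fun D => projT1 (cid (sur D))) => [C|D]; case: cid => //= C' e.
exact: inj.
Qed.

End ExtensionFull.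

(** * Noetherianity of almost commutative algebras *)

(** Induction on the number of coordinates. Let [l0] work for the first n of them and let [J] bound
    their last coordinates. An element with last coordinate at least [J] is dominated through [l0];
    the others lie in finitely many slices, each treated by induction. *)
Lemma dickson (T : eqType) (c : T -> nat -> nat) n (L : set T) :
  exists l : seq T, (forall x, x \in l -> L x) /\
    forall x, L x -> exists2 y, y \in l & forall i, (i < n)%N -> (c y i <= c x i)%N.
Proof.
elim: n L => [|n IH] L.
  have [[x Lx]|L0] := pselect (exists x, L x); last first.
    by exists [::]; split=> // x Lx; case: L0; exists x.
  exists [:: x]; split=> [y|y _]; first by rewrite mem_seq1 => /eqP->.
  by exists x; rewrite ?mem_head.
have [l0 [l0L l0P]] := IH L.
pose J := (\max_(y <- l0) c y n)%N.
have J_ub y : y \in l0 -> (c y n <= J)%N by move=> yl; apply: leq_bigmax_seq.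
pose Lj j : set T := [set x | L x /\ c x n = j].
have [l1 [l1L l1P]] : exists l1 : seq T, (forall x, x \in l1 -> L x) /\
    forall x, L x -> (c x n < J)%N ->
    exists2 y, y \in l1 & forall i, (i < n.+1)%N -> (c y i <= c x i)%N.
  elim: J {J_ub} => [|J [l [lL lP]]]; first by exists [::].
  have [l' [l'L l'P]] := IH (Lj J).
  exists (l ++ l'); split=> [x|x Lx].
    by rewrite mem_cat => /orP[/lL//|/l'L[]].
  rewrite ltnS leq_eqVlt => /orP[/eqP xJ|xJ].
    have [y yl yP] := l'P x (conj Lx xJ).
    exists y; first by rewrite mem_cat yl orbT.
    move=> i; rewrite ltnS leq_eqVlt => /orP[/eqP->|/yP//].
    by have [_ ->] := l'L y yl; rewrite xJ.
  by have [y yl yP] := lP x Lx xJ; exists y; rewrite // mem_cat yl.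
exists (l0 ++ l1); split=> [x|x Lx].
  by rewrite mem_cat => /orP[/l0L|/l1L].
have [xJ|Jx] := ltnP (c x n) J.
  by have [y yl yP] := l1P x Lx xJ; exists y; rewrite // mem_cat yl orbT.
have [y yl yP] := l0P x Lx; exists y; first by rewrite mem_cat yl.
move=> i; rewrite ltnS leq_eqVlt => /orP[/eqP->|/yP//].
exact: leq_trans (J_ub y yl) Jx.
Qed.

(** Induction on the number of generators: the coefficients of the first generator [g] in elements
    of [S] form a left ideal, and [S] meets the span of the others in a finitely generated
    module. *)
Lemma noetherian_left_ideals (A : nzRingType) :
  (forall L : set A^o, submod_set L -> exists s : seq A^o, L = span s) -> noetherian A.
Proof.
move=> HA M [s0 Hs0] S0 HS0.
suff H (s : seq M) S : submod_set S -> (forall x, S x -> span s x) ->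
    exists t : seq M, S = span t by apply: (H s0) => // x _; apply: Hs0.
elim: s S {s0 Hs0 S0 HS0} => [|g s IH] S HS Ss.
  exists [::]; apply/seteqP; split=> [x /Ss //|]; exact: (span_min HS).
pose L : set A^o := [set a | exists2 v, span s v & S (a *: g + v)].
have HL : submod_set L.
  split=> [|a b c [v sv Sv] [w sw Sw]].
    exists 0; first exact: submod0 (span_submod s).
    by rewrite scale0r add0r; apply: (proj1 HS).
  exists (a *: v + w); first exact: (proj2 (span_submod s)).
  have -> : (a *: b + c) *: g = a *: (b *: g) + c *: g by rewrite scalerDl scalerA.
  by rewrite addrACA -scalerDr; apply: (proj2 HS).
have [t et] := HA L HL.
have [|x []//|t' et'] := IH (S `&` span s).
  split=> [|a x y [? ?] [? ?]]; split; try exact: (proj2 HS); try exact: (proj1 HS).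
    exact: (proj1 (span_submod s)).
  exact: (proj2 (span_submod s)).
have [r [r1 r2]] : exists r : seq M, (forall x, x \in r -> S x) /\
    forall a, a \in t -> exists2 v, span s v & (a *: g + v) \in r.
  have : forall a, a \in t -> L a by move=> a at_; rewrite et; apply: span_mem.
  elim: t {et} => [|a t IHt] Ht; first by exists [::].
  have [b bt|r [r1 r2]] := IHt; first by apply: Ht; rewrite in_cons bt orbT.
  have [v sv Sv] := Ht a (mem_head _ _).
  exists (a *: g + v :: r); split=> [x|b]; rewrite in_cons => /orP[/eqP->//|].
  - exact: r1.
  - by exists v; rewrite ?mem_head.
  - by move=> /r2[w sw wr]; exists w; rewrite // in_cons wr orbT.
exists (r ++ t'); apply/seteqP; split=> [x Sx|]; last first.
  apply: (span_min HS) => x; rewrite mem_cat => /orP[/r1//|/span_mem].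
  by rewrite -et' => -[].
have rt' : forall y, span t' y -> span (r ++ t') y.
  by apply: span_sub => y yt; apply: span_mem; rewrite mem_cat yt orbT.
have key a : span t a -> exists2 v, span s v & S (a *: g + v) /\ span (r ++ t') (a *: g + v).
  pose V : set A^o := [set a | exists2 v, span s v & S (a *: g + v) /\ span (r ++ t') (a *: g + v)].
  have HV : submod_set V.
    split=> [|b x1 y1 [v sv [Sv rv]] [w sw [Sw rw]]].
      exists 0; first exact: submod0 (span_submod s).
      rewrite scale0r add0r; split; first exact: (proj1 HS).
      exact: submod0 (span_submod _).
    exists (b *: v + w); first exact: (proj2 (span_submod s)).
    have -> : (b *: x1 + y1) *: g = b *: (x1 *: g) + y1 *: g by rewrite scalerDl scalerA.
    by rewrite addrACA -scalerDr; split; [apply: (proj2 HS)|apply: (proj2 (span_submod _))].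
  apply: (span_min HV) => b /r2[v sv vr]; exists v => //.
  by split; [apply: r1|apply: span_mem; rewrite mem_cat vr].
have [c xc] := Ss x Sx.
rewrite /= big_ord_recl /= in xc.
pose v := \sum_(i < size s) c (lift ord0 i) *: s`_i.
have sv : span s v by exists (fun i => c (lift ord0 i)).
have La : L (c ord0) by exists v => //; rewrite /v -xc.
rewrite et in La; have [w sw [Sw rw]] := key _ La.
have -> : x = (c ord0 *: g + w) + (v - w).
  by rewrite -addrA [w + _]addrC subrK xc.
apply: (submodD (span_submod _)) => //.
apply: rt'; rewrite -et'; split; last by apply: (submodB (span_submod _)).
have -> : v - w = x - (c ord0 *: g + w) by rewrite xc opprD addrACA subrr add0r.
exact: submodB.
Qed.

Section AlmostCommutative.
Variables (K : fieldType) (A : algType K) (m : nat) (x : 'I_m -> A).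

Hypothesis x_comm : forall i j, exists (c : K) (l : 'I_m -> K),
  x i * x j = x j * x i + (c%:A + \sum_k l k *: x k).
Hypothesis x_gen : forall P : set A, P 0 -> P 1 ->
  (forall c u v, P u -> P v -> P (c *: u + v)) ->
  (forall i u, P u -> P (x i * u)) -> forall u, P u.

(** The filtration whose d-th step is spanned by the words of length at most d in the generators. *)
Inductive xfilt : nat -> A -> Prop :=
| xfilt0 d : xfilt d 0
| xfilt1 d : xfilt d 1
| xfiltP d c u v : xfilt d u -> xfilt d v -> xfilt d (c *: u + v)
| xfiltM d i u : xfilt d u -> xfilt d.+1 (x i * u).

Lemma xfiltZ d c u : xfilt d u -> xfilt d (c *: u).
Proof. by move=> Hu; rewrite -[_ *: _]addr0; apply: xfiltP => //; apply: xfilt0. Qed.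
Lemma xfiltD d u v : xfilt d u -> xfilt d v -> xfilt d (u + v).
Proof. by move=> Hu Hv; rewrite -[u]scale1r; apply: xfiltP. Qed.
Lemma xfilt_sum d (I : Type) (r : seq I) (F : I -> A) :
  (forall i, xfilt d (F i)) -> xfilt d (\sum_(i <- r) F i).
Proof. by move=> HF; elim/big_ind: _ => //; [exact: xfilt0|exact: xfiltD]. Qed.
Lemma xfiltS d u : xfilt d u -> xfilt d.+1 u.
Proof. by elim=> *; [exact: xfilt0|exact: xfilt1|exact: xfiltP|exact: xfiltM]. Qed.
Lemma xfilt_le d e u : (d <= e)%N -> xfilt d u -> xfilt e u.
Proof. by move=> /subnK <- Hu; elim: (e - d)%N => //= k; apply: xfiltS. Qed.

Lemma xfilt_mul d e u v : xfilt d u -> xfilt e v -> xfilt (d + e) (u * v).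
Proof.
move=> Hu Hv; elim: Hu => {d u} [d|d|d c u w _ IHu _ IHw|d i u _ IHu].
- by rewrite mul0r; apply: xfilt0.
- by rewrite mul1r; apply: xfilt_le Hv; apply: leq_addl.
- by rewrite mulrDl -scalerAl; apply: xfiltP.
- by rewrite -mulrA; apply: xfiltM.
Qed.

Lemma xfilt_exp i k : xfilt k (x i ^+ k).
Proof. by elim: k => [|k IH]; [exact: xfilt1|rewrite exprS; apply: xfiltM]. Qed.

Lemma xfilt_prod (F : 'I_m -> nat) (r : seq 'I_m) :
  xfilt (\sum_(i <- r) F i) (\prod_(i <- r) x i ^+ F i).
Proof.
elim: r => [|i r IH]; first by rewrite !big_nil; apply: xfilt1.
by rewrite !big_cons; apply: xfilt_mul => //; apply: xfilt_exp.
Qed.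

(** This is almost commutativity: a commutator of two generators has filtration degree 1 rather than
    2, so bracketing with a generator does not raise the degree. *)
Lemma xfilt_ad d i u : xfilt d u -> xfilt d (x i * u - u * x i).
Proof.
elim=> {d u} [d|d|d c u w _ IHu _ IHw|d j u Hu IHu].
- by rewrite mul0r mulr0 subrr; apply: xfilt0.
- by rewrite mul1r mulr1 subrr; apply: xfilt0.
- rewrite mulrDl mulrDr -scalerAl -scalerAr opprD addrACA -scalerBr; exact: xfiltP.
- have [c [l e]] := x_comm i j.
  have -> : x i * (x j * u) - x j * u * x i =
      x j * (x i * u - u * x i) + (c *: u + \sum_k l k *: (x k * u)).
    rewrite mulrBr mulrA e !mulrDl -!mulrA mulr_algl mulr_suml addrAC.
    by congr (_ + (_ + _)); apply: eq_bigr => k _; rewrite scalerAl.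
  apply: xfiltD; first exact: xfiltM.
  apply: xfiltP; first exact: xfiltS.
  by apply: xfilt_sum => k; apply/xfiltZ/xfiltM.
Qed.

(** The ordered-monomial map. In general it is only linear; [theta_XM] measures its failure to be
    multiplicative. *)
Definition theta (s : {mpoly K[m]}) : A := mmap (in_alg A) x s.

Lemma thetaX mon : theta 'X_[mon] = \prod_(i < m) x i ^+ mon i.
Proof. exact: mmapX. Qed.
Lemma thetaZ c s : theta (c *: s) = c *: theta s.
Proof. by rewrite /theta mmapZ mulr_algl. Qed.
Lemma thetaD s t : theta (s + t) = theta s + theta t. Proof. exact: mmapD. Qed.
Lemma thetaB s t : theta (s - t) = theta s - theta t. Proof. exact: mmapB. Qed.
Lemma theta0 : theta 0 = 0. Proof. exact: mmap0. Qed.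
Lemma theta1 : theta 1 = 1. Proof. by rewrite -mpolyX0 /theta mmapX mmap11. Qed.
Lemma theta_sum (I : Type) (r : seq I) (P : pred I) (F : I -> {mpoly K[m]}) :
  theta (\sum_(i <- r | P i) F i) = \sum_(i <- r | P i) theta (F i).
Proof. exact: (big_morph _ thetaD theta0). Qed.
Lemma thetaE s : theta s = \sum_(mon <- msupp s) s@_mon *: theta 'X_[mon].
Proof. by rewrite {1}[s]mpolyE theta_sum; apply: eq_bigr => i _; rewrite thetaZ. Qed.

Lemma xfilt_thetaX mon : xfilt (mdeg mon) (theta 'X_[mon]).
Proof. by rewrite thetaX mdegE; apply: xfilt_prod. Qed.

(** Moving [x i] past the factors preceding its place costs a commutator, which [xfilt_ad]
    bounds. *)
Lemma theta_xX i mon : xfilt (mdeg mon) (x i * theta 'X_[mon] - theta 'X_[U_(i) + mon]).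
Proof.
rewrite !thetaX mdegE.
have ie := mem_index_enum i; have ue := index_enum_uniq 'I_m.
case/splitPr: ie ue => r1 r2; rewrite cat_uniq /= => /and3P[_ /norP[ir1 _] /andP[ir2 _]].
have E (r : seq 'I_m) : i \notin r ->
    \prod_(j <- r) x j ^+ (U_(i) + mon)%MM j = \prod_(j <- r) x j ^+ mon j.
  move=> ir; apply: eq_big_seq => j jr; rewrite mnmDE mnm1E.
  by case: eqP ir => // ->; rewrite jr.
rewrite !big_cat /= !big_cons !E // mnmDE mnm1E eqxx exprS -mulrA mulrA.
set a := \prod_(j <- r1) _; set b := _ * \prod_(j <- r2) _.
have -> : x i * a * b - a * (x i * b) = (x i * a - a * x i) * b by rewrite mulrBl !mulrA.
by apply: xfilt_mul; [apply/xfilt_ad/xfilt_prod|apply: xfilt_mul; [apply: xfilt_exp|apply: xfilt_prod]].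
Qed.

(** The spanning half of PBW, with control of degrees; [msize] is the total degree plus one. *)
Lemma xfilt_theta_size d u : xfilt d u -> exists2 s, (msize s <= d.+1)%N & u = theta s.
Proof.
elim: d u => [|d IHd] u Hu.
  have [c ->] : exists c, u = c%:A.
    move e: 0%N Hu => d Hu; elim: Hu e => {d u} [d _|d _|d c u v _ IHu _ IHv e|//].
    - by exists 0; rewrite scale0r.
    - by exists 1; rewrite scale1r.
    - have [a ->] := IHu e; have [b ->] := IHv e; exists (c * a + b).
      by rewrite scalerDl scalerA.
  exists c%:MP; first by rewrite msizeC; case: (c != 0).
  by rewrite /theta mmapC.
move e: d.+1 Hu => d' Hu; elim: Hu e => {d' u} [d' _|d' ed|d' c u v _ IHu _ IHv e|d' i u Hu _ [e]].
- by exists 0; rewrite ?msize0 ?theta0.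
- by exists 1; rewrite ?msize1 ?theta1.
- have [s Hs ->] := IHu e; have [t Ht ->] := IHv e; exists (c *: s + t).
    by rewrite (leq_trans (msizeD_le _ _)) // geq_max (leq_trans (msizeZ_le _ _)).
  by rewrite thetaD thetaZ.
- rewrite -e in Hu *; have [s Hs ->] := IHd u Hu.
  have H mon : mon \in msupp s -> exists2 t, (msize t <= d.+2)%N & x i * theta 'X_[mon] = theta t.
    move=> /msize_mdeg_lt mons; have mond : (mdeg mon <= d)%N by rewrite -ltnS (leq_trans mons).
    have [t Ht et] := IHd _ (xfilt_le mond (theta_xX i mon)).
    exists ('X_[U_(i) + mon] + t); last by rewrite thetaD -et addrC subrK.
    rewrite (leq_trans (msizeD_le _ _)) // geq_max msizeX mdegD mdeg1 add1n !ltnS mond.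
    by rewrite (leq_trans Ht) // !ltnS ltnW.
  rewrite thetaE mulr_sumr.
  elim: (msupp s) H => [|mon r IHr] Hr; first by exists 0; rewrite ?msize0 // big_nil theta0.
  have [|t Ht et] := IHr; first by move=> m' m'r; apply: Hr; rewrite in_cons m'r orbT.
  have [t' Ht' et'] := Hr mon (mem_head _ _).
  exists (s@_mon *: t' + t); last by rewrite big_cons et -scalerAr et' thetaD thetaZ.
  by rewrite (leq_trans (msizeD_le _ _)) // geq_max (leq_trans (msizeZ_le _ _)).
Qed.

Lemma xfilt_ex u : exists d, xfilt d u.
Proof.
apply: (x_gen (P := fun u => exists d, xfilt d u)) u => [||c u v [d Hd] [e He]|i u [d Hd]].
- by exists 0%N; apply: xfilt0.
- by exists 0%N; apply: xfilt1.
- exists (maxn d e); apply: xfiltP.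
    by apply: xfilt_le Hd; apply: leq_maxl.
  by apply: xfilt_le He; apply: leq_maxr.
- by exists d.+1; apply: xfiltM.
Qed.

Lemma theta_surj u : exists s, u = theta s.
Proof. by have [d /xfilt_theta_size [s _ ->]] := xfilt_ex u; exists s. Qed.

Lemma xfilt_theta s d : (msize s <= d.+1)%N -> xfilt d (theta s).
Proof.
move=> sd; rewrite thetaE big_seq; elim/big_ind: _ => [||mon mons].
- exact: xfilt0.
- exact: xfiltD.
apply/xfiltZ; apply: xfilt_le (xfilt_thetaX mon).
by rewrite -ltnS (leq_trans (msize_mdeg_lt mons)).
Qed.

Lemma theta_XM mu mu' : exists2 r, (msize r <= mdeg mu + mdeg mu')%N &
  theta 'X_[mu] * theta 'X_[mu'] = theta ('X_[mu + mu'] + r).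
Proof.
have [k] := ubnP (mdeg mu); elim: k mu mu' => // k IH mu mu'; rewrite ltnS => muk.
have [/eqP|mu0] := eqVneq mu 0%MM.
  move=> /eqP ->; exists 0; rewrite ?msize0 // addr0.
  by rewrite mpolyX0 theta1 mul1r add0m.
have [i mui] : exists i, mu i != 0%N.
  apply: contrapT => H; case/eqP: mu0; apply/mnmP => i; rewrite mnm0E.
  by apply: contrapT => /eqP Hi; apply: H; exists i.
pose mu1 := (mu - U_(i))%MM.
have emu : mu = (U_(i) + mu1)%MM.
  by rewrite addmC submK //; apply/mnm_lepP => j; rewrite mnm1E; case: eqP => // <-; rewrite lt0n.
have dmu : mdeg mu = (mdeg mu1).+1 by rewrite {1}emu mdegD mdeg1 add1n.
have [r1 Hr1 er1] := IH mu1 mu' (leq_trans (eq_leq (esym dmu)) muk).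
pose D := (mdeg mu1 + mdeg mu')%N.
have H1 : xfilt D (x i * theta r1).
  case: (posnP D) => D0; last first.
    by rewrite -(prednK D0); apply/xfiltM/xfilt_theta; rewrite prednK.
  suff -> : r1 = 0 by rewrite theta0 mulr0; apply: xfilt0.
  by apply/eqP; rewrite -msize_poly_eq0 -leqn0 -D0.
have H2 : xfilt D (x i * theta 'X_[mu1 + mu'] - theta 'X_[mu + mu']).
  by have := theta_xX i (mu1 + mu'); rewrite mdegD -/D addmA -emu.
have H3 : xfilt D ((x i * theta 'X_[mu1] - theta 'X_[mu]) * theta 'X_[mu']).
  by apply: xfilt_mul; [rewrite emu; apply: theta_xX|apply: xfilt_thetaX].
have [s Hs es] := xfilt_theta_size (xfiltD (xfiltD H1 H2) (xfiltZ (-1) H3)).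
exists s; first by rewrite dmu addSn.
have Z (V : zmodType) (p w r v : V) : p = w + (r + (v - w) + (p - (v + r))).
  by rewrite [r + (v - w)]addrA [r + v]addrC [X in w + X]addrC subrKA addrC subrK.
rewrite thetaD -es scaleN1r mulrBl -[x i * _ * _]mulrA er1 thetaD mulrDr opprB; exact: Z.
Qed.

Lemma theta_Xmul mu s : exists2 r, (msize r <= mdeg mu + (msize s).-1)%N &
  theta 'X_[mu] * theta s = theta ('X_[mu] * s + r).
Proof.
have H (l : seq 'X_{1..m}) D : (forall mon, mon \in l -> (mdeg mon <= D)%N) ->
    exists2 r, (msize r <= mdeg mu + D)%N & theta 'X_[mu] * theta (\sum_(mon <- l) s@_mon *: 'X_[mon])
      = theta ('X_[mu] * (\sum_(mon <- l) s@_mon *: 'X_[mon]) + r).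
  elim: l => [|mon l IH] Hl.
    by exists 0; rewrite ?msize0 // !big_nil theta0 !mulr0 addr0 theta0.
  have [|t Ht et] := IH; first by move=> m' m'r; apply: Hl; rewrite in_cons m'r orbT.
  have [t' Ht' et'] := theta_XM mu mon.
  exists (s@_mon *: t' + t).
    rewrite (leq_trans (msizeD_le _ _)) // geq_max (leq_trans (msizeZ_le _ _)) //.
    by rewrite (leq_trans Ht') // leq_add2l Hl ?mem_head.
  rewrite !big_cons thetaD mulrDr et thetaZ -scalerAr et' -thetaZ -thetaD.
  by congr theta; rewrite mulrDr -scalerAr -mpolyXD scalerDr addrACA.
have [mon mons|r Hr] := H (msupp s) (msize s).-1.
  by have := msize_mdeg_lt mons; case: (msize s).
by rewrite -mpolyE => er; exists r.
Qed.

(** A Groebner basis argument: Dickson's lemma selects finitely many polynomials whose leading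
    monomials divide all those occurring over [L], and division by them lowers the leading monomial.
    Injectivity of [theta] does not enter, since one works with all polynomials sent into [L]. *)
Theorem almost_commutative_noetherian : noetherian A.
Proof.
apply: noetherian_left_ideals => L HL.
have Lmul a u : L u -> L (a * u) by exact: (submodZ HL a).
pose Ld : set {mpoly K[m]} := [set s | L (theta s) /\ s != 0].
pose co (s : {mpoly K[m]}) (i : nat) := if insub i is Some j then mlead s j else 0%N.
have [l [lL lP]] := dickson co m Ld.
exists [seq (theta s : A^o) | s <- l]; apply/seteqP; split; last first.
  by apply: (span_min HL) => _ /mapP[s /lL [? _] ->].
set S := span _; have HS : submod_set S := span_submod _.
suff H s : L (theta s) -> S (theta s).
  by move=> u; have [s ->] := theta_surj u; apply: H.
elim/mleadrect: s => s IH Ls.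
have [->|s0] := eqVneq s 0; first by rewrite theta0; apply: submod0 HS.
have [t tl tP] := lP s (conj Ls s0); have [Lt t0] := lL t tl.
have /mnm_lepP/submK emon : forall i, (mlead t i <= mlead s i)%N.
  by move=> i; have := tP i (ltn_ord i); rewrite /co valK.
set mu := (mlead s - mlead t)%MM in emon.
have [r Hr er] := theta_Xmul mu t.
pose c := mleadc s / mleadc t.
have tc0 : mleadc t != 0 by rewrite mleadc_eq0.
pose s' := s - c *: ('X_[mu] * t + r).
have St : S (theta t) by apply: span_mem; apply: map_f.
have es : theta s = theta s' + c *: (theta 'X_[mu] * theta t).
  by rewrite /s' thetaB thetaZ er subrK.
have SZ a u : S u -> S (a * u) by exact: (submodZ HS a).
have Sct : S (c *: (theta 'X_[mu] * theta t)).
  by rewrite -mulr_algl; exact/SZ/SZ.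
rewrite es; apply: (submodD HS) => //.
have Ls' : L (theta s').
  have -> : theta s' = theta s - c *: (theta 'X_[mu] * theta t) by rewrite es addrK.
  by apply: (submodB HL) => //; rewrite -mulr_algl; exact/Lmul/Lmul.
have [->|s'0] := eqVneq s' 0; first by rewrite theta0; apply: submod0 HS.
apply: IH => //; rewrite ltNge; apply/negP => les.
(* The correction [r] has degree below that of [mlead s], and the monomial order is compatible with
   degree, so [r] cannot contribute at a monomial at least [mlead s]. *)
have r0 : r@_(mlead s') = 0.
  apply: memN_msupp_eq0; apply: msize_mdeg_ge.
  rewrite (leq_trans Hr) //; apply: leq_trans (lemc_mdeg les).
  by rewrite -emon mdegD leq_add2l -mlead_deg.
have : s'@_(mlead s') = 0.
  have -> k : s'@_k = s@_k - c * (('X_[mu] * t)@_k + r@_k).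
    by rewrite mcoeffB mcoeffZ mcoeffD.
  rewrite r0 addr0.
  move: les; rewrite le_eqVlt => /orP[/eqP <-|lts].
    have -> : ('X_[mu] * t)@_(mlead s) = mleadc t by rewrite -emon mulrC mcoeffMX.
    by rewrite divfK // subrr.
  rewrite !mcoeff_gt_mlead ?mulr0 ?subr0 //.
  by apply: le_lt_trans (mleadM_le _ _) _; rewrite mleadXm emon.
by apply/eqP; rewrite mleadc_eq0.
Qed.

End AlmostCommutative.

(** * The PBW isomorphism for gl_n *)

Section LieModule.
Variables (K : fieldType) (V : lmodType K) (br : V -> V -> V) (W : lmodType K).
Variable r : V -> W -> W.
Hypothesis r_linl : forall a x y w, r (a *: x + y) w = a *: r x w + r y w.
Hypothesis r_linr : forall x, linear (r x).
Hypothesis r_lie : forall x y w, r (br x y) w = r x (r y w) - r y (r x w).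

(** Terms are interpreted directly as operators on [W], without packaging the endomorphisms of [W]
    as an algebra. *)
Fixpoint term_act (t : uea_term K V) : W -> W :=
  match t with
  | UGen x => r x
  | UCst a => fun w => a *: w
  | UAdd s t => fun w => term_act s w + term_act t w
  | UMul s t => fun w => term_act s (term_act t w)
  end.

Lemma term_act_linear t : linear (term_act t).
Proof.
elim: t => [x|a|s IHs t IHt|s IHs t IHt] b w w' /=.
- exact: r_linr.
- by rewrite scalerDr !scalerA mulrC.
- by rewrite IHs IHt scalerDr addrACA.
- by rewrite IHt IHs.
Qed.

Lemma term_act_eq s t : uea_eq br s t -> term_act s =1 term_act t.
Proof.
elim=> {s t} /=.
- by [].
- by move=> s t _ H w.
- by move=> s t u _ H1 _ H2 w; rewrite H1.
- by move=> s s' t t' _ H1 _ H2 w; rewrite H1 H2.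
- by move=> s s' t t' _ H1 _ H2 w; rewrite H1 H2.
- by move=> s t u w; rewrite addrA.
- by move=> s t w; rewrite addrC.
- by move=> s w; rewrite scale0r add0r.
- by move=> s w; rewrite scaleN1r addNr scale0r.
- by [].
- by move=> s w; rewrite scale1r.
- by [].
- move=> s t u w; have := term_act_linear s 1 (term_act t w) (term_act u w).
  by rewrite !scale1r.
- by move=> a b w; rewrite scalerDl.
- by move=> a b w; rewrite scalerA.
- move=> a s w; have e : term_act s 0 = 0.
    by have := term_act_linear s (-1) 0 0; rewrite scaler0 addr0 scaleN1r addNr.
  by have := term_act_linear s a w 0; rewrite e !addr0.
- by move=> a x y w; rewrite r_linl.
- by move=> x y w; rewrite r_lie scaleN1r.
Qed.

Definition uea_act (u : uea br) : W -> W := term_act (uea_repr u).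

Lemma uea_act_pi t : uea_act (uea_pi br t) =1 term_act t.
Proof. exact/term_act_eq/uea_repr_pi. Qed.

Lemma uea_act_linear u : linear (uea_act u). Proof. exact: term_act_linear. Qed.
Lemma uea_actD u v w : uea_act (u + v) w = uea_act u w + uea_act v w.
Proof. exact: uea_act_pi. Qed.
Lemma uea_actM u v w : uea_act (u * v) w = uea_act u (uea_act v w).
Proof. exact: uea_act_pi. Qed.
Lemma uea_act_cst a w : uea_act (uea_cst br a) w = a *: w.
Proof. exact: uea_act_pi. Qed.
Lemma uea_actZ a u w : uea_act (a *: u) w = a *: uea_act u w.
Proof. by rewrite [LHS]uea_actM uea_act_cst. Qed.
Lemma uea_act1 w : uea_act 1 w = w.
Proof. by rewrite [LHS]uea_act_cst scale1r. Qed.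
Lemma uea_act_gen x w : uea_act (uea_gen br x) w = r x w.
Proof. exact: uea_act_pi. Qed.
End LieModule.

Lemma uea_gen_ind (K : fieldType) (V : lmodType K) (br : V -> V -> V)
    (P : set (uea br)) : P 0 -> P 1 ->
  (forall c u v, P u -> P v -> P (c *: u + v)) ->
  (forall x u, P u -> P (uea_gen br x * u)) -> forall u, P u.
Proof.
move=> P0 P1 Pl PM u.
have PD v w : P v -> P w -> P (v + w) by move=> Pv Pw; rewrite -[v]scale1r; apply: Pl.
suff H t v : P v -> P (uea_pi br t * v) by rewrite -[u]mulr1 -(uea_reprK u); apply: H.
elim: t v => [x|a|s IHs t IHt|s IHs t IHt] v Pv.
- exact: PM.
- rewrite -[_ * v]/(a *: v) -[_ *: _]addr0; exact: Pl.
- rewrite -uea_piD -[_ * v]/((uea_pi br s + uea_pi br t) * v) mulrDl.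
  by apply: PD; [apply: IHs|apply: IHt].
- rewrite -uea_piM -[_ * v]/((uea_pi br s * uea_pi br t) * v) -mulrA.
  exact/IHs/IHt.
Qed.

Section MatrixUnits.
Variables (K : fieldType) (n : nat).
Notation U := (Ugl K n).

Definition glE (i j : 'I_n) : U := uea_gen (@commutator K n) (delta_mx i j).

Lemma uea_gen_mx (A : 'M[K]_n) :
  uea_gen (@commutator K n) A = \sum_i \sum_j A i j *: glE i j.
Proof.
rewrite {1}[A]matrix_sum_delta linear_sum; apply: eq_bigr => i _.
by rewrite linear_sum; apply: eq_bigr => j _; rewrite linearZ.
Qed.

Lemma glE_mul i j k l : glE i j * glE k l =
  glE k l * glE i j + ((j == k)%:R *: glE i l - (l == i)%:R *: glE k j).
Proof.
have e : commutator (delta_mx i j) (delta_mx k l : 'M[K]_n) =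
    (j == k)%:R *: delta_mx i l - (l == i)%:R *: delta_mx k j.
  by rewrite /commutator !mul_delta_mx_cond -!scaler_nat.
have := uea_gen_lie (@commutator K n) (delta_mx i j) (delta_mx k l).
rewrite e linearB !linearZ /= -!/(glE _ _) => ->.
by rewrite addrC subrK.
Qed.

Lemma Ugl_ind (P : set U) : P 0 -> P 1 ->
  (forall c u v, P u -> P v -> P (c *: u + v)) ->
  (forall i j u, P u -> P (glE i j * u)) -> forall u, P u.
Proof.
move=> P0 P1 Pl PM; apply: uea_gen_ind => // A u Pu.
have PD v w : P v -> P w -> P (v + w) by move=> Pv Pw; rewrite -[v]scale1r; apply: Pl.
rewrite uea_gen_mx mulr_suml; elim/big_ind: _ => // i _.
rewrite mulr_suml; elim/big_ind: _ => // j _.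
by rewrite -scalerAl -[_ *: _]addr0; apply: Pl => //; apply: PM.
Qed.
End MatrixUnits.

Lemma sum_delta_scale (R : nzRingType) (V : lmodType R) (I : finType) (a : I) (F : I -> V) :
  \sum_t (t == a)%:R *: F t = F a.
Proof.
by rewrite (bigD1 a) //= eqxx scale1r big1 ?addr0 // => t /negPf->; rewrite scale0r.
Qed.

Section Derivation.
Variables (K : fieldType) (N : nat).
Notation S := {mpoly K[N]}.

Definition der (v : 'I_N -> S) (s : S) : S := \sum_k v k * mderiv k s.

Lemma der_linear v : linear (der v).
Proof.
move=> c s t; rewrite /der scaler_sumr -big_split; apply: eq_bigr => p _ /=.
by rewrite linearP mulrDr scalerAr.
Qed.
HB.instance Definition _ v := GRing.isLinear.Build K S S *:%R (der v) (der_linear v).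

Lemma derP v c s t : der v (c *: s + t) = c *: der v s + der v t.
Proof. exact: der_linear. Qed.

Lemma derD v s t : der v (s + t) = der v s + der v t.
Proof. exact: linearD. Qed.

Lemma der_nat v k : der v k%:R = 0.
Proof. by rewrite /der big1 // => i _; rewrite -mpolyC_nat mderivC mulr0. Qed.

Lemma derM v s t : der v (s * t) = der v s * t + s * der v t.
Proof.
rewrite /der mulr_suml mulr_sumr -big_split; apply: eq_bigr => p _ /=.
by rewrite mderivM; ring.
Qed.

Lemma derX v k : der v 'X_k = v k.
Proof.
rewrite /der (bigD1 k) //= big1 => [|l lk]; rewrite mderivX mnm1E.
  by rewrite eqxx scale1r -[X in (X - _)%MM]add0m addmK mpolyX0 mulr1 addr0.
by rewrite eq_sym (negPf lk) scale0r mulr0.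
Qed.

Lemma derivation_eq0 (D : S -> S) : linear D ->
  (forall s t, D (s * t) = D s * t + s * D t) ->
  (forall k, D 'X_k = 0) -> forall s, D s = 0.
Proof.
move=> Dl DM DX s; pose D' := mk_linear Dl.
have D1 : D 1 = 0.
  have h := DM 1 1; rewrite !mulr1 mul1r in h.
  move: h; set z := D 1 => h.
  by have := congr1 (fun t => t - z) h; rewrite subrr addrK.
have DX' m : D 'X_[m] = 0.
  rewrite mpolyXE_id; elim/big_ind: _ => [//|a b Da Db|i _].
    by rewrite DM Da Db mul0r mulr0 addr0.
  elim: (m i) => [|k IH]; first by rewrite expr0.
  by rewrite exprS DM DX IH mul0r mulr0 addr0.
rewrite [s]mpolyE -[LHS]/(D' _) linear_sum big1 // => m _.
by rewrite linearZ /= DX' scaler0.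
Qed.

(** A commutator of derivations is a derivation, so it is determined by its values on the
    variables. *)
Lemma der_comm v w z : (forall k, der v (w k) - der w (v k) = z k) ->
  forall s, der v (der w s) - der w (der v s) = der z s.
Proof.
move=> H s; apply/eqP; rewrite -subr_eq0; apply/eqP.
apply: (derivation_eq0 (D := fun s => der v (der w s) - der w (der v s) - der z s)).
- by move=> c a b; rewrite !derP -!mul_mpolyC; ring.
- by move=> a b; rewrite !(derM, derD); ring.
- by move=> k; rewrite !derX H subrr.
Qed.

End Derivation.

Lemma mx_span_ind (K : fieldType) (n : nat) (P : 'M[K]_n -> Prop) : P 0 ->
  (forall c A B, P A -> P B -> P (c *: A + B)) ->
  (forall i j, P (delta_mx i j)) -> forall A, P A.
Proof.
move=> P0 Pl Pd A; rewrite [A]matrix_sum_delta.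
have PD B C : P B -> P C -> P (B + C) by move=> PB PC; rewrite -[B]scale1r; apply: Pl.
elim/big_ind: _ => // i _; elim/big_ind: _ => // j _.
by rewrite -[_ *: _]addr0; apply: Pl.
Qed.

Lemma commutator_delta (K : fieldType) (n : nat) (i j k l : 'I_n) :
  commutator (delta_mx i j) (delta_mx k l : 'M[K]_n) =
    (j == k)%:R *: delta_mx i l - (l == i)%:R *: delta_mx k j.
Proof. by rewrite /commutator !mul_delta_mx_cond -!scaler_nat. Qed.

Section PBW.
Variables (K : fieldType) (n N : nat).
Variables (e : 'I_N -> 'I_n * 'I_n) (e' : 'I_n * 'I_n -> 'I_N).
Hypotheses (eK : cancel e e') (e'K : cancel e' e).
Notation U := (Ugl K n).
Notation S := {mpoly K[N]}.
Notation y i j := ('X_(e' (i, j)) : S).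

Definition glx (k : 'I_N) : U := glE K (e k).1 (e k).2.

Lemma glE_glx i j : glE K i j = glx (e' (i, j)).
Proof. by rewrite /glx e'K. Qed.

Lemma glx_comm a b : exists (c : K) (l : 'I_N -> K),
  glx a * glx b = glx b * glx a + (c%:A + \sum_k l k *: glx k).
Proof.
case ea : (e a) => [i j]; case eb : (e b) => [k l]; rewrite /glx ea eb /= glE_mul.
exists 0, (fun t => (j == k)%:R * (t == e' (i, l))%:R - (l == i)%:R * (t == e' (k, j))%:R).
rewrite scale0r add0r; congr (_ + _).
under eq_bigr do rewrite scalerBl -!scalerA.
by rewrite sumrB -!scaler_sumr !sum_delta_scale !e'K.
Qed.

Lemma glx_gen (P : set U) : P 0 -> P 1 ->
  (forall c u v, P u -> P v -> P (c *: u + v)) ->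
  (forall i u, P u -> P (glx i * u)) -> forall u, P u.
Proof.
by move=> P0 P1 Pl PM; apply: Ugl_ind => // i j u Pu; rewrite glE_glx; apply: PM.
Qed.

Lemma Ugl_noetherian_enum : noetherian U.
Proof. exact: almost_commutative_noetherian glx_comm glx_gen. Qed.

Definition vecL i j (k : 'I_N) : S := (j == (e k).1)%:R * y i (e k).2.
Definition vecR i j (k : 'I_N) : S := ((e k).2 == i)%:R * y (e k).1 j.
Notation derL i j := (der (vecL i j)).
Notation derR i j := (der (vecR i j)).

Lemma derLy i j k l : derL i j (y k l) = (j == k)%:R * y i l.
Proof. by rewrite derX /vecL e'K. Qed.
Lemma derRy i j k l : derR i j (y k l) = (l == i)%:R * y k j.
Proof. by rewrite derX /vecR e'K. Qed.

(* Multiplication by [y_x] plus the derivation [b |-> x b] (resp. [b |-> b x]) *)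
(* of the symmetric algebra of the associative algebra of matrices: these two *)
(* commuting actions become left and right multiplication of [U(gl_n)] under  *)
(* the PBW isomorphism [u |-> u 1].                                           *)
Definition rho i j (s : S) : S := y i j * s + derL i j s.
Definition rho' i j (s : S) : S := y i j * s + derR i j s.

Lemma rho_linear i j : linear (rho i j).
Proof. by move=> c s t; rewrite /rho derP -!mul_mpolyC; ring. Qed.
HB.instance Definition _ i j := GRing.isLinear.Build K S S *:%R (rho i j) (rho_linear i j).
Lemma rho'_linear i j : linear (rho' i j).
Proof. by move=> c s t; rewrite /rho' derP -!mul_mpolyC; ring. Qed.
HB.instance Definition _ i j := GRing.isLinear.Build K S S *:%R (rho' i j) (rho'_linear i j).

Lemma derL_comm i j k l s : derL i j (derL k l s) - derL k l (derL i j s) =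
  (j == k)%:R * derL i l s - (l == i)%:R * derL k j s.
Proof.
rewrite (@der_comm _ _ _ _ (fun t => (j == k)%:R * vecL i l t - (l == i)%:R * vecL k j t)).
  rewrite /der !mulr_sumr -sumrB; apply: eq_bigr => t _; ring.
move=> t; rewrite /vecL !derM !derLy.
rewrite !der_nat; ring.
Qed.

Lemma rho_comm i j k l s : rho i j (rho k l s) - rho k l (rho i j s) =
  (j == k)%:R * rho i l s - (l == i)%:R * rho k j s.
Proof.
have H : derL i j (derL k l s) = derL k l (derL i j s) +
    ((j == k)%:R * derL i l s - (l == i)%:R * derL k j s).
  by rewrite -derL_comm addrC subrK.
by rewrite /rho !derD !derM !derLy H; ring.
Qed.

Lemma derLR_comm i j k l s : derL i j (derR k l s) = derR k l (derL i j s).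
Proof.
apply/eqP; rewrite -subr_eq0; apply/eqP.
rewrite (@der_comm _ _ _ _ (fun _ => 0)) => [|t].
  by rewrite /der big1 // => t _; rewrite mul0r.
by rewrite /vecL /vecR !derM !der_nat !derLy !derRy; ring.
Qed.

Lemma rho_rho' i j k l s : rho i j (rho' k l s) = rho' k l (rho i j s).
Proof.
rewrite /rho /rho' !derD !derM derLR_comm derLy derRy.
by ring.
Qed.

Definition rhom (A : 'M[K]_n) (s : S) : S := \sum_i \sum_j A i j *: rho i j s.

Lemma rhom_linr A : linear (rhom A).
Proof.
move=> c s t; rewrite /rhom scaler_sumr -big_split; apply: eq_bigr => i _ /=.
rewrite scaler_sumr -big_split; apply: eq_bigr => j _ /=.
by rewrite linearP scalerDr !scalerA mulrC.
Qed.

Lemma rhom_linl c A B s : rhom (c *: A + B) s = c *: rhom A s + rhom B s.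
Proof.
rewrite /rhom scaler_sumr -big_split; apply: eq_bigr => i _ /=.
rewrite scaler_sumr -big_split; apply: eq_bigr => j _ /=.
by rewrite !mxE scalerDl scalerA.
Qed.

Lemma rhom_delta i j s : rhom (delta_mx i j) s = rho i j s.
Proof.
rewrite /rhom (bigD1 i) //= [X in _ + X]big1 ?addr0 => [|k ki]; last first.
  by rewrite big1 // => l _; rewrite mxE (negPf ki) scale0r.
rewrite (bigD1 j) //= [X in _ + X]big1 ?addr0 => [|l lj].
  by rewrite mxE !eqxx scale1r.
by rewrite mxE (negPf lj) andbF scale0r.
Qed.

Lemma rhom_lie A B s :
  rhom (commutator A B) s = rhom A (rhom B s) - rhom B (rhom A s).
Proof.
have r0 s' : rhom 0 s' = 0.
  by rewrite /rhom big1 // => i _; rewrite big1 // => j _; rewrite mxE scale0r.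
have r0' A' : rhom A' 0 = 0 := linear0 (mk_linear (rhom_linr A')).
move: A; apply: mx_span_ind => [|c A1 A2 H1 H2|i j].
- by rewrite /commutator mul0mx mulmx0 subr0 !r0 r0' subrr.
- have -> : commutator (c *: A1 + A2) B = c *: commutator A1 B + commutator A2 B.
    by rewrite /commutator mulmxDl mulmxDr -scalemxAl -scalemxAr opprD addrACA scalerBr.
  rewrite rhom_linl H1 H2 !rhom_linl rhom_linr.
  by rewrite scalerBr opprD addrACA.
move: B; apply: mx_span_ind => [|c B1 B2 H1 H2|k l].
- by rewrite /commutator mul0mx mulmx0 subr0 !r0 r0' subrr.
- have -> : commutator (delta_mx i j) (c *: B1 + B2)
      = c *: commutator (delta_mx i j) B1 + commutator (delta_mx i j) B2.
    by rewrite /commutator mulmxDl mulmxDr -scalemxAl -scalemxAr opprD addrACA scalerBr.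
  rewrite rhom_linl H1 H2 !rhom_linl rhom_linr.
  by rewrite scalerBr opprD addrACA.
rewrite !rhom_delta rho_comm commutator_delta.
have -> : (j == k)%:R *: delta_mx i l - (l == i)%:R *: delta_mx k j =
  (j == k)%:R *: delta_mx i l + (- (l == i)%:R *: delta_mx k j + 0) :> 'M[K]_n.
  by rewrite addr0 scaleNr.
by rewrite !rhom_linl !rhom_delta r0 addr0 scaleNr !scaler_nat !mulr_natl.
Qed.

Definition act (u : U) (s : S) : S := uea_act rhom u s.

Lemma act_linear u : linear (act u).
Proof. exact: (uea_act_linear rhom_linr). Qed.
HB.instance Definition _ u := GRing.isLinear.Build K S S *:%R (act u) (act_linear u).
Lemma actD u v s : act (u + v) s = act u s + act v s.
Proof. exact: (uea_actD rhom_linl rhom_linr rhom_lie). Qed.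
Lemma actM u v s : act (u * v) s = act u (act v s).
Proof. exact: (uea_actM rhom_linl rhom_linr rhom_lie). Qed.
Lemma actZ a u s : act (a *: u) s = a *: act u s.
Proof. exact: (uea_actZ rhom_linl rhom_linr rhom_lie). Qed.
Lemma act1 s : act 1 s = s.
Proof. exact: (uea_act1 rhom_linl rhom_linr rhom_lie). Qed.
Lemma act_glE i j s : act (glE K i j) s = rho i j s.
Proof. by rewrite -rhom_delta; exact: (uea_act_gen rhom_linl rhom_linr rhom_lie). Qed.

Definition tau (u : U) : S := act u 1.

Lemma tau_linear : linear tau.
Proof. by move=> a u v; rewrite /tau actD actZ. Qed.
HB.instance Definition _ := GRing.isLinear.Build K U S *:%R tau tau_linear.

Lemma act0 s : act 0 s = 0. Proof. by rewrite -(scale0r 0) actZ scale0r. Qed.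

Lemma act_rho' u i j s : act u (rho' i j s) = rho' i j (act u s).
Proof.
move: u s; apply: Ugl_ind => [s|s|c u v Hu Hv s|k l u Hu s].
- by rewrite !act0 linear0.
- by rewrite !act1.
- by rewrite !actD !actZ Hu Hv linearP.
- by rewrite !actM Hu !act_glE rho_rho'.
Qed.

Lemma tau_mul u v : tau (u * v) = act u (tau v). Proof. exact: actM. Qed.

(** Left action and [rho'] commute, and [rho] and [rho'] agree on 1. *)
Lemma tau_mul_glE u i j : tau (u * glE K i j) = rho' i j (tau u).
Proof.
rewrite tau_mul -act_rho' /tau act_glE /rho /rho'.
by rewrite -[1]/(1%:R) !der_nat.
Qed.

(** The multiplication terms of [rho] and [rho'] cancel. Thus [tau] is exactly equivariant for the
    adjoint action, not merely up to lower degree. *)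
Lemma tau_ad u i j :
  tau (glE K i j * u - u * glE K i j) = derL i j (tau u) - derR i j (tau u).
Proof.
rewrite linearB /= tau_mul_glE tau_mul act_glE /rho /rho'.
by rewrite opprD addrACA subrr add0r.
Qed.

End PBW.

Section Degree.
Variables (K : fieldType) (N : nat).
Notation S := {mpoly K[N]}.

Lemma msize_le (s : S) d : (forall m, m \in msupp s -> (mdeg m < d)%N) -> (msize s <= d)%N.
Proof. by move=> H; rewrite msizeE; apply/bigmax_leqP_seq => m ms _; apply: H. Qed.

Lemma msizeD (s t : S) d : (msize s <= d)%N -> (msize t <= d)%N -> (msize (s + t) <= d)%N.
Proof. by move=> Hs Ht; rewrite (leq_trans (msizeD_le _ _)) // geq_max Hs. Qed.

Lemma msize_sum (I : Type) (r : seq I) (F : I -> S) d :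
  (forall i, (msize (F i) <= d)%N) -> (msize (\sum_(i <- r) F i) <= d)%N.
Proof.
by move=> H; elim/big_ind: _ => // [|s t]; [rewrite msize0|apply: msizeD].
Qed.

Lemma msize_mul (s t : S) d d' : (msize s <= d.+1)%N -> (msize t <= d')%N ->
  (msize (s * t) <= d + d')%N.
Proof.
have [->|s0] := eqVneq s 0; first by rewrite mul0r msize0.
have [->|t0] := eqVneq t 0; first by rewrite mulr0 msize0.
move=> Hs Ht; rewrite msizeM //; have := leq_add Hs Ht.
by case: (_ + _)%N => //= k; rewrite addSn ltnS.
Qed.

Lemma msize_mderiv k (s : S) : (msize (mderiv k s) <= (msize s).-1)%N.
Proof.
apply: msize_le => m; rewrite mcoeff_msupp mcoeff_mderiv => H.
have : (m + U_(k))%MM \in msupp s.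
  by rewrite mcoeff_msupp; apply: contraNneq H => ->; rewrite mul0rn.
by move=> /msize_mdeg_lt; rewrite mdegD mdeg1 addn1; case: (msize s).
Qed.

Lemma msize_der (v : 'I_N -> S) s : (forall k, (msize (v k) <= 2)%N) ->
  (msize (der v s) <= msize s)%N.
Proof.
move=> Hv; rewrite /der; apply: msize_sum => k.
have [->|s0] := eqVneq s 0; first by rewrite linear0 mulr0.
have := msize_mul (Hv k) (msize_mderiv k s); rewrite add1n prednK //.
by rewrite lt0n msize_poly_eq0.
Qed.
End Degree.

Section PBWIso.
Variables (K : fieldType) (n N : nat).
Variables (e : 'I_N -> 'I_n * 'I_n) (e' : 'I_n * 'I_n -> 'I_N).
Hypotheses (eK : cancel e e') (e'K : cancel e' e).
Notation U := (Ugl K n).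
Notation S := {mpoly K[N]}.
Notation y i j := ('X_(e' (i, j)) : S).
Notation act := (@act K n N e e').
Notation tau := (@tau K n N e e').
Notation theta := (theta (glx K e)).

(* [u] acts on the symmetric algebra as multiplication by [f], up to lower    *)
(* order terms; [f] represents the symbol of [u] in degree [d].               *)
Definition approx d (u : U) (f : S) : Prop := (msize f <= d.+1)%N /\
  forall k s, (msize s <= k.+1)%N -> (msize (act u s - f * s) <= d + k)%N.

Lemma approx_act d u f k s : approx d u f -> (msize s <= k)%N -> (msize (act u s) <= d + k)%N.
Proof.
move=> [Hf H]; case: k => [|k] Hs.
  by move: Hs; rewrite leqn0 msize_poly_eq0 => /eqP->; rewrite linear0 msize0.
rewrite -[act u s](subrK (f * s)); apply: msizeD; last exact: msize_mul.
by rewrite (leq_trans (H k s Hs)) // leq_add2l.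
Qed.

Lemma approx_glE i j : approx 1 (glE K i j) (y i j).
Proof.
split=> [|k s Hs]; first by rewrite msizeX mdeg1.
rewrite (act_glE e'K) /rho addrAC subrr add0r add1n; apply: leq_trans Hs.
apply: msize_der => t; rewrite /vecL.
by case: (_ == _); rewrite ?mul1r ?mul0r ?msize0 // msizeX mdeg1.
Qed.

Lemma approx1 : approx 0 1 1.
Proof. by split=> [|k s _]; rewrite ?msize1 // (act1 e'K) mul1r subrr msize0. Qed.

Lemma approxM d d' u v f g : approx d u f -> approx d' v g -> approx (d + d') (u * v) (f * g).
Proof.
move=> Hu Hv; split.
  rewrite -addnS; apply: msize_mul; [exact: (proj1 Hu)|exact: (proj1 Hv)].
move=> k s Hs; rewrite (actM e'K).
have -> : act u (act v s) - f * g * s =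
    act u (act v s - g * s) + (act u (g * s) - f * (g * s)).
  by rewrite linearB /= mulrA addrA subrK.
rewrite -addnA; apply: msizeD.
  by apply: (approx_act Hu); apply: (proj2 Hv).
by apply: (proj2 Hu); rewrite -addnS; apply: msize_mul => //; apply: (proj1 Hv).
Qed.

Lemma approxP d c u v f g : approx d u f -> approx d v g -> approx d (c *: u + v) (c *: f + g).
Proof.
move=> [Hf Hu] [Hg Hv]; split.
  by apply: msizeD => //; rewrite (leq_trans (msizeZ_le _ _)).
move=> k s Hs; rewrite (actD e'K) (actZ e'K).
have -> : c *: act u s + act v s - (c *: f + g) * s =
    c *: (act u s - f * s) + (act v s - g * s).
  by rewrite mulrDl opprD addrACA scalerBr scalerAl.
apply: msizeD; last exact: Hv.
by rewrite (leq_trans (msizeZ_le _ _)) // Hu.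
Qed.

Lemma approx0 d : approx d 0 0.
Proof. by split=> [|k s _]; rewrite ?msize0 // (act0 e'K) mul0r subrr msize0. Qed.

Lemma approxD d u v f g : approx d u f -> approx d v g -> approx d (u + v) (f + g).
Proof. by move=> Hu Hv; rewrite -[u]scale1r -[f]scale1r; apply: approxP. Qed.

Lemma approxZ d c u f : approx d u f -> approx d (c *: u) (c *: f).
Proof.
by move=> Hu; rewrite -[c *: u]addr0 -[c *: f]addr0; apply: approxP => //; apply: approx0.
Qed.

Lemma approx_sum d (I : Type) (r : seq I) (F : I -> U) (G : I -> S) :
  (forall i, approx d (F i) (G i)) -> approx d (\sum_(i <- r) F i) (\sum_(i <- r) G i).
Proof.
by move=> H; elim/big_ind2: _ => // [|*]; [apply: approx0|apply: approxD].
Qed.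

Lemma approx_le d d' u f : (d <= d')%N -> approx d u f -> approx d' u f.
Proof.
move=> dd' [Hf Hu]; split=> [|k s Hs]; first by rewrite (leq_trans Hf).
by rewrite (leq_trans (Hu k s Hs)) // leq_add2r.
Qed.

Lemma approx_prod (I : Type) (r : seq I) (F : I -> U) (G : I -> S) (D : I -> nat) :
  (forall i, approx (D i) (F i) (G i)) ->
  approx (\sum_(i <- r) D i) (\prod_(i <- r) F i) (\prod_(i <- r) G i).
Proof.
move=> H; elim: r => [|i r IH]; first by rewrite !big_nil; apply: approx1.
by rewrite !big_cons; apply: approxM.
Qed.

Lemma approx_exp d u f k : approx d u f -> approx (k * d) (u ^+ k) (f ^+ k).
Proof.
move=> H; elim: k => [|k IH]; first exact: approx1.
by rewrite !exprS mulSn; apply: approxM.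
Qed.

Lemma approx_theta d s : (msize s <= d.+1)%N -> approx d (theta s) s.
Proof.
move=> Hs; rewrite thetaE {3}[s]mpolyE big_seq [X in approx _ _ X]big_seq.
elim/big_ind2: _ => [|u f v g|m ms]; [exact: approx0|exact: approxD|].
apply/approxZ; apply: (@approx_le (mdeg m)).
  by rewrite -ltnS (leq_trans (msize_mdeg_lt ms)).
rewrite thetaX mpolyXE_id mdegE; apply: approx_prod => k.
rewrite -[X in approx X]muln1; apply: approx_exp.
rewrite /glx -[k in 'X_k]eK; case: (e k) => i j; exact: approx_glE.
Qed.

(** The composite of [theta] and [tau] is the identity up to lower degree. Hence [theta] is
    injective, which is the PBW theorem, and [tau] is bijective. *)
Lemma tau_theta d s : (msize s <= d.+1)%N -> (msize (tau (theta s) - s) <= d)%N.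
Proof.
move=> /approx_theta [_ /(_ 0%N 1)]; rewrite mulr1 addn0; apply.
by rewrite msize1.
Qed.

Lemma tau_theta_inj s : tau (theta s) = 0 -> s = 0.
Proof.
move=> H; apply/eqP; apply: contrapT => /negP; rewrite -msize_poly_eq0 -lt0n => s0.
have := @tau_theta (msize s).-1 s; rewrite H prednK // leqnn => /(_ isT).
by rewrite sub0r -scaleN1r msizeZ ?oppr_eq0 ?oner_eq0 // leqNgt ltn_predL s0.
Qed.

Lemma theta_inj s : theta s = 0 -> s = 0.
Proof. by move=> H; apply: tau_theta_inj; rewrite H linear0. Qed.

Lemma theta_glx_surj u : exists s, u = theta s.
Proof. exact: (theta_surj (glx_comm K e'K) (glx_gen e'K)). Qed.

Lemma tau_inj u : tau u = 0 -> u = 0.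
Proof. by have [s ->] := theta_glx_surj u; move=> /tau_theta_inj ->; apply: theta0. Qed.

Lemma tau_surj s : exists u, tau u = s.
Proof.
have [k] := ubnP (msize s); elim: k s => // k IH s; rewrite ltnS => sk.
case: k IH sk => [|k] IH sk.
  by move: sk; rewrite leqn0 msize_poly_eq0 => /eqP->; exists 0; rewrite linear0.
have [u Hu] := IH (tau (theta s) - s) (tau_theta sk).
by exists (theta s - u); rewrite linearB /= Hu subKr.
Qed.

Lemma approx_tau_mul d d' u v f : approx d u f -> (msize (tau v) <= d'.+1)%N ->
  (msize (tau (u * v) - f * tau v) <= d + d')%N.
Proof. by move=> [_ H] Hv; rewrite (tau_mul e'K); apply: H. Qed.

End PBWIso.

(** * Casimir elements and invariants *)

Section MatrixPowers.
Variables (A : nzRingType) (n : nat) (X : 'M[A]_n).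

Fixpoint mxpow r : 'M[A]_n := if r is r'.+1 then X *m mxpow r' else 1%:M.

Lemma mxpowS i j r : mxpow r.+1 i j = \sum_k X i k * mxpow r k j.
Proof. by rewrite /= mxE. Qed.

Variables (D : {additive A -> A}) (a b : 'I_n).
Hypothesis DM : forall u v, D (u * v) = D u * v + u * D v.
Hypothesis DX : forall i j, D (X i j) = (b == i)%:R * X a j - (j == a)%:R * X i b.

Lemma derivation1 : D 1 = 0.
Proof.
have h := DM 1 1; rewrite !mulr1 mul1r in h; move: h; set z := D 1 => h.
by have := congr1 (fun t => t - z) h; rewrite subrr addrK.
Qed.

Lemma sum_delta_l (I : finType) (i : I) (F : I -> A) : \sum_k (i == k)%:R * F k = F i.
Proof.
rewrite (bigD1 i) //= eqxx mul1r big1 ?addr0 // => k /negPf ki.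
by rewrite eq_sym ki mul0r.
Qed.

(** A derivation acting on the entries of [X] as bracketing with a matrix unit acts in the same way
    on powers of [X]. The entries need not commute, so this serves both the Casimir elements of [U]
    and the trace polynomials. *)
Lemma derivation_mxpow r i j :
  D (mxpow r i j) = (b == i)%:R * mxpow r a j - (j == a)%:R * mxpow r i b.
Proof.
elim: r i j => [|r IH] i j.
  rewrite !mxE raddfMn derivation1 mul0rn -!natrM !mulnb [j == a]eq_sym.
  by rewrite [i == b]eq_sym andbC subrr.
rewrite mxpowS raddf_sum /=.
under eq_bigr do rewrite DM DX IH mulrBl mulrBr.
rewrite big_split /= !sumrB.
have -> : \sum_k (b == i)%:R * X a k * mxpow r k j = (b == i)%:R * mxpow r.+1 a j.
  by rewrite mxpowS mulr_sumr; apply: eq_bigr => k _; rewrite mulrA.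
have -> : \sum_k (k == a)%:R * X i b * mxpow r k j = X i b * mxpow r a j.
  under eq_bigr do rewrite eq_sym -mulrA; exact: sum_delta_l.
have -> : \sum_k X i k * ((b == k)%:R * mxpow r a j) = X i b * mxpow r a j.
  under eq_bigr do rewrite mulrA commr_nat -mulrA.
  exact: sum_delta_l.
have -> : \sum_k X i k * ((j == a)%:R * mxpow r k b) = (j == a)%:R * mxpow r.+1 i b.
  by rewrite mxpowS mulr_sumr; apply: eq_bigr => k _; rewrite !mulrA commr_nat.
by rewrite addrA subrK.
Qed.

Lemma derivation_mxtrace r : D (\tr (mxpow r)) = 0.
Proof.
rewrite /mxtrace raddf_sum /=; under eq_bigr do rewrite derivation_mxpow.
rewrite sumrB sum_delta_l; under [X in _ - X]eq_bigr do rewrite eq_sym.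
by rewrite sum_delta_l subrr.
Qed.
End MatrixPowers.

Section Casimir.
Variables (K : fieldType) (n : nat).
Notation U := (Ugl K n).

Definition glmx : 'M[U]_n := \matrix_(i, j) glE K i j.
Definition casimir r : U := \tr (mxpow glmx r).

Lemma casimir_central r u : casimir r * u = u * casimir r.
Proof.
move: u; apply: Ugl_ind => [||c u v Hu Hv|a b u Hu].
- by rewrite mulr0 mul0r.
- by rewrite mulr1 mul1r.
- by rewrite mulrDl mulrDr -scalerAl -scalerAr Hu Hv.
suff H : glE K a b * casimir r = casimir r * glE K a b by rewrite mulrA -H -mulrA Hu mulrA.
apply/subr0_eq.
pose D u := glE K a b * u - u * glE K a b.
have DD : additive D by move=> v w; rewrite /D mulrBr mulrBl !opprB [X in _ + X]addrC addrACA [- _ + _]addrC.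
pose D' : {additive U -> U} := HB.pack D (GRing.isZmodMorphism.Build U U D DD).
have DM v w : D' (v * w) = D' v * w + v * D' w.
  by rewrite /= /D mulrBl mulrBr !mulrA addrA subrK.
have DX i j : D' (glmx i j) = (b == i)%:R * glmx a j - (j == a)%:R * glmx i b.
  rewrite /= !mxE /D glE_mul addrAC subrr add0r.
  by rewrite !mulr_natl !scaler_nat.
exact: (derivation_mxtrace DM DX).
Qed.

End Casimir.

(** * Equivariant polynomial maps and their restriction to diagonal matrices *)

Section DiagonalRestriction.
Variables (K : fieldType) (n N : nat).
Variables (e : 'I_N -> 'I_n * 'I_n) (e' : 'I_n * 'I_n -> 'I_N).
Hypotheses (eK : cancel e e') (e'K : cancel e' e).
Hypothesis K0 : forall k : nat, k.+1%:R != 0 :> K.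
Notation S := {mpoly K[N]}.
Notation y i j := ('X_(e' (i, j)) : S).

Definition offdiag (k : 'I_N) : bool := (e k).1 != (e k).2.
Definition offdeg (m : 'X_{1..N}) : nat := \sum_k offdiag k * m k.

Lemma offdegD m m' : offdeg (m + m')%MM = (offdeg m + offdeg m')%N.
Proof. by rewrite /offdeg -big_split; apply: eq_bigr => k _; rewrite mnmDE mulnDr. Qed.

Lemma offdegU k : offdeg U_(k)%MM = offdiag k.
Proof.
rewrite /offdeg (bigD1 k) //= mnm1E eqxx muln1 big1 ?addn0 // => l lk.
by rewrite mnm1E eq_sym (negPf lk) muln0.
Qed.

Lemma mnm_subUK (m : 'X_{1..N}) k : (0 < m k)%N -> (m - U_(k) + U_(k))%MM = m.
Proof.
by move=> mk; apply: submK; apply/mnm_lepP => l; rewrite mnm1E; case: eqP => // <-.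
Qed.

Lemma offdeg_sub (m : 'X_{1..N}) k : (0 < m k)%N ->
  offdeg m = (offdeg (m - U_(k))%MM + offdiag k)%N.
Proof. by move=> mk; rewrite -{1}(mnm_subUK mk) offdegD offdegU. Qed.

Lemma mcoeffXUM k (s : S) M :
  ('X_k * s)@_M = if (0 < M k)%N then s@_(M - U_(k))%MM else 0.
Proof.
case: ltnP => Mk; first by rewrite -{1}(mnm_subUK Mk) addmC mulrC mcoeffMX.
rewrite [s]mpolyE mulr_sumr raddf_sum big1 // => m _ /=.
rewrite -scalerAr -mpolyXD mcoeffZ mcoeffX; case: eqP => [E|_]; last by rewrite mulr0.
by move: Mk; rewrite -E mnmDE mnm1E eqxx.
Qed.

(** Under the last hypothesis the operator X_l d/dX_k does not lower the off-diagonal degree. *)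
Lemma mcoeff_Xderiv0 k l (s : S) M o : (forall m, (offdeg m < o)%N -> s@_m = 0) ->
  (offdeg M < o)%N -> (offdiag k <= offdiag l)%N -> ('X_l * mderiv k s)@_M = 0.
Proof.
move=> Hs HM kl; rewrite mcoeffXUM; case: ltnP => // Ml.
rewrite mcoeff_mderiv Hs ?mul0rn //; apply: leq_ltn_trans HM.
by rewrite (offdeg_sub Ml) offdegD offdegU leq_add2l.
Qed.

Variables (I : finType) (C : 'I_n -> 'I_n -> I -> I -> K) (f : I -> S).
Hypothesis f_inv : forall a b t, der (vecL K e e' a b) (f t) - der (vecR K e e' a b) (f t)
  = \sum_t' C a b t t' *: f t'.

(* In the lowest off-diagonal degree, the adjoint action of [E_ij] is           *)
(* [(y i i - y j j) * mderiv (j, i)], so that an equivariant polynomial map is  *)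
(* determined by its restriction to diagonal matrices.                        *)
Lemma invariant_coef_step i j o t M : i != j -> offdeg M = o ->
  (forall t m, (offdeg m <= o)%N -> (f t)@_m = 0) ->
  (y i i * mderiv (e' (j, i)) (f t))@_M = (y j j * mderiv (e' (j, i)) (f t))@_M.
Proof.
move=> ij HM Hf; apply/eqP; rewrite -subr_eq0; apply/eqP.
have := congr1 (mcoeff M) (f_inv i j t).
have -> : (\sum_t' C i j t t' *: f t')@_M = 0.
  by rewrite raddf_sum /= big1 // => t' _; rewrite mcoeffZ Hf ?HM ?mulr0.
have E v (s : S) : (der v s)@_M = \sum_k (v k * mderiv k s)@_M by rewrite /der raddf_sum.
rewrite mcoeffB !E -sumrB (bigD1 (e' (j, i))) //= big1 => [|k kne].
  by rewrite addr0 /vecL /vecR e'K /= !eqxx !mul1r.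
have Hs m : (offdeg m < o.+1)%N -> (f t)@_m = 0 by rewrite ltnS; apply: Hf.
have HM' : (offdeg M < o.+1)%N by rewrite HM.
have kji : e k != (j, i) by apply: contraNneq kne => ke; rewrite -ke eK.
rewrite /vecL /vecR; move: kji; case ek : (e k) => [a b] /= kji.
have X0 l : (offdiag k <= offdiag l)%N -> ('X_l * mderiv k (f t))@_M = 0.
  exact: mcoeff_Xderiv0 Hs HM'.
have -> : ((j == a)%:R * y i b * mderiv k (f t))@_M = 0.
  case: eqP => [ja|_]; last by rewrite !mul0r mcoeff0.
  rewrite mul1r X0 // /offdiag ek e'K /= -ja; case: (eqVneq i b) => [ib|_]; last exact: leq_b1.
  by rewrite -ja ib eqxx in kji.
have -> : ((b == i)%:R * y a j * mderiv k (f t))@_M = 0.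
  case: eqP => [bi|_]; last by rewrite !mul0r mcoeff0.
  rewrite mul1r X0 // /offdiag ek e'K /= bi; case: (eqVneq a j) => [aj|_]; last exact: leq_b1.
  by rewrite bi aj eqxx in kji.
by rewrite subr0.
Qed.

(** Induction on the off-diagonal degree [o]. By [invariant_coef_step], the part of degree [o] of an
    off-diagonal derivative of [f t] is killed by y_ii - y_jj, hence vanishes in the polynomial
    domain. In characteristic zero this kills the coefficients of off-diagonal degree [o + 1]. *)
Lemma invariant_eq0 : (forall t m, offdeg m = 0%N -> (f t)@_m = 0) -> forall t, f t = 0.
Proof.
move=> H0; suff H o t m : (offdeg m <= o)%N -> (f t)@_m = 0.
  by move=> t; apply/mpolyP => m; rewrite mcoeff0 (H (offdeg m)).
elim: o t m => [|o IH] t m; first by rewrite leqn0 => /eqP; apply: H0.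
rewrite leq_eqVlt => /orP[/eqP mo|]; last by rewrite ltnS; apply: IH.
have [k [mk ok]] : exists k, (0 < m k)%N /\ offdiag k.
  apply: contrapT => Hk; move: mo; rewrite /offdeg big1 // => k _.
  case ok: (offdiag k); last by rewrite mul0n.
  case mk: (m k) => [|p]; first by rewrite muln0.
  by case: Hk; exists k; rewrite mk ok.
move: ok; rewrite /offdiag; case ek : (e k) => [j i] /= ji.
have ke : k = e' (j, i) by rewrite -ek eK.
pose g := mderiv k (f t).
have Hg M : offdeg M = o -> (y i i * g)@_M = (y j j * g)@_M.
  move=> HM; have ij : i != j by rewrite eq_sym.
  by rewrite /g ke; apply: (invariant_coef_step _ ij HM IH).
pose g' : S := \sum_(m <- msupp g | offdeg m == o) g@_m *: 'X_[m].
have gE M : g@_M = \sum_(m <- msupp g) g@_m * (m == M)%:R.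
  rewrite {1}[g]mpolyE raddf_sum; apply: eq_bigr => m' _.
  by rewrite /= mcoeffZ mcoeffX.
have g'E M : g'@_M = if offdeg M == o then g@_M else 0.
  have -> : g'@_M = \sum_(m <- msupp g | offdeg m == o) g@_m * (m == M)%:R.
    by rewrite /g' raddf_sum; apply: eq_bigr => m' _; rewrite /= mcoeffZ mcoeffX.
  case: ifP => HM; last first.
    by rewrite big1 // => m' m'o; case: eqP => [E|_]; [rewrite -E m'o in HM|rewrite mulr0].
  rewrite [RHS]gE big_mkcond; apply: eq_bigr => m' _.
  by case: ifP => // m'o; case: eqP => [E|_]; [rewrite E HM in m'o|rewrite mulr0].
have Xg' l M : ~~ offdiag l ->
    ('X_l * g')@_M = if offdeg M == o then ('X_l * g)@_M else 0.
  move=> /negPf ol; rewrite !mcoeffXUM; case: ltnP => Ml; last by rewrite if_same.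
  by rewrite g'E (offdeg_sub Ml) ol addn0.
have : (y i i - y j j) * g' = 0.
  apply/mpolyP => M; rewrite mulrBl mcoeffB mcoeff0 !Xg' ?/offdiag ?e'K /= ?eqxx //.
  by case: eqP => [/Hg->|_]; rewrite subrr.
move/eqP; rewrite mulf_eq0 subr_eq0 => /orP[/eqP/(congr1 (mcoeff U_(e' (i, i))%MM))|/eqP g'0].
  rewrite !mcoeffX !eqxx; case: eqP => [/(congr1 (fun m : 'X_{1..N} => m (e' (i, i))))|_ /eqP].
    by rewrite !mnm1E eqxx (can_eq e'K) xpair_eqE (negPf ji).
  by rewrite oner_eq0.
have := congr1 (mcoeff (m - U_(k))%MM) g'0.
rewrite g'E mcoeff0; have := offdeg_sub mk; rewrite mo /offdiag ek /= ji addn1 => -[<-].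
rewrite eqxx /g mcoeff_mderiv mnm_subUK // => /eqP.
by rewrite -mulr_natr mulf_eq0 (negPf (K0 _)) orbF => /eqP.
Qed.
End DiagonalRestriction.

Section ThetaComm.
Variables (K : fieldType) (m : nat).

Lemma theta_map (A B : algType K) (g : {lrmorphism A -> B}) (x : 'I_m -> A) s :
  g (theta x s) = theta (g \o x) s.
Proof.
rewrite thetaE (thetaE (g \o x)) linear_sum; apply: eq_bigr => mon _.
rewrite linearZ /= !thetaX rmorph_prod; congr (_ *: _); apply: eq_bigr => i _.
by rewrite rmorphXn.
Qed.

Variables (A : comAlgType K) (x : 'I_m -> A).

Lemma thetaM s t : theta x (s * t) = theta x s * theta x t.
Proof. exact: (rmorphM (mmap (in_alg A) x)). Qed.

Lemma theta_linear : linear (theta x).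
Proof. by move=> a s t; rewrite thetaD thetaZ. Qed.
HB.instance Definition _ := GRing.isLinear.Build K {mpoly K[m]} A *:%R (theta x) theta_linear.

Lemma theta_monoid_morphism : monoid_morphism (theta x).
Proof. by split; [exact: theta1|exact: thetaM]. Qed.
HB.instance Definition _ :=
  GRing.isMonoidMorphism.Build {mpoly K[m]} A (theta x) theta_monoid_morphism.

Lemma thetaXU i : theta x 'X_i = x i.
Proof. by rewrite /theta mmapX mmap1U. Qed.
End ThetaComm.

Lemma mpoly_noetherian (K : fieldType) (m : nat) : noetherian {mpoly K[m]}.
Proof.
apply: (@almost_commutative_noetherian K {mpoly K[m]} m (fun i => 'X_i)) => [i j|P P0 P1 Pl PM u].
  exists 0, (fun=> 0); rewrite scale0r add0r big1 ?addr0 1?mulrC // => k _.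
  by rewrite scale0r.
rewrite [u]mpolyE; elim/big_ind: _ => // [s t Ps Pt|mon _].
  by rewrite -[s]scale1r; apply: Pl.
rewrite -[_ *: _]addr0; apply: Pl => //; rewrite mpolyXE_id.
elim: (index_enum _) => [|i r IH]; first by rewrite big_nil.
rewrite big_cons; elim: (mon i) => [|k IHk]; first by rewrite expr0 mul1r.
by rewrite exprS -mulrA; apply: PM.
Qed.

(** * Polynomials are finite over the algebra of power sums *)

Section PowerSums.
Variables (K : fieldType) (n : nat).
Hypothesis K0 : forall k : nat, k.+1%:R != 0 :> K.
Notation P := {mpoly K[n]}.

Definition powersum r : P := \sum_i 'X_i ^+ r.
Definition psum_map : {mpoly K[n]} -> P := theta (fun r : 'I_n => powersum r.+1).

Let chi : {poly P} := \prod_(i < n) ('X - ('X_i : P)%:P).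
Let psi i : {poly P} := 'X * \prod_(j < n | j != i) ('X - ('X_j : P)%:P).

Let psiE i k : (psi i)`_k = chi`_k + ('X_i : P) * (psi i)`_k.+1.
Proof.
set Q := \prod_(j < n | j != i) ('X - ('X_j : P)%:P).
have -> : chi = psi i - ('X_i : P)%:P * Q by rewrite /chi (bigD1 i) //= mulrBl.
by rewrite coefB mul_polyC coefZ /psi -/Q [('X * Q)`_k.+1]coefXM /= subrK.
Qed.

Let chi_size : size chi = n.+1.
Proof. by rewrite /chi size_prod_XsubC /index_enum -enumT size_enum_ord. Qed.

Let chi_n : chi`_n = 1.
Proof.
have : lead_coef chi = 1 by apply/monicP/monic_prod_XsubC.
by rewrite lead_coefE chi_size.
Qed.

Let psi_size i : (psi i)`_n.+1 = 0.
Proof.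
apply: nth_default; rewrite /psi mulrC size_mulX; last first.
  by apply: monic_neq0; apply: monic_prod_XsubC.
have : size chi = (size (\prod_(j < n | j != i) ('X - ('X_j : P)%:P))).+1.
  rewrite /chi (bigD1 i) //= size_monicM ?monicXsubC ?monic_neq0 ?monic_prod_XsubC //.
  by rewrite size_XsubC.
by rewrite chi_size => -[/esym e]; rewrite ltnS [X in (X <= _)%N]e.
Qed.

Let psi_coef i j : (j <= n)%N ->
  (psi i)`_(n - j) = \sum_(l < j.+1) chi`_(n - l) * 'X_i ^+ (j - l).
Proof.
elim: j => [_|j IH jn]; first by rewrite big_ord1 subn0 psiE psi_size mulr0 addr0 mulr1.
rewrite psiE -subSn // subSS IH 1?ltnW // [RHS]big_ord_recr /= subnn expr0 mulr1 addrC; congr (_ + _).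
rewrite mulr_sumr; apply: eq_bigr => l _.
by rewrite mulrCA -exprS subSn // -ltnS.
Qed.

Let psi_sum : \sum_i psi i = 'X * chi^`().
Proof.
rewrite /psi -mulr_sumr; congr (_ * _); rewrite /chi.
elim: (index_enum _) (index_enum_uniq 'I_n) => [_|i r IH /= /andP[ir /IH IHr]].
  by rewrite !big_nil derivC.
rewrite !big_cons derivM derivXsubC mul1r -IHr eqxx; congr (_ + _).
  rewrite big_seq_cond [RHS]big_seq; apply: eq_bigl => j.
  by case jr: (j \in r) => //=; apply: contraTneq jr => ->.
rewrite mulr_sumr big_seq [RHS]big_seq; apply: eq_bigr => j jr.
by rewrite big_cons; case: eqP ir => // ->; rewrite jr.
Qed.

(** Newton's identities, read off from the coefficients of X chi' = sum of the [psi i]. Solving for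
    the coefficient of [chi] in degree n - j divides by j, whence the hypothesis [K0]. *)
Let newton j : (j <= n)%N -> exists h, chi`_(n - j) = psum_map h.
Proof.
have [k] := ubnP j; elim: k j => // k IH j; rewrite ltnS => jk jn.
case: j jk jn => [|j] jk jn; first by exists 1; rewrite subn0 chi_n /psum_map theta1.
have E : chi`_(n - j.+1) *+ (n - j.+1) = \sum_(l < j.+2) chi`_(n - l) * powersum (j.+1 - l).
  have := congr1 (fun p : {poly P} => p`_(n - j.+1)) psi_sum.
  rewrite coef_sum coefXM; under eq_bigr do rewrite psi_coef //.
  rewrite exchange_big /=; under eq_bigr do rewrite -mulr_sumr.
  by move=> ->; case: (n - j.+1)%N => [|p] /=; rewrite ?mulr0n // coef_deriv.
have E2 : chi`_(n - j.+1) *+ j.+1 = - \sum_(l < j.+1) chi`_(n - l) * powersum (j.+1 - l).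
  apply/eqP; rewrite -addr_eq0; move: E; rewrite big_ord_recr /= subnn /powersum.
  under [X in _ * X]eq_bigr do rewrite expr0.
  rewrite sumr_const card_ord mulr_natr => E.
  apply/eqP; apply: (@addIr _ (chi`_(n - j.+1) *+ (n - j.+1))).
  by rewrite add0r [RHS]E addrAC -mulrnDr subnKC // addrC.
have [h Hh] : exists h, \sum_(l < j.+1) chi`_(n - l) * powersum (j.+1 - l) = psum_map h.
  elim/big_ind: _ => [|_ _ [h1 ->] [h2 ->]|l _].
  - by exists 0; rewrite /psum_map theta0.
  - by exists (h1 + h2); rewrite /psum_map thetaD.
  have [h ->] := IH l (leq_trans (ltn_ord l) jk) (leq_trans (ltnW (ltn_ord l)) jn).
  have lt : ((j.+1 - l).-1 < n)%N by have lj : (l <= j)%N := ltn_ord l; rewrite subSn //=; apply: leq_ltn_trans (leq_subr _ _) jn.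
  exists (h * 'X_(Ordinal lt)); rewrite /psum_map thetaM thetaXU /= prednK //.
  by rewrite subn_gt0.
exists (- (j.+1%:R^-1) *: h).
rewrite /psum_map thetaZ -/(psum_map h) -Hh scaleNr -scalerN -E2.
by rewrite -scaler_nat scalerA mulVf ?scale1r.
Qed.

(** Each variable is a root of [chi], whose lower coefficients are polynomials in the power sums. *)
Lemma X_integral : exists h : 'I_n -> {mpoly K[n]}, forall i : 'I_n,
  ('X_i : P) ^+ n = \sum_(k < n) psum_map (h k) * 'X_i ^+ k.
Proof.
have H (k : 'I_n) : exists h, chi`_k = psum_map h.
  by rewrite -[X in chi`_X](subKn (ltnW (ltn_ord k))); apply: newton; apply: leq_subr.
pose h (k : 'I_n) := projT1 (cid (H k)).
have hP (k : 'I_n) : chi`_k = psum_map (h k) by rewrite /h; case: cid.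
exists (fun k => - h k) => i.
have : chi.['X_i] = 0 by rewrite /chi (bigD1 i) //= hornerM hornerXsubC subrr mul0r.
rewrite horner_coef chi_size big_ord_recr /= chi_n mul1r => /eqP.
rewrite addrC addr_eq0 => /eqP ->; rewrite -sumrN; apply: eq_bigr => k _.
by rewrite hP /psum_map -[- h k]scaleN1r thetaZ scaleN1r mulNr.
Qed.

Definition psum_rmorph : {rmorphism {mpoly K[n]} -> P} := psum_map.

Lemma psum_finite (I : finType) :
  fin_gen (res_mod psum_rmorph {ffun I -> P^o}).
Proof.
have [h hP] := X_integral.
pose V := res_mod psum_rmorph {ffun I -> P^o}.
pose dl (t : I) (u : P) : V := [ffun t' => if t' == t then u else 0].
pose mon (f : {ffun 'I_n -> 'I_n}) : 'X_{1..n} := [multinom (f i : nat) | i < n].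
pose s : seq V := [seq dl t 'X_[mon f] | t <- enum I, f <- enum {ffun 'I_n -> 'I_n}].
have HS := span_submod s.
have dlD t u v : dl t (u + v) = dl t u + dl t v.
  by apply/ffunP => t'; rewrite !ffunE; case: eqP; rewrite ?addr0.
have dlZ t (c : {mpoly K[n]}) u : dl t (psum_map c * u) = c *: dl t u.
  by apply/ffunP => t'; rewrite res_scaleE !ffunE; case: eqP => // _; rewrite scaler0.
have dl_sum t (J : Type) (r : seq J) (F : J -> P) :
    dl t (\sum_(j <- r) F j) = \sum_(j <- r) dl t (F j).
  apply: (big_morph _ (dlD t)); apply/ffunP => t'.
  by rewrite !ffunE; case: eqP.
have dlX t (m : 'X_{1..n}) : span s (dl t 'X_[m]).
  have [k] := ubnP (mdeg m); elim: k m => // k IH m; rewrite ltnS => mk.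
  (* An exponent at least n is reduced by integrality, which lowers the total degree; the monomials
     left have all exponents below n and belong to [s]. *)
  have [[i mi]|Hm] := pselect (exists i, (n <= m i)%N).
    pose m' := (m - U_(i) *+ n)%MM.
    have Um : (U_(i) *+ n <= m)%MM.
      by apply/mnm_lepP => j; rewrite mulmnE mnm1E; case: eqP => [<-|]; rewrite ?mul1n.
    have em : m = (m' + U_(i) *+ n)%MM by rewrite submK.
    have n0 : (0 < n)%N by apply: leq_ltn_trans (ltn_ord i).
    rewrite em mpolyXD -mpolyXn [X in _ * X]hP mulr_sumr dl_sum.
    apply: (submod_sum HS) => j; rewrite mulrCA dlZ; apply: (submodZ HS).
    rewrite mpolyXn -mpolyXD; apply: IH; apply: leq_trans mk.
    by rewrite [X in (_ < mdeg X)%N]em !mdegD !mdegMn mdeg1 !mul1n ltn_add2l.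
  apply: span_mem; apply/allpairsP.
  have mn i : (m i < n)%N by rewrite ltnNge; apply/negP => H; apply: Hm; exists i.
  exists (t, [ffun i => Ordinal (mn i)]); rewrite !mem_enum; split=> //=.
  by congr (dl t 'X_[_]); apply/mnmP => i; rewrite mnmE ffunE.
have dlS t u : span s (dl t u).
  rewrite [u]mpolyE dl_sum; apply: (submod_sum HS) => m.
  have -> : u@_m *: 'X_[m] = psum_map (u@_m)%:MP * 'X_[m] :> P.
    by rewrite /psum_map /theta mmapC mulr_algl.
  by rewrite dlZ; apply: (submodZ HS).
exists s => v; suff : span s v by [].
have -> : v = \sum_t dl t ((v : {ffun I -> P^o}) t).
  apply/ffunP => t; rewrite [RHS](sum_ffunE) (bigD1 t) //= ffunE eqxx big1 ?addr0 // => t' tt'.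
  by rewrite ffunE eq_sym (negPf tt').
exact: (submod_sum HS).
Qed.
End PowerSums.

Lemma der_theta0 (K : fieldType) (N k : nat) (v : 'I_N -> {mpoly K[N]})
    (x : 'I_k -> {mpoly K[N]}) :
  (forall i, der v (x i) = 0) -> forall h, der v (theta x h) = 0.
Proof.
move=> Hx h; rewrite thetaE linear_sum big1 // => m _.
rewrite linearZ /= thetaX; suff -> : der v (\prod_i x i ^+ m i) = 0 by rewrite scaler0.
elim/big_ind: _ => [|a b Ha Hb|i _].
- exact: (der_nat v 1).
- by rewrite derM Ha Hb mul0r mulr0 addr0.
- elim: (m i) => [|l IH]; first exact: (der_nat v 1).
  by rewrite exprS derM Hx IH mul0r mulr0 addr0.
Qed.

Lemma pihomog_der (K : fieldType) (N : nat) (v : 'I_N -> {mpoly K[N]}) d s :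
  (forall k, v k \is 1.-homog) -> pihomog mdeg d (der v s) = der v (pihomog mdeg d s).
Proof.
move=> Hv; rewrite {1}[s]mpolyE (linear_sum (der v)) linear_sum /=.
rewrite [in RHS]pihomogE (linear_sum (der v)) /= [RHS]big_mkcond.
apply: eq_bigr => m _; rewrite !linearZ /=.
have Hm : der v 'X_[m] \is (mdeg m).-homog.
  rewrite /der; apply: rpred_sum => k _; rewrite mderivX -scalerAr.
  case: (posnP (m k)) => [->|mk]; first by rewrite scale0r dhomog0.
  apply: dhomogZ; have em : (m = U_(k) + (m - U_(k)))%MM by rewrite addmC mnm_subUK.
  rewrite [X in mdeg X]em mdegD mdeg1; apply: dhomogM => //.
  by rewrite dhomogX.
case: eqP => [<-|/eqP md]; first by rewrite pihomog_dE.
by rewrite (pihomog_ne0 md) // scaler0.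
Qed.

Section Invariants.
Variables (K : fieldType) (n N : nat).
Variables (e : 'I_N -> 'I_n * 'I_n) (e' : 'I_n * 'I_n -> 'I_N).
Hypotheses (eK : cancel e e') (e'K : cancel e' e).
Hypothesis K0 : forall k : nat, k.+1%:R != 0 :> K.
Notation S := {mpoly K[N]}.
Notation P := {mpoly K[n]}.
Notation derL a b := (der (vecL K e e' a b)).
Notation derR a b := (der (vecR K e e' a b)).

Definition genmx : 'M[S]_n := \matrix_(i, j) 'X_(e' (i, j)).
Definition trpow r : S := \tr (mxpow genmx r).
Definition trpow_map : {mpoly K[n]} -> S := theta (fun r : 'I_n => trpow r.+1).
Definition diagres : S -> P :=
  theta (fun k => if (e k).1 == (e k).2 then 'X_((e k).1) else 0).

Lemma trpow_invariant a b r : derL a b (trpow r) = derR a b (trpow r).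
Proof.
apply/subr0_eq.
have DM u v : (derL a b \- derR a b) (u * v) =
    (derL a b \- derR a b) u * v + u * (derL a b \- derR a b) v :> S.
  by rewrite /= !derM; ring.
apply: (@derivation_mxtrace S n genmx (derL a b \- derR a b : {additive S -> S}) a b DM) => i j.
by rewrite /= !mxE (derLy _ e'K) (derRy _ e'K).
Qed.

Lemma trpow_map_invariant a b h : derL a b (trpow_map h) = derR a b (trpow_map h).
Proof.
apply/subr0_eq.
have E v w (s : S) : der v s - der w s = der (fun k => v k - w k) s.
  by rewrite /der -sumrB; apply: eq_bigr => k _; rewrite mulrBl.
rewrite E; apply: der_theta0 => r; rewrite -E; apply/subr0_eq.
by rewrite subr0; apply/eqP; rewrite subr_eq0 trpow_invariant.
Qed.

Lemma diagresM s t : diagres (s * t) = diagres s * diagres t.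
Proof. exact: thetaM. Qed.
Lemma diagresD s t : diagres (s + t) = diagres s + diagres t.
Proof. exact: thetaD. Qed.
Lemma diagresZ c s : diagres (c *: s) = c *: diagres s.
Proof. exact: thetaZ. Qed.
Lemma diagres_sum (I : Type) (r : seq I) (F : I -> S) :
  diagres (\sum_(i <- r) F i) = \sum_(i <- r) diagres (F i).
Proof. exact: theta_sum. Qed.

Lemma diagres_gen i j : diagres 'X_(e' (i, j)) = (i == j)%:R * 'X_i.
Proof. by rewrite /diagres thetaXU e'K /=; case: eqP => _; rewrite ?mul1r ?mul0r. Qed.

Lemma diagres_mxpow r i j : diagres (mxpow genmx r i j) = (i == j)%:R * 'X_i ^+ r.
Proof.
elim: r i j => [|r IH] i j.
  by rewrite mxE expr0 mulr1 /diagres rmorph_nat.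
rewrite mxpowS diagres_sum (bigD1 i) //= big1 => [|k ki].
  by rewrite diagresM IH mxE diagres_gen eqxx mul1r addr0 mulrCA -exprS.
by rewrite diagresM mxE diagres_gen eq_sym (negPf ki) !mul0r.
Qed.

Lemma diagres_trpow r : diagres (trpow r) = powersum K n r.
Proof.
rewrite /trpow diagres_sum; apply: eq_bigr => i _.
by rewrite diagres_mxpow eqxx mul1r.
Qed.

Lemma diagres_trpow_map h : diagres (trpow_map h) = psum_map h.
Proof.
rewrite /diagres /trpow_map theta_map /psum_map; congr (theta _ h).
by apply/funext => r /=; rewrite -/(diagres _) diagres_trpow.
Qed.

Definition diagmon (m : 'X_{1..N}) : 'X_{1..n} := [multinom m (e' (i, i)) | i < n].

Lemma diagresX m : diagres 'X_[m] = if offdeg e m == 0%N then 'X_[diagmon m] else 0.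
Proof.
rewrite /diagres thetaX; case: eqP => [/eqP m0|/eqP m0].
  have Hm k : offdiag e k -> m k = 0%N.
    by move: m0; rewrite sum_nat_eq0 => /forallP/(_ k); case: offdiag => //=; rewrite mul1n => /eqP.
  rewrite (bigID (fun k => offdiag e k)) /= big1 ?mul1r => [|k ok]; last by rewrite Hm.
  rewrite mpolyXE_id (reindex_onto (fun i => e' (i, i)) (fun k => (e k).1)) /=; last first.
    by move=> k; rewrite negbK => /eqP ek; rewrite {2}ek -surjective_pairing eK.
  apply: eq_big => [i|i _]; first by rewrite /offdiag e'K /= !eqxx.
  by rewrite e'K /= eqxx mnmE.
have [k /andP[ok mk]] : exists k, offdiag e k && (0 < m k)%N.
  apply: contrapT => Hk; case/negP: m0; rewrite sum_nat_eq0; apply/forallP => k /=.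
  case ok : (offdiag e k) => //=; rewrite mul1n -leqn0 leqNgt; apply/negP => mk.
  by apply: Hk; exists k; rewrite ok.
rewrite (bigD1 k) //=; move: ok; rewrite /offdiag => /negPf->.
by rewrite expr0n gtn_eqF // mul0r.
Qed.

Lemma diagres_eq0 s m : diagres s = 0 -> offdeg e m = 0%N -> s@_m = 0.
Proof.
move=> Hs m0; have <- : (diagres s)@_(diagmon m) = 0 by rewrite Hs mcoeff0.
have sE : s@_m = \sum_(k <- msupp s) s@_k * (k == m)%:R.
  rewrite {1}[s]mpolyE raddf_sum; apply: eq_bigr => k _.
  by rewrite /= mcoeffZ mcoeffX.
have -> : diagres s = \sum_(k <- msupp s) s@_k *: diagres 'X_[k] by rewrite /diagres thetaE.
rewrite raddf_sum /= sE; apply: eq_bigr => k _.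
rewrite mcoeffZ diagresX; congr (_ * _).
case: (eqVneq (offdeg e k) 0%N) => k0; last first.
  by rewrite mcoeff0; case: (eqVneq k m) k0 => [->|//]; rewrite m0.
rewrite mcoeffX; congr (_%:R); congr nat_of_bool; apply/eqP/eqP => [-> //|/mnmP E].
apply/mnmP => l; have [ol|ol] := boolP (offdiag e l).
  have Z (p : 'X_{1..N}) : offdeg e p = 0%N -> p l = 0%N.
    by move=> /eqP; rewrite sum_nat_eq0 => /forallP/(_ l); rewrite ol /= mul1n => /eqP.
  by rewrite !Z.
have := E (e l).1; rewrite !mnmE.
by move: ol; rewrite negbK => /eqP el; rewrite {2 4}el -surjective_pairing eK.
Qed.

Variables (I : finType) (C : 'I_n -> 'I_n -> I -> I -> K).

(** An equivariant polynomial map from matrices to K^I, where the matrix unit E_ab acts on K^I by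
    [C a b]. *)
Definition invariant (f : I -> S) : Prop := forall a b t,
  derL a b (f t) - derR a b (f t) = \sum_t' C a b t t' *: f t'.

Lemma invariantP c f g : invariant f -> invariant g -> invariant (fun t => c *: f t + g t).
Proof.
move=> Hf Hg a b t; rewrite !derP opprD addrACA -scalerBr Hf Hg scaler_sumr -big_split.
by apply: eq_bigr => t' _; rewrite scalerDr !scalerA mulrC.
Qed.

Lemma invariant0 : invariant (fun=> 0).
Proof.
move=> a b t; have d0 (v : 'I_N -> S) : der v 0 = 0 := linear0 _.
by rewrite !d0 subrr big1 // => t' _; apply: scaler0.
Qed.

Lemma invariantM h f : invariant f -> invariant (fun t => trpow_map h * f t).
Proof.
move=> Hf a b t; rewrite !derM trpow_map_invariant opprD addrACA subrr add0r.
by rewrite -mulrBr Hf mulr_sumr; apply: eq_bigr => t' _; rewrite scalerAr.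
Qed.

Lemma invariant_pihomog d f : invariant f -> invariant (fun t => pihomog mdeg d (f t)).
Proof.
move=> Hf a b t; have X1 k : ('X_k : S) \is 1.-homog by rewrite dhomogX; apply/eqP; apply: mdeg1.
have b1 (c : bool) k : c%:R * ('X_k : S) \is 1.-homog.
  by case: c; rewrite ?mul1r ?mul0r ?dhomog0.
rewrite -(@pihomog_der _ _ (vecL K e e' a b)); last by move=> k; apply: b1.
rewrite -(@pihomog_der _ _ (vecR K e e' a b)); last by move=> k; apply: b1.
rewrite -linearB Hf linear_sum; apply: eq_bigr => t' _; exact: linearZ.
Qed.

Lemma invariant_diagres f : invariant f -> (forall t, diagres (f t) = 0) ->
  forall t, f t = 0.
Proof.
move=> Hf H0; apply: (invariant_eq0 eK e'K K0 Hf) => t m m0.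
exact: diagres_eq0.
Qed.

(** Restriction to the diagonal is injective on equivariant maps and turns traces of powers into
    power sums. The image is a submodule of a finitely generated module over a polynomial ring,
    hence finitely generated. *)
Lemma invariant_fin_gen : exists (J : finType) (g : J -> I -> S),
  (forall j, invariant (g j)) /\ forall f, invariant f ->
  exists h : J -> {mpoly K[n]}, forall t, f t = \sum_j trpow_map (h j) * g j t.
Proof.
pose V := res_mod (psum_rmorph K n) {ffun I -> P^o}.
pose B : set V := [set v | exists2 f, invariant f & v = [ffun t => diagres (f t)]].
have HB : submod_set B.
  split=> [|h _ _ [f Hf ->] [g Hg ->]].
    exists (fun=> 0); last by apply/ffunP => t; rewrite !ffunE /diagres theta0.
    exact: invariant0.
  exists (fun t => 1 *: (trpow_map h * f t) + g t); first by apply: invariantP => //; apply: invariantM.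
  apply/ffunP => t; by rewrite !ffunE scale1r diagresD diagresM diagres_trpow_map.
have [s Bs] := @mpoly_noetherian K n V (psum_finite n K0 I) B HB.
have [g Hg] : exists g : 'I_(size s) -> I -> S, forall j,
    invariant (g j) /\ s`_j = [ffun t => diagres (g j t)].
  have H (j : 'I_(size s)) : exists g, invariant g /\ s`_j = [ffun t => diagres (g t)].
    have : B s`_j by rewrite Bs; apply/span_mem/mem_nth.
    by move=> [f Hf e1]; exists f.
  by exists (fun j => projT1 (cid (H j))) => j; case: cid.
exists 'I_(size s), g; split=> [j|f Hf]; first by case: (Hg j).
have : B [ffun t => diagres (f t)] by exists f.
rewrite Bs => -[h Hh]; exists h => t; apply/subr0_eq.
pose u t := (-1) *: (\sum_j trpow_map (h j) * g j t) + f t.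
have Hu : invariant u.
  apply: invariantP => //.
  have: forall r : seq 'I_(size s), invariant (fun t => \sum_(j <- r) trpow_map (h j) * g j t).
    elim=> [|j r IH].
      have := invariant0; congr invariant; apply/funext => t'.
      by rewrite big_nil.
    have := invariantP 1 (invariantM (h j) (proj1 (Hg j))) IH.
    by congr invariant; apply/funext => t'; rewrite big_cons scale1r.
  exact.
have <- : u t = f t - \sum_j trpow_map (h j) * g j t by rewrite /u scaleN1r addrC.
apply: invariant_diagres => // t'.
rewrite /u diagresD diagresZ diagres_sum.
have := congr1 (fun w : {ffun I -> P^o} => w t') Hh; rewrite ffunE => ->.
rewrite sum_ffunE scaleN1r addrC; apply/eqP; rewrite subr_eq0; apply/eqP.
apply: eq_bigr => j _; rewrite (proj2 (Hg j)) res_scaleE !ffunE.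
by rewrite diagresM diagres_trpow_map.
Qed.

End Invariants.

(** * Centralizing families in U(gl_n) are finite over the Casimir elements *)

Section CentralizerFinite.
Variables (K : fieldType) (n : nat).
Hypothesis K0 : forall k : nat, k.+1%:R != 0 :> K.
Notation U := (Ugl K n).

Let N := #|{: 'I_n * 'I_n}|.
Let e : 'I_N -> 'I_n * 'I_n := enum_val.
Let e' : 'I_n * 'I_n -> 'I_N := enum_rank.
Let eK : cancel e e' := enum_valK.
Let e'K : cancel e' e := enum_rankK.
Notation S := {mpoly K[N]}.
Notation R := {mpoly K[n]}.
Notation tau := (@tau K n N e e').
Notation approx := (@approx K n N e e').

Definition casimir_map : R -> U := theta (fun r : 'I_n => casimir K n r.+1).

Lemma casimir_map_central h u : casimir_map h * u = u * casimir_map h.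
Proof.
rewrite /casimir_map thetaE mulr_suml mulr_sumr; apply: eq_bigr => m _.
rewrite -scalerAl -scalerAr; congr (_ *: _); rewrite thetaX.
elim/big_ind: _ => [|a b Ha Hb|i _]; first by rewrite mul1r mulr1.
  by rewrite -mulrA Hb mulrA Ha mulrA.
elim: (m i) => [|k IH]; first by rewrite mul1r mulr1.
by rewrite exprS -mulrA IH mulrA (casimir_central _ u) -mulrA.
Qed.

Let approx_glmx r i j : approx r (mxpow (glmx K n) r i j) (mxpow (genmx K e') r i j).
Proof.
elim: r i j => [|r IH] i j.
  rewrite !mxE; case: eqP => _; [exact: approx1|exact: approx0].
rewrite !mxpowS; apply: approx_sum => // k; rewrite !mxE -add1n.
by apply: approxM => //; apply: approx_glE.
Qed.

Let approx_casimir r : approx r (casimir K n r) (trpow K e' r).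
Proof. by apply: approx_sum => // i; apply: approx_glmx. Qed.

(** The degree in which the variable of index r, standing for the trace of the (r+1)-st power, has
    weight r+1. *)
Let wt (m : 'X_{1..n}) : nat := \sum_(r < n) m r * r.+1.

Let approx_casimir_map m : approx (wt m) (casimir_map 'X_[m]) (@trpow_map K n N e' 'X_[m]).
Proof.
rewrite /casimir_map /trpow_map !thetaX; apply: approx_prod => // r.
by apply: approx_exp => //; apply: approx_casimir.
Qed.

Let genmx_homog r i j : mxpow (genmx K e') r i j \is r.-homog.
Proof.
elim: r i j => [|r IH] i j.
  by rewrite mxE; case: eqP => _; [exact: dhomog1|exact: dhomog0].
rewrite mxpowS; apply: rpred_sum => k _; rewrite -add1n mxE; apply: dhomogM => //.
by rewrite dhomogX; apply/eqP; apply: mdeg1.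
Qed.

Let trpow_homog r : trpow K e' r \is r.-homog.
Proof. by apply: rpred_sum => i _; apply: genmx_homog. Qed.

Let trpow_map_homog m : @trpow_map K n N e' 'X_[m] \is (wt m).-homog.
Proof.
rewrite /trpow_map thetaX /wt; elim: (index_enum _) => [|r s IH].
  by rewrite !big_nil dhomog1.
rewrite !big_cons; apply: dhomogM => //; rewrite mulnC.
exact: dhomogMn (trpow_homog _).
Qed.

Variables (I : finType) (C : 'I_n -> 'I_n -> I -> I -> K).

Definition centralizing (b : I -> U) : Prop := forall i j t,
  glE K i j * b t - b t * glE K i j = \sum_t' C i j t t' *: b t'.

Let centralizingE b : centralizing b <-> invariant e e' C (fun t => tau (b t)).
Proof.
split=> H i j t.
  by rewrite -(tau_ad e'K) H linear_sum; apply: eq_bigr => t' _; rewrite linearZ.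
apply/subr0_eq/(tau_inj eK e'K); rewrite linearB /= (tau_ad e'K) H linear_sum.
by apply/eqP; rewrite subr_eq0; apply/eqP/eq_bigr => t' _; rewrite linearZ.
Qed.

Let trunc d (s : S) : S := \sum_(k < d.+1) pihomog mdeg k s.

Let trunc_linear d : linear (trunc d).
Proof.
move=> c s t; rewrite /trunc scaler_sumr -big_split; apply: eq_bigr => k _.
exact: linearP.
Qed.
HB.instance Definition _ d := GRing.isLinear.Build K S S *:%R (trunc d) (trunc_linear d).

Let trunc_id d s : (msize s <= d.+1)%N -> trunc d s = s.
Proof. by move=> Hs; rewrite /trunc -(pihomog_partitionE Hs). Qed.

Let trunc_homog d k s : s \is k.-homog -> trunc d s = if (k <= d)%N then s else 0.
Proof.
move=> Hs; rewrite /trunc; case: leqP => kd.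
  have kd' : (k < d.+1)%N by [].
  rewrite (bigD1 (Ordinal kd')) //= pihomog_dE // big1 ?addr0 // => l lk.
  by apply: pihomog_ne0 Hs; rewrite eq_sym.
rewrite big1 // => l _; apply: pihomog_ne0 Hs.
by rewrite gtn_eqF // (leq_trans (ltn_ord l)).
Qed.

Let homog_msize k (s : S) : s \is k.-homog -> (msize s <= k.+1)%N.
Proof. by move=> /dhomogP H; apply: msize_le => m /H; rewrite ltnS => <-. Qed.

(* Under PBW, [b] becomes an equivariant polynomial map on matrices; restricting *)
(* to the diagonal embeds these maps into a finite module over the algebra of   *)
(* power sums, and the result lifts to [U] by induction on the degree.        *)
Theorem centralizing_finite : exists (J : finType) (a : J -> I -> U),
  (forall j, centralizing (a j)) /\ forall b, centralizing b ->
  exists h : J -> R, forall t, b t = \sum_j casimir_map (h j) * a j t.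
Proof.
have [J0 [g0 [g0I g0P]]] := @invariant_fin_gen K n N e e' eK e'K K0 I C.
pose D := \max_j \max_t msize (g0 j t).
have HD j t : (msize (g0 j t) <= D)%N.
  apply: leq_trans (leq_bigmax (F := fun j => \max_t msize (g0 j t))%N j).
  exact: (leq_bigmax (F := fun t => msize (g0 j t))).
(* Each generator is split into its homogeneous components, so that degrees can be compared
   termwise. *)
pose J : finType := (J0 * 'I_D)%type.
pose g (j : J) t : S := pihomog mdeg j.2 (g0 j.1 t).
have gI j : invariant e e' C (g j) by apply: invariant_pihomog.
have gH j t : g j t \is (j.2 : nat).-homog by apply: pihomogP.
have gP f : invariant e e' C f ->
    exists h : J -> R, forall t, f t = \sum_j @trpow_map K n N e' (h j) * g j t.
  move=> /g0P[h Hh]; exists (fun j => h j.1) => t.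
  rewrite Hh -(pair_bigA _ (fun j k => @trpow_map K n N e' (h j) * g (j, k) t)) /=.
  apply: eq_bigr => j _; rewrite -mulr_sumr; congr (_ * _).
  exact: pihomog_partitionE.
have [a Ha] : exists a : J -> I -> U, forall j t, tau (a j t) = g j t.
  exists (fun j t => projT1 (cid (tau_surj eK e'K (g j t)))) => j t.
  by case: cid.
exists J, a; have aC j : centralizing (a j).
  apply/centralizingE; have := gI j; congr invariant; apply/funext => t.
  by rewrite Ha.
split=> // b; pose d := (\max_t msize (tau (b t)))%N.
have : forall t, (msize (tau (b t)) <= d)%N.
  by move=> t; exact: (leq_bigmax (F := fun t => msize (tau (b t)))).
move: d => d; elim: d b => [|d IH] b Hb bC.
  exists (fun=> 0) => t; have := Hb t; rewrite leqn0 msize_poly_eq0 => /eqP/(tau_inj eK e'K) ->.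
  by rewrite big1 // => j _; rewrite /casimir_map theta0 mul0r.
have [h Hh] := gP _ (proj1 (centralizingE b) bC).
(* The terms of degree above [d] cancel, since [tau (b t)] has degree at most [d]. After dropping
   them, each remaining term lifts to [U] with an error of degree below [d]. *)
pose h' j : R := \sum_(m <- msupp (h j) | (wt m + j.2 <= d)%N) (h j)@_m *: 'X_[m].
have Hh' t : tau (b t) = \sum_j @trpow_map K n N e' (h' j) * g j t.
  rewrite -(trunc_id (Hb t)) Hh linear_sum; apply: eq_bigr => j _.
  rewrite /= {1}/trpow_map thetaE mulr_suml linear_sum.
  rewrite /trpow_map theta_sum mulr_suml [RHS]big_mkcond; apply: eq_bigr => m _.
  rewrite -scalerAl linearZ /= (trunc_homog _ (dhomogM (trpow_map_homog m) (gH j t))).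
  case: ifP => _; last by rewrite scaler0.
  by rewrite thetaZ -scalerAl.
pose b' t := (-1) *: (\sum_j casimir_map (h' j) * a j t) + b t.
have b'C : centralizing b'.
  move=> x y t; rewrite /b' mulrDr mulrDl -scalerAr -scalerAl opprD addrACA -scalerBr bC.
  rewrite mulr_sumr mulr_suml -sumrB.
  under eq_bigr do rewrite mulrA -casimir_map_central -!mulrA -mulrBr aC mulr_sumr.
  rewrite exchange_big scaler_sumr -big_split; apply: eq_bigr => t' _ /=.
  rewrite scalerDr; congr (_ + _); rewrite scalerA mulrC -scalerA; congr (_ *: _).
  by rewrite scaler_sumr; apply: eq_bigr => j _; rewrite scalerAr.
have Hb' t : (msize (tau (b' t)) <= d)%N.
  rewrite /b' linearP /= scaleN1r Hh' linear_sum addrC /= -sumrB.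
  apply: msize_sum => j; rewrite /trpow_map /casimir_map !theta_sum !mulr_suml linear_sum -sumrB.
  rewrite -big_filter; have: all (fun m => (wt m + j.2 <= d)%N)
    [seq m <- msupp (h j) | (wt m + j.2 <= d)%N] by apply: filter_all.
  elim: [seq _ <- _ | _] => [|m r IHr]; first by rewrite big_nil msize0.
  rewrite big_cons /= => /andP[md /IHr]; apply: msizeD.
  rewrite !thetaZ -!scalerAl linearZ /= -scalerBr (leq_trans (msizeZ_le _ _)) //.
  apply: leq_trans md; rewrite -opprB -scaleN1r (leq_trans (msizeZ_le _ _)) // -Ha.
  apply: (approx_tau_mul e'K (approx_casimir_map m)).
  by rewrite Ha; apply: homog_msize.
have [h'' Hh''] := IH b' Hb' b'C.
exists (fun j => h' j + h'' j) => t.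
have -> : b t = \sum_j casimir_map (h' j) * a j t + b' t.
  by rewrite /b' scaleN1r addrA subrr add0r.
rewrite Hh'' -big_split; apply: eq_bigr => j _ /=.
by rewrite /casimir_map thetaD mulrDl.
Qed.
End CentralizerFinite.

(** * Gelfand-Zeitlin modules as locally finite modules *)

Lemma field_noetherian (K : fieldType) : noetherian K.
Proof.
apply: noetherian_left_ideals => L HL.
have [[a [La a0]]|H] := pselect (exists a, L a /\ a != 0).
  exists [:: a]; apply/seteqP; split=> [x _|].
    by exists (fun=> x / a); rewrite big_ord1 /= /GRing.scale /= divfK.
  by apply: (span_min HL) => x; rewrite mem_seq1 => /eqP->.
exists [::]; apply/seteqP; split=> [x Lx|]; last by apply: (span_min HL).
have -> : x = 0 by apply/eqP; apply: contrapT => /negP x0; apply: H; exists x.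
exact: submod0 (span_submod _).
Qed.

(* [KX] is [X] seen as a vector space: [span] over it is [lin_span] over [X].   *)
Section LocallyFiniteSpan.
Variables (K : fieldType) (A : algType K) (X : lmodType A).
Notation KX := (res_mod (in_alg A) X).

Lemma scale_algA (c : K) (a : A) (x : X) : (c *: a) *: x = c%:A *: (a *: x).
Proof. by rewrite scalerA -scalerAl mul1r. Qed.

Lemma lin_span_submod (s : seq X) : submod_set (lin_span s : set KX).
Proof. exact: (@span_submod K KX s). Qed.

Lemma lin_span0 (s : seq X) : lin_span s 0.
Proof. exact: submod0 (lin_span_submod s). Qed.

Lemma lin_spanD (s : seq X) x y : lin_span s x -> lin_span s y -> lin_span s (x + y).
Proof. exact: submodD (lin_span_submod s) x y. Qed.

Lemma lin_spanZ (s : seq X) c x : lin_span s x -> lin_span s (c%:A *: x).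
Proof. exact: submodZ (lin_span_submod s) c x. Qed.

Lemma lin_span_sum (s : seq X) (I : Type) (r : seq I) (P : pred I) (F : I -> X) :
  (forall i, P i -> lin_span s (F i)) -> lin_span s (\sum_(i <- r | P i) F i).
Proof. by move=> H; elim/big_ind: _ => //; [exact: lin_span0|exact: lin_spanD]. Qed.

Lemma lin_span_mem (s : seq X) x : x \in s -> lin_span s x.
Proof. exact: (@span_mem K KX s x). Qed.

Lemma lin_span_sub (s t : seq X) : (forall x, x \in s -> lin_span t x) ->
  lin_span s `<=` lin_span t.
Proof. exact: (@span_sub K KX s t). Qed.

Lemma lin_span_mul (s t : seq X) a : (forall x, x \in s -> lin_span t (a *: x)) ->
  forall y, lin_span s y -> lin_span t (a *: y).
Proof.
move=> H y [c ->]; rewrite scaler_sumr; apply: lin_span_sum => i _.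
rewrite scalerA -scalerAr mulr1 scale_algA.
by apply: lin_spanZ; apply/H/mem_nth.
Qed.

Lemma horner_alg_sum (q : A) (p : {poly K}) N : (size p <= N)%N ->
  horner_alg q p = \sum_(i < N) p`_i *: q ^+ i.
Proof.
move=> pN; have {1}-> : p = \sum_(i < N) p`_i *: 'X^i.
  rewrite -poly_def; apply/polyP => i; rewrite coef_poly; case: ltnP => // Ni.
  by rewrite nth_default // (leq_trans pN).
rewrite rmorph_sum; apply: eq_bigr => i _.
by rewrite -mul_polyC rmorphM rmorphXn /= horner_algC horner_algX mulr_algl.
Qed.

Lemma lin_span_powers (p : {poly K}) (q : A) (x : X) h : p != 0 -> horner_alg q p *: x = 0 ->
  lin_span [seq q ^+ j *: x | j <- iota 0 (size p)] (horner_alg q h *: x).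
Proof.
move=> p0 px; rewrite (divp_eq h p) rmorphD rmorphM /= scalerDl -scalerA px scaler0 add0r.
have rp : (size (h %% p)%R <= size p)%N by rewrite ltnW // ltn_modp.
rewrite (horner_alg_sum q rp) scaler_suml; apply: lin_span_sum => i _.
rewrite scale_algA; apply/lin_spanZ/lin_span_mem.
by apply: map_f; rewrite mem_iota ltn_ord.
Qed.

(** The [D + 1] vectors q^i x with i at most [D] lie in the span of [D] vectors, hence are linearly
    dependent. *)
Lemma lin_span_annihilator (s : seq X) (q : A) x : (forall i, lin_span s (q ^+ i *: x)) ->
  exists2 p, p != 0 & horner_alg q p *: x = 0.
Proof.
move=> H; have {H} /choice [c cE] : forall i, exists c : 'I_(size s) -> K,
  q ^+ i *: x = \sum_j (c j)%:A *: s`_j by exact: H.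
set D := size s; pose M := \matrix_(i < D.+1, j < D) c i j.
have /rowV0Pn [v /sub_kermxP vM v0] : kermx M != 0.
  rewrite -mxrank_eq0 mxrank_ker -lt0n subn_gt0.
  by rewrite (leq_ltn_trans (rank_leq_col M)).
pose p := \poly_(i < D.+1) v 0 (inord i).
have pE (i : 'I_D.+1) : p`_i = v 0 i by rewrite coef_poly ltn_ord inord_val.
exists p.
  apply: contraNneq v0 => p0; apply/eqP/rowP => i.
  by rewrite -pE p0 coef0 mxE.
have pD : (size p <= D.+1)%N by exact: size_poly.
rewrite (horner_alg_sum q pD) scaler_suml.
under eq_bigr => i _.
  rewrite pE scale_algA cE scaler_sumr.
  under eq_bigr => j _ do rewrite scalerA -scalerAl mul1r scalerA.
  over.
rewrite exchange_big /= big1 // => j _.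
rewrite -scaler_suml -scaler_suml.
have /matrixP/(_ 0 j) := vM; rewrite !mxE => vMj.
have E : \sum_(i < D.+1) v 0 i * c i j = 0.
  by rewrite -[RHS]vMj; apply: eq_bigr => i _; rewrite mxE.
by rewrite E !scale0r.
Qed.

(** The operators are added one at a time: a span stable under the earlier ones is enlarged by
    powers of the new one, and commutation preserves the stability already obtained. *)
Lemma lf_stable_span (Q : set A) (x : X) (l : seq A) :
  (forall q q', Q q -> Q q' -> q * q' = q' * q) -> lf Q x -> (forall q, q \in l -> Q q) ->
  exists s, [/\ lin_span s x, forall q y, q \in l -> lin_span s y -> lin_span s (q *: y)
    & forall y, y \in s -> lf Q y].
Proof.
move=> Qc Qx; elim: l => [|q l IH] lQ.
  exists [:: x]; split=> // [|y]; first by apply: lin_span_mem; rewrite mem_seq1.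
  by rewrite mem_seq1 => /eqP->.
have [q' q'l|s [sx sl sQ]] := IH; first by apply: lQ; rewrite in_cons q'l orbT.
have Qq : Q q by apply: lQ; rewrite mem_head.
have Ql q' : q' \in l -> Q q' by move=> H; apply: lQ; rewrite in_cons H orbT.
have /choice [d dP] : forall y, exists d : nat, y \in s -> forall h,
    lin_span [seq q ^+ j *: y | j <- iota 0 d] (horner_alg q h *: y).
  move=> y; have [ys|_] := boolP (y \in s); last by exists 0%N.
  have [p p0 py] := sQ _ ys _ Qq; exists (size p) => _ h; exact: lin_span_powers.
pose t := flatten [seq [seq q ^+ j *: y | j <- iota 0 (d y)] | y <- s].
have tP y h : y \in s -> lin_span t (horner_alg q h *: y).
  move=> ys; apply: lin_span_sub (dP _ ys h) => z zt; apply: lin_span_mem.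
  by apply/flattenP; exists [seq q ^+ j *: y | j <- iota 0 (d y)] => //; apply: map_f.
have tX y j : lin_span s y -> lin_span t (q ^+ j *: y).
  move: y; apply: lin_span_mul => y /(@tP _ ('X^j)).
  by rewrite rmorphXn /= horner_algX.
have tE z : z \in t -> exists y j, y \in s /\ z = q ^+ j *: y.
  by move=> /flattenP [? /mapP [y ys ->]] /mapP [j _ ->]; exists y, j.
exists t; split.
- by have := tX _ 0%N sx; rewrite expr0 scale1r.
- move=> q' y; rewrite in_cons => q'l; move: y; apply: lin_span_mul => z /tE [y [j [ys ->]]].
  case/predU1P: q'l => [->|q'l].
    by rewrite scalerA -exprS; apply/tX/lin_span_mem.
  rewrite scalerA (_ : q' * _ = q ^+ j * q').
    by rewrite -scalerA; apply/tX/sl => //; apply: lin_span_mem.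
  by apply: commrX; apply: Qc => //; apply: Ql.
- move=> z /tE [y [j [ys ->]]]; apply: lf_comm; last exact: sQ.
  by move=> q' Qq'; apply: commrX; apply: Qc.
Qed.

Lemma lf_theta_span n (q : 'I_n -> A) (x : X) : (forall i j, q i * q j = q j * q i) ->
  lf (range q) x -> exists s, forall h : {mpoly K[n]}, lin_span s (theta q h *: x).
Proof.
move=> qc qx; have [_ _ [i _ <-] [j _ <-] //|_ /mapP[i _ ->]|s [sx sq _]] :=
  @lf_stable_span _ x [seq q i | i : 'I_n] _ qx; first by exists i.
exists s => h; rewrite thetaE scaler_suml; apply: lin_span_sum => m _.
rewrite scale_algA thetaX; apply: lin_spanZ.
elim/big_rec: _ => [|i a _]; first by rewrite scale1r.
rewrite -scalerA; elim: (m i) => [|k IH] sa; first by rewrite expr0 scale1r.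
by rewrite exprS -scalerA; apply: sq; [apply: map_f; rewrite mem_enum|apply: IH].
Qed.
End LocallyFiniteSpan.

(** * The center acting on a tensor product with a finite-dimensional representation *)

Section Fusion.
Variables (K : fieldType) (k : nat).
Hypothesis K0 : forall m : nat, m.+1%:R != 0 :> K.
Notation U := (Ugl K k).
Notation gen := (uea_gen (@commutator K k)).
Variables (I : finType) (rho : 'M[K]_k -> I -> I -> K).
Hypothesis rho_lin : forall a x y t t', rho (a *: x + y) t t' = a * rho x t t' + rho y t t'.
Hypothesis rho_lie : forall x y t t', rho (commutator x y) t t' =
  \sum_s (rho x t s * rho y s t' - rho y t s * rho x s t').

(* [W] is the tensor product of [U] with the representation [rho] of [gl_k].   *)
(* It is free as a right [U]-module, so a central [z] acts on it by a matrix   *)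
(* over [U], which commutes with the action of [gl_k].                        *)
Let W := {ffun I -> U}.
Let r (x : 'M[K]_k) (w : W) : W := [ffun t => gen x * w t + \sum_t' rho x t t' *: w t'].

Let r_linl a x y w : r (a *: x + y) w = a *: r x w + r y w.
Proof.
apply/ffunP => t; rewrite !ffunE linearP mulrDl -scalerAl scalerDr scaler_sumr.
rewrite [RHS]addrACA; congr (_ + _).
rewrite -big_split /=; apply: eq_bigr => t' _.
by rewrite rho_lin scalerDl scalerA.
Qed.

Let r_linr x : linear (r x).
Proof.
move=> a v w; apply/ffunP => t; rewrite !ffunE mulrDr -scalerAr scalerDr scaler_sumr.
rewrite [RHS]addrACA; congr (_ + _).
rewrite -big_split /=; apply: eq_bigr => t' _.
by rewrite !ffunE scalerDr !scalerA mulrC.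
Qed.

Let rr x y w t : r x (r y w) t = gen x * (gen y * w t) +
  (\sum_t' rho y t t' *: (gen x * w t') + \sum_t' rho x t t' *: (gen y * w t')) +
  \sum_t' (\sum_s rho x t s * rho y s t') *: w t'.
Proof.
rewrite !ffunE mulrDr -!addrA; congr (_ + _); rewrite mulr_sumr; congr (_ + _).
  by apply: eq_bigr => t' _; rewrite -scalerAr.
under eq_bigr => s _ do rewrite ffunE scalerDr scaler_sumr.
rewrite big_split; congr (_ + _); rewrite exchange_big; apply: eq_bigr => t' _.
by rewrite scaler_suml; apply: eq_bigr => s _; rewrite scalerA.
Qed.

Let r_lie x y w : r (commutator x y) w = r x (r y w) - r y (r x w).
Proof.
apply/ffunP => t; rewrite [in RHS]ffunE [X in _ = _ + X]ffunE !rr ffunE uea_gen_lie.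
rewrite [X in _ = _ - (_ + X + _)]addrC [in RHS]opprD [RHS]addrACA opprD.
rewrite [X in _ = X + _]addrACA subrr addr0 mulrBl !mulrA; congr (_ + _).
rewrite -sumrB; apply: eq_bigr => t' _; rewrite -scalerBl rho_lie; congr (_ *: _).
by rewrite sumrB.
Qed.

Let uact (u : U) (w : W) : W := uea_act r u w.
Let delta (t0 : I) : W := [ffun t => (t == t0)%:R].
Let rmul (w : W) (u : U) : W := [ffun t => w t * u].

Let uact_lin u : linear (uact u). Proof. exact: uea_act_linear. Qed.
Let uact_l u : {linear W -> W} := mk_linear (uact_lin u).

Let uact_ind (P : U -> Prop) : P 0 -> P 1 ->
  (forall c u v, P u -> P v -> P (c *: u + v)) ->
  (forall x u, P u -> P (gen x * u)) -> forall u, P u.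
Proof. exact: uea_gen_ind. Qed.

Let uactP c u v w : uact (c *: u + v) w = c *: uact u w + uact v w.
Proof. by rewrite /uact uea_actD // uea_actZ. Qed.
Let uact0 w : uact 0 w = 0.
Proof. by rewrite -(scale0r 0) /uact uea_actZ // scale0r. Qed.
Let uact1 w : uact 1 w = w. Proof. exact: uea_act1. Qed.
Let uact_gen x u w : uact (gen x * u) w = r x (uact u w).
Proof. by rewrite /uact uea_actM // uea_act_gen. Qed.

Let uact_rmul u w v : uact u (rmul w v) = rmul (uact u w) v.
Proof.
move: u; apply: uact_ind => [||c u u' IH IH'|x u IH].
- by rewrite !uact0; apply/ffunP => t; rewrite !ffunE mul0r.
- by rewrite !uact1.
- by rewrite !uactP IH IH'; apply/ffunP => t; rewrite !ffunE mulrDl scalerAl.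
- rewrite !uact_gen IH; apply/ffunP => t; rewrite !ffunE mulrDl mulrA mulr_suml.
  by congr (_ + _); apply: eq_bigr => t' _; rewrite ffunE scalerAl.
Qed.

(** Encodes that a matrix [b] over [U] commutes with E_ij + rho(E_ij). *)
Let C i j (p q : I * I) : K :=
  (p.1 == q.1)%:R * rho (delta_mx i j) q.2 p.2 - (p.2 == q.2)%:R * rho (delta_mx i j) p.1 q.1.

Let fusion_centralizing z : alg_center U z ->
  centralizing C (fun p : I * I => uact z (delta p.2) p.1).
Proof.
move=> zc i j [t t0]; rewrite /= /C; set x := delta_mx i j.
have rd : r x (delta t0) = rmul (delta t0) (gen x) + \sum_t' rho x t' t0 *: delta t'.
  apply/ffunP => s; rewrite !ffunE sum_ffunE.
  have -> : gen x * (s == t0)%:R = (s == t0)%:R * gen x.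
    by case: eqP; rewrite ?mulr1 ?mul1r ?mulr0 ?mul0r.
  congr (_ + _); rewrite (bigD1 t0) //= [RHS](bigD1 s) //= !ffunE !eqxx.
  by rewrite !big1 // => t' /negbTE nt; rewrite !ffunE ?nt ?[s == t']eq_sym ?nt scaler0.
have E : r x (uact z (delta t0)) = uact z (r x (delta t0)).
  have e w : r x w = uact (gen x * 1) w by rewrite uact_gen uact1.
  rewrite !e mulr1 /uact -!uea_actM //; congr (uea_act _ _ _).
  exact: esym (zc _).
have {E} := congr1 (fun w : W => w t) E.
rewrite rd -[uact z]/(uact_l z : _ -> _) linearD linear_sum /= uact_rmul.
rewrite [in LHS]ffunE [in RHS]ffunE [X in _ = X + _]ffunE sum_ffunE => E.
have S1 (g : I -> K) (F : I * I -> U) :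
    \sum_p ((t == p.1)%:R * g p.2) *: F p = \sum_s g s *: F (t, s).
  transitivity (\sum_(p : I * I) ((t == p.1)%:R * g p.2) *: F (p.1, p.2)).
    by apply: eq_bigr => -[].
  rewrite -(pair_bigA _ (fun a b => ((t == a)%:R * g b) *: F (a, b))) /= (bigD1 t) //=.
  rewrite [X in _ + X]big1 ?addr0 => [|s /negbTE nt].
    by apply: eq_bigr => s _; rewrite eqxx mul1r.
  by apply: big1 => s0 _; rewrite eq_sym nt mul0r scale0r.
have S2 (g : I -> K) (F : I * I -> U) :
    \sum_p ((t0 == p.2)%:R * g p.1) *: F p = \sum_s g s *: F (s, t0).
  transitivity (\sum_(p : I * I) ((t0 == p.2)%:R * g p.1) *: F (p.1, p.2)).
    by apply: eq_bigr => -[].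
  rewrite -(pair_bigA _ (fun a b => ((t0 == b)%:R * g a) *: F (a, b))) /=.
  apply: eq_bigr => s _; rewrite (bigD1 t0) //= big1 ?addr0 ?eqxx ?mul1r // => s0 /negbTE nt.
  by rewrite eq_sym nt mul0r scale0r.
under [RHS]eq_bigr do rewrite scalerBl.
rewrite sumrB (S1 (fun s => rho x s t0) (fun p => uact z (delta p.2) p.1)).
rewrite (S2 (fun s => rho x t s) (fun p => uact z (delta p.2) p.1)) /=.
rewrite -/(glE K i j) in E.
apply/eqP; rewrite subr_eq -addrA [X in _ + X]addrC addrA; apply/eqP.
apply/eqP; rewrite eq_sym subr_eq eq_sym; apply/eqP; rewrite E addrC; congr (_ + _).
apply: eq_bigr => s _; rewrite -[uact z _]/(uact_l z _) linearZ /= ffunE //.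
Qed.

Variables (A : algType K) (iota : {lrmorphism U -> A}) (E : I -> A).
Hypothesis iotaE : forall x t, iota (gen x) * E t =
  E t * iota (gen x) + \sum_t' rho x t' t *: E t'.

Let Phi (w : W) : A := \sum_t E t * iota (w t).

Let Phi_act u w : iota u * Phi w = Phi (uact u w).
Proof.
move: u; apply: uact_ind => [||c u u' IH IH'|x u IH].
- by rewrite rmorph0 mul0r uact0 /Phi big1 // => t _; rewrite ffunE rmorph0 mulr0.
- by rewrite rmorph1 mul1r uact1.
- rewrite linearP mulrDl -scalerAl IH IH' uactP /Phi scaler_sumr -big_split.
  by apply: eq_bigr => t _; rewrite !ffunE linearP mulrDr scalerAr.
rewrite rmorphM -mulrA IH uact_gen /Phi; move: (uact u w) => {u IH}w.
under [RHS]eq_bigr => t _.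
  rewrite ffunE rmorphD rmorphM rmorph_sum /= mulrDr mulrA mulr_sumr.
  under eq_bigr => t' _ do rewrite linearZ /= -scalerAr.
  over.
rewrite [RHS]big_split /= exchange_big -big_split mulr_sumr; apply: eq_bigr => t _ /=.
rewrite mulrA iotaE mulrDl mulr_suml; congr (_ + _).
by apply: eq_bigr => t' _; rewrite scalerAl.
Qed.

(** The product z E_t0 is a sum of terms E_t b(t, t0), where [b] is the matrix of z on the tensor
    product. By [centralizing_finite] each entry is a combination of fixed elements with Casimir
    polynomials as coefficients, and the latter move [x] only within a finite span. *)
Lemma fusion_span (X : lmodType A) (x : X) t0 :
  lf (range (fun r : 'I_k => iota (casimir K k r.+1))) x ->
  exists s : seq X, forall z, alg_center U z -> lin_span s (iota z *: (E t0 *: x)).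
Proof.
move=> /lf_theta_span [i j|s sP].
  by rewrite -!rmorphM casimir_central.
have [J [a [_ aP]]] := @centralizing_finite K k K0 _ C.
exists [seq (E p.1 * iota (a p.2 (p.1, t0))) *: y | p <- enum {: I * J}, y <- s] => z zc.
have -> : E t0 = Phi (delta t0).
  rewrite /Phi (bigD1 t0) //= big1 => [|t /negbTE nt]; last by rewrite ffunE nt rmorph0 mulr0.
  by rewrite ffunE eqxx rmorph1 mulr1 addr0.
have [h hP] := aP _ (fusion_centralizing zc).
rewrite scalerA Phi_act /Phi scaler_suml; apply: lin_span_sum => t _.
rewrite (hP (t, t0)) rmorph_sum mulr_sumr scaler_suml; apply: lin_span_sum => j _.
rewrite casimir_map_central rmorphM /= mulrA -scalerA /casimir_map theta_map.
move: (sP (h j)); set y := _ *: x; move: y; apply: (@lin_span_mul _ _ X s _ _).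
move=> y ys; apply: lin_span_mem; apply/allpairsPdep.
by exists (t, j), y; rewrite mem_enum.
Qed.
End Fusion.

Section Inclusions.
Variable K : fieldType.
Local Notation gen n := (uea_gen (@commutator K n)).

Section Incl.
Variables (k n : nat) (kn : (k <= n)%N).

Definition incl : {lrmorphism Ugl K k -> Ugl K n} :=
  let: And3 L M _ := Ugl_inclP K kn in
  HB.pack (Ugl_incl n) (GRing.isLinear.Build K (Ugl K k) (Ugl K n) *:%R (Ugl_incl n) L)
    (GRing.isMonoidMorphism.Build (Ugl K k) (Ugl K n) (Ugl_incl n) M).

Lemma inclE u : incl u = Ugl_incl n u.
Proof. by rewrite /incl; case: Ugl_inclP. Qed.

Lemma incl_gen x : incl (gen k x) = gen n (corner n x).
Proof. by rewrite inclE; case: (Ugl_inclP K kn). Qed.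
End Incl.

Lemma Ugl_morph_ext n (A : algType K) (f g : {lrmorphism Ugl K n -> A}) :
  (forall x, f (gen n x) = g (gen n x)) -> f =1 g.
Proof.
move=> fg u; rewrite (uea_lift_uniq fg u).
by rewrite -(uea_lift_uniq (g := g) (fun x => erefl (g (gen n x))) u).
Qed.

Lemma corner_id n (x : 'M[K]_n) : corner n x = x.
Proof. by rewrite /corner pid_mx_1 mul1mx mulmx1. Qed.

Lemma corner_corner k m n (x : 'M[K]_k) : (k <= m)%N -> corner n (corner m x) = corner n x.
Proof.
move=> km; rewrite /corner !mulmxA mul_pid_mx -!mulmxA mul_pid_mx.
by rewrite !(minn_idPr km, minn_idPl km).
Qed.

Lemma incl_id n (nn : (n <= n)%N) u : incl nn u = u.
Proof.
suff H : incl nn =1 (idfun : {lrmorphism Ugl K n -> Ugl K n}) by exact: H.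
apply: Ugl_morph_ext => x.
by rewrite incl_gen corner_id.
Qed.

Lemma incl_comp k m n (km : (k <= m)%N) (mn : (m <= n)%N) (kn : (k <= n)%N) u :
  incl mn (incl km u) = incl kn u.
Proof.
suff H : (incl mn \o incl km : {lrmorphism Ugl K k -> Ugl K n}) =1 incl kn by exact: H.
apply: Ugl_morph_ext => x.
by rewrite /= !incl_gen corner_corner.
Qed.

Lemma incl_center_comm k m n (kn : (k <= n)%N) (mn : (m <= n)%N) z u : (k <= m)%N ->
  alg_center (Ugl K m) z -> incl mn z * incl kn u = incl kn u * incl mn z.
Proof. by move=> km zc; rewrite -(incl_comp km mn kn) -!rmorphM zc. Qed.
End Inclusions.

Section OrbitSpan.
Variables (K : fieldType) (A : algType K) (X : lmodType A).
Notation KX := (res_mod (in_alg A) X).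

Lemma orbit_span (Z : set A) (y : X) : Z 0 -> (forall c u v, Z u -> Z v -> Z (c *: u + v)) ->
  (exists s : seq X, forall z, Z z -> lin_span s (z *: y)) ->
  exists t : seq X, [set z *: y | z in Z] = lin_span t.
Proof.
move=> Z0 ZP [s sZ].
apply: (@fin_gen_sub K KX [set z *: y | z in Z] s (@field_noetherian K)).
  split=> [|c _ _ [u Zu <-] [v Zv <-]]; first by exists 0; rewrite ?scale0r.
  by exists (c *: u + v); [apply: ZP|rewrite scalerDl scale_algA].
by move=> _ [z /sZ H <-].
Qed.

(** The orbits of the generators under [Z] are joined; operators commuting with [Z] keep the
    stability they had on [s]. *)
Lemma lin_span_stable_add (Z : set A) (s : seq X) :
  Z 0 -> Z 1 -> (forall c u v, Z u -> Z v -> Z (c *: u + v)) ->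
  (forall u v, Z u -> Z v -> Z (u * v)) ->
  (forall y, y \in s -> exists t : seq X, forall z, Z z -> lin_span t (z *: y)) ->
  exists t : seq X, [/\ lin_span s `<=` lin_span t,
    forall z y, Z z -> lin_span t y -> lin_span t (z *: y),
    forall a, (forall z, Z z -> a * z = z * a) ->
      (forall y, lin_span s y -> lin_span s (a *: y)) ->
      forall y, lin_span t y -> lin_span t (a *: y)
  & forall x, x \in t -> exists z y, x = z *: y /\ y \in s].
Proof.
move=> Z0 Z1 ZP ZM H.
have /choice [t tP] : forall y, exists t : seq X, y \in s -> [set z *: y | z in Z] = lin_span t.
  move=> y; have [ys|_] := boolP (y \in s); last by exists [::].
  by have [t tE] := orbit_span Z0 ZP (H _ ys); exists t.
pose T := flatten [seq t y | y <- s].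
have TE x : x \in T -> exists z y, [/\ Z z, x = z *: y & y \in s].
  move=> /flattenP [_ /mapP [y ys ->] xt].
  have : lin_span (t y) x by exact: lin_span_mem.
  by rewrite -tP // => -[z Zz <-]; exists z, y.
have ZT z y : Z z -> y \in s -> lin_span T (z *: y).
  move=> Zz ys; have : lin_span (t y) (z *: y) by rewrite -tP //; exists z.
  apply: lin_span_sub => x xt; apply: lin_span_mem; apply/flattenP.
  by exists (t y) => //; apply: map_f.
have ZsT z y : Z z -> lin_span s y -> lin_span T (z *: y).
  by move=> Zz; move: y; apply: lin_span_mul => y; apply: ZT.
exists T; split.
- by move=> y /(ZsT _ _ Z1); rewrite scale1r.
- move=> z y Zz; move: y; apply: lin_span_mul => _ /TE [z' [y [Zz' -> ys]]].
  by rewrite scalerA; apply: ZT => //; apply: ZM.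
- move=> a aZ sa; apply: lin_span_mul => _ /TE [z [y [Zz -> ys]]].
  by rewrite scalerA aZ // -scalerA; apply/ZsT/sa/lin_span_mem.
- by move=> x /TE [z [y [_ -> ys]]]; exists z, y.
Qed.
End OrbitSpan.

Section GelfandZeitlin.
Variables (K : fieldType) (n : nat).
Hypothesis K0 : forall m : nat, m.+1%:R != 0 :> K.
Notation U := (Ugl K n).

Definition GZ_casimirs : set U := \bigcup_(k in [set k | (k <= n)%N])
  range (fun r : 'I_k => Ugl_incl n (casimir K k r.+1)).

Lemma lf_GZ_casimirs (X : lmodType U) (x : X) k (kn : (k <= n)%N) : lf GZ_casimirs x ->
  lf (range (fun r : 'I_k => incl K kn (casimir K k r.+1))) x.
Proof.
by apply: lfS => _ [r _ <-]; rewrite inclE; exists k => //; exists r.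
Qed.

(** Fusion with the trivial one-dimensional representation: the center of U(gl_k) is finite over the
    Casimir elements. *)
Lemma center_span (X : lmodType U) (x : X) k (kn : (k <= n)%N) : lf GZ_casimirs x ->
  exists s : seq X, forall z, alg_center (Ugl K k) z -> lin_span s (Ugl_incl n z *: x).
Proof.
move=> /(@lf_GZ_casimirs X x k kn) Hx.
have [||y t|s sP] := @fusion_span K k K0 unit (fun _ _ _ => 0) _ _ U (incl K kn) (fun=> 1) _ X x tt Hx.
- by move=> a y z t t'; rewrite mulr0 addr0.
- by move=> y z t t'; rewrite big1 // => s _; rewrite mul0r subr0.
- by rewrite mul1r mulr1 big1 ?addr0 // => s _; rewrite scale0r.
by exists s => z /sP; rewrite scale1r inclE.
Qed.

Let ad (X : 'M[K]_n) (t t' : 'I_n * 'I_n) : K := commutator X (delta_mx t'.1 t'.2) t.1 t.2.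

Let gen_glE X t : uea_gen (@commutator K n) X * glE K t.1 t.2 =
  glE K t.1 t.2 * uea_gen (@commutator K n) X + \sum_t' ad X t' t *: glE K t'.1 t'.2.
Proof.
rewrite -(pair_bigA _ (fun a b => ad X (a, b) t *: glE K a b)) /ad /=.
by rewrite -uea_gen_mx uea_gen_lie addrC subrK.
Qed.

Let ad_lie X Y t t' : ad (commutator X Y) t t' =
  \sum_s (ad X t s * ad Y s t' - ad Y t s * ad X s t').
Proof.
have adM V W : commutator V (commutator W (delta_mx t'.1 t'.2)) t.1 t.2 =
    \sum_s ad V t s * ad W s t'.
  rewrite {1}[commutator W _]matrix_sum_delta pair_bigA /=.
  have comm_lin : linear (fun Z => commutator V Z).
    by move=> c A B; rewrite /commutator mulmxDr mulmxDl -scalemxAr -scalemxAl scalerBr opprD addrACA.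
  rewrite -[commutator V _]/(mk_linear comm_lin _) linear_sum summxE.
  by apply: eq_bigr => s _; rewrite linearZ mxE mulrC.
rewrite sumrB -!adM /ad; set D := delta_mx _ _; move: D => D.
rewrite /commutator !(mulmxBl, mulmxBr) !mulmxA.
move: (X *m Y *m D) (Y *m X *m D) (D *m X *m Y) (D *m Y *m X) (X *m D *m Y) (Y *m D *m X).
by move=> *; rewrite !mxE; ring.
Qed.

(** Fusion with gl_n, seen as a representation of gl_k through the corner embedding; powers of a
    Casimir are central, so [lin_span_annihilator] applies. *)
Lemma lf_GZ_glE (X : lmodType U) (x : X) i j : lf GZ_casimirs x ->
  lf GZ_casimirs (glE K i j *: x).
Proof.
move=> Hx _ [k /= kn [r _ <-]]; have Hk := @lf_GZ_casimirs X x k kn Hx.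
have [a y z t t'|y z t t'|y t|s sP] := @fusion_span K k K0 _
    (fun y t t' => ad (corner n y) t t') _ _ U (incl K kn) (fun t => glE K t.1 t.2) _ X x (i, j) Hk.
- rewrite corner_linear /ad /commutator mulmxDl mulmxDr -scalemxAl -scalemxAr.
  by rewrite !mxE; ring.
- by rewrite corner_commutator // ad_lie.
- by rewrite incl_gen gen_glE.
apply: (@lin_span_annihilator _ _ _ s) => m; rewrite -inclE -rmorphXn; apply: sP => u.
by apply/esym/commrX/esym/casimir_central.
Qed.

Lemma lf_GZ_stable (X : lmodType U) (a : U) (x : X) :
  lf GZ_casimirs x -> lf GZ_casimirs (a *: x).
Proof.
move=> Hx; move: a; apply: Ugl_ind => [||c u v Hu Hv|i j u Hu].
- by rewrite scale0r; apply: lf0.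
- by rewrite scale1r.
- rewrite scalerDl scale_algA; apply: lfD => //; apply: lf_comm => // q _.
  by rewrite -scalerAl -scalerAr mul1r mulr1.
- by rewrite -scalerA; apply: lf_GZ_glE.
Qed.
End GelfandZeitlin.

Section GelfandZeitlinModules.
Variables (K : fieldType) (n : nat).
Hypothesis K0 : forall m : nat, m.+1%:R != 0 :> K.
Notation U := (Ugl K n).
Notation casQ := (@GZ_casimirs K n).

Lemma GZ_alg_linear c u v : GZ_alg K n u -> GZ_alg K n v -> GZ_alg K n (c *: u + v).
Proof.
move=> Hu Hv B [Bs Bg]; have [_ BP _] := Bs.
by apply/set_mem/(BP c); apply/mem_set; [apply: Hu|apply: Hv].
Qed.

Lemma GZ_alg1 : GZ_alg K n 1.
Proof. by move=> B [[B1 _ _] _]; apply: set_mem. Qed.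

Lemma GZ_alg0 : GZ_alg K n 0.
Proof. by rewrite -(addNr 1) -scaleN1r; apply: GZ_alg_linear; apply: GZ_alg1. Qed.

Lemma GZ_alg_center k z : (1 <= k <= n)%N -> alg_center (Ugl K k) z ->
  GZ_alg K n (Ugl_incl n z).
Proof. by move=> kn zc B [_ Bg]; apply: Bg; exists k => //; exists z. Qed.

Lemma alg_centerX (A : nzRingType) (z : A) i : alg_center A z -> alg_center A (z ^+ i).
Proof. by move=> zc u; apply/commr_sym/commrX/commr_sym/zc. Qed.

Lemma alg_centerP (A : algType K) c (u v : A) : alg_center A u -> alg_center A v ->
  alg_center A (c *: u + v).
Proof.
move=> uc vc a; rewrite /GRing.comm mulrDl mulrDr -scalerAl -scalerAr.
by congr (_ *: _ + _); [apply: uc|apply: vc].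
Qed.

(** The centers are treated in increasing order. Each one commutes with the earlier ones, and
    [lf_GZ_stable] keeps the new generators locally finite, so that [center_span] applies again. *)
Lemma centers_stable_span (X : lmodType U) (x : X) k : (k <= n.+1)%N -> lf casQ x ->
  exists s : seq X, [/\ lin_span s x, forall y, y \in s -> lf casQ y
    & forall j z y, (j < k)%N -> alg_center (Ugl K j) z -> lin_span s y ->
      lin_span s (Ugl_incl n z *: y)].
Proof.
move=> kn Hx; elim: k kn => [|k IH] kn.
  exists [:: x]; split=> [|y|//]; first by apply: lin_span_mem; rewrite mem_seq1.
  by rewrite mem_seq1 => /eqP->.
have [s [sx slf sZ]] := IH (ltnW kn); have kn' : (k <= n)%N by [].
have [||c _ _ [u uc <-] [v vc <-]|_ _ [u uc <-] [v vc <-]|y ys|t [st tZ ta tE]] :=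
  @lin_span_stable_add K U X (incl K kn' @` alg_center (Ugl K k)) s.
- by exists 0; rewrite ?rmorph0 // => u; rewrite /GRing.comm mul0r mulr0.
- by exists 1; rewrite ?rmorph1 // => u; rewrite /GRing.comm mul1r mulr1.
- by exists (c *: u + v); [apply: alg_centerP|rewrite linearP].
- exists (u * v); last by rewrite rmorphM.
  by move=> a; apply/commr_sym/commrM; apply/commr_sym; [apply: uc|apply: vc].
- have [t tP] := @center_span K n K0 X y k kn' (slf _ ys).
  by exists t => _ [z zc <-]; rewrite inclE; apply: tP.
exists t; split=> [|y /tE [z [y' [-> ys]]]|j z y].
- exact: st.
- by apply: lf_GZ_stable => //; apply: slf.
rewrite ltnS leq_eqVlt => /predU1P [jk|jk] zc; last first.
  have jn : (j <= n)%N by apply: leq_trans (ltnW jk) kn'.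
  apply: ta => [_ [w wc <-]|y' sy']; last exact: sZ.
  by rewrite -(inclE jn) -incl_center_comm // ltnW.
by subst j; rewrite -(inclE kn'); apply: tZ; exists z.
Qed.

Lemma GZ_alg_span (X : lmodType U) (x : X) : lf casQ x ->
  exists s : seq X, forall g, GZ_alg K n g -> lin_span s (g *: x).
Proof.
move=> /(@centers_stable_span X x n.+1 (leqnn _)) [s [sx _ sZ]]; exists s => g gG.
suff /(_ g gG) : GZ_alg K n `<=` [set a | forall y, lin_span s y -> lin_span s (a *: y)].
  by apply.
apply: smallest_sub => [|_ [k /andP[_ kn] [z zc <-]] y]; last by apply: sZ.
split=> [|c u v|u v]; rewrite !inE /=.
- by move=> y; rewrite scale1r.
- move=> Hu Hv y sy; rewrite scalerDl scale_algA.
  by apply: lin_spanD; [apply/lin_spanZ/Hu|apply: Hv].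
- by move=> Hu Hv y sy; rewrite -scalerA; apply/Hu/Hv.
Qed.

Lemma GZ_moduleE : @GZ_module K n = fgP (lf_mod casQ).
Proof.
apply/funext => M; apply/propext; split=> -[Mfg HM]; split=> // v.
  move=> _ [k /= kn [r _ <-]]; have [s sE] := HM v.
  have k1n : (1 <= k <= n)%N by rewrite kn (leq_ltn_trans (leq0n r)).
  apply: (@lin_span_annihilator _ _ _ s) => i; rewrite -sE; exists (Ugl_incl n (casimir K k r.+1) ^+ i) => //.
  rewrite -(inclE kn) -rmorphXn /= inclE; apply: GZ_alg_center => //.
  by apply: alg_centerX => u; apply: casimir_central.
have [s sP] := GZ_alg_span (HM v).
exact: (orbit_span GZ_alg0 GZ_alg_linear (ex_intro _ s sP)).
Qed.
End GelfandZeitlinModules.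

(** * Restriction of injective modules *)

Section RightBasis.
Variables (K : fieldType) (B A : algType K) (phi : {lrmorphism B -> A}).
Variables (T : Type) (v : T -> A).
(* [basis_ext] and [basis_ind] say that [v] is a basis of [A] as a right       *)
(* [B]-module.                                                                *)
Hypothesis basis_ext : forall (N : lmodType K) (F : T -> B -> N), (forall t, linear (F t)) ->
  exists2 L : A -> N, linear L & forall t b, L (v t * phi b) = F t b.
Hypothesis basis_ind : forall P : A -> Prop, P 0 ->
  (forall c x y, P x -> P y -> P (c *: x + y)) -> (forall t b, P (v t * phi b)) ->
  forall x, P x.

Let lin_eq (N : lmodType K) (L L' : A -> N) : linear L -> linear L' ->
  (forall t b, L (v t * phi b) = L' (v t * phi b)) -> L =1 L'.
Proof.
move=> HL HL' e; apply: basis_ind => // [|c x y ex ey]; last by rewrite HL HL' ex ey.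
by rewrite -[L]/(mk_linear HL : _ -> _) -[L']/(mk_linear HL' : _ -> _) !linear0.
Qed.

Let cfun_linear (N : lmodType K) (h : coind (in_alg A) N) : linear (cfun h).
Proof. by move=> c x y; rewrite -cfunP /= mulr_algl. Qed.

(** Over [B], Hom_K(A, N) is the product over [t] of the injective modules Hom_K(B, N). The map is
    extended over [K] in each component, and the components are reassembled by [basis_ext]. *)
Lemma inj_mod_res_coind (N : lmodType K) :
  inj_mod (res_mod phi (coind (in_alg A) N : lmodType A) : lmodType B).
Proof.
move=> X Y f g fg.
have gl t : linear (fun x : res_mod (in_alg B) X => cfun (g x : coind (in_alg A) N) (v t)).
  move=> c x y; rewrite linearP coind_addE; congr (_ + _).
  rewrite coind_scaleE /= linearZ rmorph1 /= mulr_algr.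
  by rewrite -(mk_linearE (cfun_linear (g x))) linearZ.
have /choice [S SP] : forall t, exists s : {linear res_mod (in_alg B) Y -> N},
    forall x, s (f x) = cfun (g x : coind (in_alg A) N) (v t).
  move=> t; have [x fx|s sP] :=
    @inj_mod_field K N _ _ (@res_lin _ _ (in_alg B) _ _ f) (mk_linear (gl t)).
    by rewrite mk_linearE fg.
  by exists s => x; rewrite -[f x]/(@res_lin _ _ (in_alg B) _ _ f x) sP.
have Fl y t : linear (fun b : B => S t (b *: y)).
  by move=> c b b'; rewrite scalerDl scale_algA -linearP.
have /choice [L LP] : forall y, exists L : A -> N, linear L /\
    forall t b, L (v t * phi b) = S t (b *: y).
  by move=> y; have [L L1 L2] := basis_ext (Fl y); exists L.
have LC y c a a' : L y (in_alg A c * a + a') = c *: L y a + L y a'.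
  by have [Ll _] := LP y; rewrite /= mulr_algl Ll.
pose s y : res_mod phi (coind (in_alg A) N) := Coind (LC y).
have sl : linear s.
  move=> b y y'; apply: coind_ext.
  apply: lin_eq; [exact: cfun_linear|exact: cfun_linear|move=> t b'].
  rewrite -[LHS]/(L (b *: y + y') (v t * phi b')).
  rewrite -[RHS]/(L y (v t * phi b' * phi b) + L y' (v t * phi b')) -mulrA -rmorphM.
  have [_ ->] := LP (b *: y + y'); have [_ ->] := LP y; have [_ ->] := LP y'.
  by rewrite scalerDr scalerA raddfD.
exists (mk_linear sl) => x; rewrite mk_linearE; apply: coind_ext.
apply: lin_eq; [exact: cfun_linear|exact: cfun_linear|move=> t b /=].
have [_ ->] := LP (f x).
by rewrite -linearZ SP linearZ.
Qed.

(** An injective module is a direct summand of the coinduced module into which it embeds. *)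
Lemma inj_mod_res (I : lmodType A) : inj_mod I -> inj_mod (res_mod phi I : lmodType B).
Proof.
move=> HI; set N : lmodType K := res_mod (in_alg A) I.
have [r rP] : exists r : {linear coind (in_alg A) N -> I}, forall x, r (coind_in (in_alg A) I x) = x.
  apply: (HI _ _ (coind_in (in_alg A) I) idfun) => x e /=.
  by apply: (@coind_in_inj _ _ (in_alg A)); rewrite e linear0.
apply: (@inj_mod_retract B _ _ (@res_lin _ _ phi _ _ (coind_in (in_alg A) I))
  (@res_lin _ _ phi _ _ r)) => [x|]; first exact: rP.
exact: inj_mod_res_coind.
Qed.
End RightBasis.

Lemma mpoly_lin_ext (K : fieldType) (m : nat) (N : lmodType K) (G : 'X_{1..m} -> N) :
  exists2 L : {mpoly K[m]} -> N, linear L & forall mon, L 'X_[mon] = G mon.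
Proof.
pose L (s : {mpoly K[m]}) := \sum_(mon <- msupp s) s@_mon *: G mon.
have LE d s : (msize s <= d)%N -> L s = \sum_(mon : 'X_{1..m < d}) s@_mon *: G mon.
  move=> sd; pose I : subFinType _ := 'X_{1..m < d}.
  rewrite /L (big_mksub I) ?msupp_uniq //=; last first.
    by move=> x /msize_mdeg_lt /leq_trans; apply.
  by rewrite big_rmcond //= => i /memN_msupp_eq0 ->; rewrite scale0r.
exists L => [c s t|mon]; last by rewrite /L msuppX big_seq1 mcoeffX eqxx scale1r.
pose d := maxn (msize (c *: s + t)) (maxn (msize s) (msize t)).
rewrite !(LE d) ?leq_max ?leqnn ?orbT // scaler_sumr -big_split; apply: eq_bigr => i _ /=.
by rewrite mcoeffD mcoeffZ scalerDl scalerA.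
Qed.

Section InclBasis.
Variables (K : fieldType) (k n : nat) (kn : (k <= n)%N).
Hypothesis K0 : forall m : nat, m.+1%:R != 0 :> K.
Notation U := (Ugl K n).

Let small (p : 'I_n * 'I_n) := ((p.1 < k) && (p.2 < k))%N.
Let T := {p : 'I_n * 'I_n | ~~ small p}.
Let a := #|{: T}|.
Let B := #|{: 'I_k * 'I_k}|.
Let f : 'I_B -> 'I_k * 'I_k := enum_val.
Let f' : 'I_k * 'I_k -> 'I_B := enum_rank.
Let fK : cancel f f' := enum_valK.
Let f'K : cancel f' f := enum_rankK.
Let w (p : 'I_k * 'I_k) : 'I_n * 'I_n := (widen_ord kn p.1, widen_ord kn p.2).
(** Positions outside the upper left block are enumerated first, so that every ordered monomial is
    some [v al] times an ordered monomial of U(gl_k). *)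
Let e (i : 'I_(a + B)) : 'I_n * 'I_n :=
  match split i with inl j => val (enum_val j : T) | inr j => w (f j) end.

Let small_w p : small (w p).
Proof. by rewrite /small /= !ltn_ord. Qed.

Let w_inj : injective w.
Proof. by move=> [i j] [i' j'] [/val_inj -> /val_inj ->]. Qed.

Let e_inj : injective e.
Proof.
move=> i j; rewrite -(splitK i) -(splitK j) /e !unsplitK.
case: (split i) => x; case: (split j) => y.
- by move=> /val_inj /enum_val_inj ->.
- by move=> E; have := valP (enum_val x : T); rewrite /= E small_w.
- by move=> E; have := valP (enum_val y : T); rewrite /= -E small_w.
- by move=> /w_inj /(can_inj fK) ->.
Qed.

Let e_surj p : exists i, e i = p.
Proof.
have [/andP[h1 h2]|h] := boolP (small p).
  exists (rshift a (f' (Ordinal h1, Ordinal h2))).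
  rewrite /e (unsplitK (inr _)) f'K; case: p h1 h2 => i j h1 h2.
  by congr (_, _); apply: val_inj.
by exists (lshift B (enum_rank (Sub p h : T))); rewrite /e (unsplitK (inl _)) enum_rankK.
Qed.

Let e' p : 'I_(a + B) := sval (cid (e_surj p)).
Let e'K : cancel e' e. Proof. by move=> p; rewrite /e'; case: cid. Qed.
Let eK : cancel e e'. Proof. by move=> i; apply: e_inj; rewrite e'K. Qed.

Let v (al : 'X_{1..a}) : U := \prod_(i < a) glx K e (lshift B i) ^+ al i.

Let corner_delta (i j : 'I_k) : corner n (delta_mx i j : 'M[K]_k) =
  delta_mx (widen_ord kn i) (widen_ord kn j).
Proof.
apply/matrixP => x y; rewrite cornerE mxE.
have H z (l : 'I_k) : (z == widen_ord kn l) = if insub (val z) is Some z' then z' == l else false.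
  case: insubP => [z' _ ez|]; first by rewrite -!val_eqE /= -ez.
  by apply: contraNF => /eqP ->; rewrite /= ltn_ord.
rewrite !H; case: insubP => [x' _ _|_] //; case: insubP => [y' _ _|_]; rewrite ?mxE ?andbF //.
Qed.

Let glx_rshift j : glx K e (rshift a j) = incl K kn (glx K f j).
Proof.
rewrite /glx /e (unsplitK (inr _)) /glE incl_gen corner_delta //.
Qed.

Let join (al : 'X_{1..a}) (be : 'X_{1..B}) : 'X_{1..a + B} :=
  [multinom match split i with inl j => al j | inr j => be j end | i < a + B].

Let theta_join al be :
  theta (glx K e) 'X_[join al be] = v al * incl K kn (theta (glx K f) 'X_[be]).
Proof.
rewrite !thetaX big_split_ord rmorph_prod; congr (_ * _); apply: eq_bigr => i _.
  by rewrite mnmE (unsplitK (inl _)).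
by rewrite mnmE (unsplitK (inr _)) rmorphXn glx_rshift.
Qed.

Let left_part (m : 'X_{1..a + B}) : 'X_{1..a} := [multinom m (lshift B i) | i < a].
Let right_part (m : 'X_{1..a + B}) : 'X_{1..B} := [multinom m (rshift a i) | i < B].

Let joinK m : join (left_part m) (right_part m) = m.
Proof.
apply/mnmP => i; rewrite mnmE -(splitK i) unsplitK.
by case: (split i) => j; rewrite mnmE.
Qed.

Let joinL al be : left_part (join al be) = al.
Proof. by apply/mnmP => i; rewrite !mnmE (unsplitK (inl _)). Qed.
Let joinR al be : right_part (join al be) = be.
Proof. by apply/mnmP => i; rewrite !mnmE (unsplitK (inr _)). Qed.

(** By PBW for both algebras, the [v al] form a basis of U(gl_n) as a right U(gl_k)-module. *)
Lemma inj_mod_res_incl (I : lmodType U) :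
  inj_mod I -> inj_mod (res_mod (incl K kn) I : lmodType (Ugl K k)).
Proof.
apply: (@inj_mod_res K _ _ (incl K kn) _ v) => [N F Fl|P P0 PP Pv x].
  have /choice [s sP] : forall u, exists s, u = theta (glx K e) s.
    exact: theta_glx_surj e'K.
  have sl : linear s.
    move=> c x y; apply/eqP; rewrite -subr_eq0; apply/eqP/(theta_inj eK e'K).
    by rewrite thetaB thetaD thetaZ -!sP subrr.
  have [L Ll LX] := @mpoly_lin_ext K _ N
    (fun m => F (left_part m) (theta (glx K f) 'X_[right_part m])).
  exists (L \o s) => [c x y|al b]; first by rewrite /= sl Ll.
  have [t ->] := theta_glx_surj f'K b.
  have linL : linear (fun b => L (s (v al * incl K kn b))).
    by move=> c x y; rewrite linearP mulrDr -scalerAr sl Ll.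
  rewrite /= -[LHS]/(mk_linear linL _) -[RHS]/(mk_linear (Fl al) _).
  rewrite (thetaE _ t) !linear_sum; apply: eq_bigr => m _; rewrite !linearZ /=; congr (_ *: _).
  change (L (s (v al * incl K kn (theta (glx K f) 'X_[m]))) = F al (theta (glx K f) 'X_[m])).
  transitivity (L 'X_[join al m]); last by rewrite LX joinL joinR.
  rewrite -theta_join; congr L.
  apply/eqP; rewrite -subr_eq0; apply/eqP/(theta_inj eK e'K).
  by rewrite thetaB -sP subrr.
have [s ->] := theta_glx_surj e'K x; rewrite thetaE.
elim/big_rec: _ => // m y _ Py; apply: PP => //.
by rewrite -[m]joinK theta_join.
Qed.
End InclBasis.

(** * Induction along the chain and conclusion *)

Section Assembly.
Variable K : fieldType.
Hypothesis K0 : forall m : nat, m.+1%:R != 0 :> K.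

Lemma Ugl_noetherian n : noetherian (Ugl K n).
Proof. exact: (@Ugl_noetherian_enum K n _ enum_val enum_rank (@enum_rankK _)). Qed.

Lemma GZ_casimirs0 : @GZ_casimirs K 0 = set0.
Proof.
apply/seteqP; split=> // _ [k /= k0 [r _ _]].
by have := ltn_ord r; rewrite ltnNge (leq_trans k0).
Qed.

Lemma GZ_casimirsS n : @GZ_casimirs K n.+1 =
  incl K (leqnSn n) @` (@GZ_casimirs K n) `|` [set` [seq casimir K n.+1 r.+1 | r : 'I_n.+1]].
Proof.
apply/seteqP; split=> [_ [k /= kn [r _ <-]]|x].
  move: kn; rewrite leq_eqVlt => /predU1P [kn|kn].
    subst k; right; rewrite -(inclE (leqnn n.+1)) incl_id /=.
    by apply/mapP; exists r; rewrite ?mem_enum.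
  have {}kn : (k <= n)%N by [].
  left; exists (Ugl_incl n (casimir K k r.+1)); first by exists k => //; exists r.
  by rewrite -(inclE kn) (incl_comp _ _ (leqW kn)) inclE.
case=> [[_ [k /= kn [r _ <-]] <-]|/= /mapP [r _ ->]].
  exists k; first exact: leqW.
  by exists r => //; rewrite -(inclE kn) (incl_comp _ _ (leqW kn)) inclE.
exists n.+1; first exact: leqnn.
by exists r => //; rewrite -(inclE (leqnn n.+1)) incl_id.
Qed.

(** For the Casimirs coming from gl_n, the claim on a U(gl_(n+1))-module follows by restriction;
    those of gl_(n+1) are central and are then adjoined one by one. *)
Lemma good_GZ_casimirs n (C : lmodType (Ugl K n)) :
  lf_mod (@GZ_casimirs K n) C -> forall d, good (@GZ_casimirs K n) d C.
Proof.
elim: n C => [|n IH] C; first by move=> _ d; rewrite GZ_casimirs0; apply: good_set0.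
rewrite GZ_casimirsS.
apply: good_lf_mod_add_centrals => [|q /mapP [r _ ->] u|{}C HC d].
- exact: Ugl_noetherian.
- exact: casimir_central.
apply: good_res => [I HI|]; first exact: inj_mod_res_incl.
by apply: IH => x; apply/lf_res/HC.
Qed.

Lemma GZ_extension_full n : extension_full (@GZ_module K n).
Proof.
rewrite (GZ_moduleE n K0); apply: extension_full_lf.
- exact: Ugl_noetherian.
- by move=> X a x; apply: lf_GZ_stable.
- exact: good_GZ_casimirs.
Qed.
End Assembly.

Local Open Scope complex_scope.

Theorem theoremA (R : realType) (n : nat) (hn : (0 < n)%N) :
  extension_full (A := Ugl R[i] n) (@GZ_module R[i] n).
Proof. by apply: GZ_extension_full => m; rewrite pnatr_eq0. Qed.
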